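(* Let $\mathcal{F}$ be a holomorphic foliation, of arbitrary codimension, on a complex manifold $M$, and let $V$ be a finite dimensional linear system on $M$. Suppose that there exists a collection $\{L_i\}_{i\in\Lambda}$ of leaves of $\mathcal{F}$ such that each leaf $L_i$ has flat contact with some nonzero element of $V$. If the analytic closure of $\bigcup_{i\in\Lambda}L_i$ is equal to $M$, then $\mathcal{F}$ admits a first integral and every leaf of $\mathcal{F}$ has flat contact with some nonzero element of $V$.
   Context: A linear system $V$ on $M$ is a vector subspace $V\subseteq H^0(M,\mathcal{L})$ for some holomorphic line bundle $\mathcal{L}$ on $M$. Foliations may have singularities; leaves are the leaves of the regular foliation on the complement of the singular set. Flat contact: for a local holomorphic vector field $X$ and a section $s$ of $\mathcal{L}$, written as a function in a local trivialization near $p$, $s$ has flat contact with $X$ at $p$ if there is no $k\ge 0$ such that the ideal generated by $s, X(s),\ldots,X^k(s)$ in the local ring $\mathcal{O}_{M,p}$ is the whole ring; equivalently, $X^k(s)(p)=0$ for all $k\ge 0$ (where $X^0(s)=s$, $X^k(s)=X(X^{k-1}(s))$; this does not depend on the trivialization). A leaf $L$ of $\mathcal{F}$ has flat contact with $s$ if, at every point of $L$, $s$ has flat contact with every local holomorphic vector field tangent to $\mathcal{F}$. The analytic closure of a subset of $M$ is the smallest closed analytic subset of $M$ containing it. A first integral of a holomorphic foliation $\mathcal{F}$ on a complex manifold $M$ is a non-constant holomorphic map $f:M\to N$, with $N$ a complex manifold, such that the fibers of $f$ are $\mathcal{F}$-invariant.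
   Formalization: The first integral is a non-constant meromorphic map to a complex manifold (holomorphic off a nowhere dense analytic set, fibers invariant there), not holomorphic on all of M: lines through 0 in C^2 with V spanned by x, y have no non-constant holomorphic first integral. *)

(* Defs.v *)
From HB Require Import structures.
From Stdlib Require Import Relation_Operators.
From mathcomp Require Import all_boot all_order all_algebra.
From mathcomp Require Import all_classical all_reals all_analysis.
From mathcomp Require Import complex.
Set Implicit Arguments.
Unset Strict Implicit.
Unset Printing Implicit Defensive.
Import Order.TTheory GRing.Theory Num.Theory numFieldNormedType.Exports.
Local Open Scope classical_set_scope.
Local Open Scope ring_scope.

(* Naming R[i] as a numFieldType makes its canonical norm and topology available. *)
Definition Cx (R : realType) : numFieldType := R[i].

(* [chart_map] and [chart_inv] are total functions whose values outside
   [chart_dom] and its image are irrelevant. *)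
Record chart (R : realType) (n : nat) (T : topologicalType) := Chart {
  chart_dom : set T;
  chart_map :> T -> 'rV[Cx R]_n;
  chart_inv : 'rV[Cx R]_n -> T;
  chart_dom_open : open chart_dom;
  chart_img_open : open (chart_map @` chart_dom);
  chart_mapK : forall x, chart_dom x -> chart_inv (chart_map x) = x;
  chart_map_cont : forall x, chart_dom x -> {for x, continuous chart_map};
  chart_inv_cont : forall z, (chart_map @` chart_dom) z ->
    {for z, continuous chart_inv} }.

Definition chart_compatible (R : realType) (n : nat) (T : topologicalType)
    (a b : chart R n T) :=
  forall x, chart_dom a x -> chart_dom b x ->
    differentiable (b \o chart_inv a) (a x) /\
    differentiable (a \o chart_inv b) (b x).

(* Manifolds are nonempty and of pure dimension n; connectedness is not assumed. *)
Record complex_manifold (R : realType) (n : nat) := ComplexManifold {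
  mcarrier :> topologicalType;
  atlas : set (chart R n mcarrier);
  mnonempty : [set: mcarrier] !=set0;
  mhausdorff : hausdorff_space mcarrier;
  msecond_countable : @second_countable mcarrier;
  atlas_cover : forall x, exists2 a, atlas a & chart_dom a x;
  atlas_compatible : forall a b, atlas a -> atlas b -> chart_compatible a b;
  atlas_maximal : forall a,
    (forall b, atlas b -> chart_compatible a b) -> atlas a }.

Definition chart_at (R : realType) (n : nat) (M : complex_manifold R n) (x : M)
  : set (chart R n M) := [set a | atlas a /\ chart_dom a x].

Section Functions.
Context (R : realType) (n : nat) (M : complex_manifold R n).

Definition holo_on (W : normedModType (Cx R)) (U : set M) (f : M -> W) :=
  forall x, U x -> forall a, chart_at x a ->
    differentiable (f \o chart_inv a) (a x).

Definition analytic_subset (Z : set M) :=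
  closed Z /\ forall p : M, exists U : set M, exists k : nat,
    exists h : 'I_k -> M -> Cx R,
    [/\ open U, U p, forall i, holo_on U (h i)
      & forall x, U x -> (Z x <-> forall i, h i x = 0)].

Definition analytic_closure (A : set M) : set M :=
  [set x | forall Z, analytic_subset Z -> A `<=` Z -> Z x].

End Functions.

Section Maps.
Context (R : realType) (n m : nat).
Context (M : complex_manifold R n) (N : complex_manifold R m).

Definition holo_map_on (U : set M) (f : M -> N) :=
  forall x, U x -> {for x, continuous f} /\
    forall a b, chart_at x a -> chart_at (f x) b ->
      differentiable (b \o f \o chart_inv a) (a x).

Definition holo_on_prod (U : set (M * N)) (h : M * N -> Cx R) :=
  forall w, U w -> forall a b, chart_at w.1 a -> chart_at w.2 b ->
    differentiable
      (fun z : 'rV[Cx R]_n * 'rV[Cx R]_m =>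
         h (chart_inv a z.1, chart_inv b z.2))
      (a w.1, b w.2).

Definition analytic_subset_prod (G : set (M * N)) :=
  closed G /\ forall w : M * N, exists U : set (M * N), exists k : nat,
    exists h : 'I_k -> M * N -> Cx R,
    [/\ open U, U w, forall i, holo_on_prod U (h i)
      & forall x, U x -> (G x <-> forall i, h i x = 0)].

(* Meromorphic maps M --> N in the sense of Remmert: f is holomorphic off the
   nowhere dense analytic subset Z, and its graph over the complement of Z
   extends to an analytic subset of M * N that is proper over M.  The set G may
   have extra components over Z; discarding these gives the closure of the
   graph.  The values of f on Z are irrelevant, and Z = set0 means that f is
   holomorphic on M. *)
Definition meromorphic_map (f : M -> N) (Z : set M) :=
  [/\ analytic_subset Z, dense (~` Z), holo_map_on (~` Z) f
    & exists G : set (M * N),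
      [/\ analytic_subset_prod G,
          forall x y, ~ Z x -> (G (x, y) <-> y = f x)
        & forall K : set M, compact K -> compact (G `&` (K `*` [set: N]))]].

End Maps.

Section VectorFields.
Context (R : realType) (n : nat) (M : complex_manifold R n).

(* A local vector field is given by its components [X a x] in each chart [a] of
   the atlas; the components are related by the differentials of the changes of
   coordinates.  Values off the open set under consideration, or off the domain
   of the chart, are irrelevant. *)
Definition vfield := chart R n M -> M -> 'rV[Cx R]_n.

Definition is_vfield (U : set M) (X : vfield) :=
  (forall a, atlas a -> holo_on (U `&` chart_dom a) (X a)) /\
  (forall x, U x -> forall a b, chart_at x a -> chart_at x b ->
     X b x = 'D_(X a x) (b \o chart_inv a) (a x)).

Definition eq_vfield_on (U : set M) (X Y : vfield) :=
  forall x, U x -> forall a, chart_at x a -> X a x = Y a x.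

(* The derivative of g along X, computed in the chart a. *)
Definition lieD (W : normedModType (Cx R)) (a : chart R n M) (X : vfield)
    (g : M -> W) : M -> W :=
  fun x => 'D_(X a x) (g \o chart_inv a) (a x).

Definition lie_bracket (X Y : vfield) : vfield :=
  fun a x => lieD a X (Y a) x - lieD a Y (X a) x.

Definition generates (F : set M -> set vfield) (U : set M) (k : nat)
    (X : 'I_k -> vfield) :=
  (forall i, F U (X i)) /\
  forall W Y q, open W -> W `<=` U -> F W Y -> W q ->
    exists W' : set M, exists g : 'I_k -> M -> Cx R,
    [/\ open W', W' q, W' `<=` W, forall i, holo_on W' (g i)
      & eq_vfield_on W' Y (fun a x => \sum_i g i x *: X i a x)].

(* Holomorphic, possibly singular, foliations: involutive coherent subsheaves
   of the tangent sheaf, [tsheaf U] being the set of sections over the open set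
   U.  A subsheaf of the (locally free) tangent sheaf is coherent as soon as it
   is locally finitely generated, by Oka's theorem.  The sheaf is not required
   to be saturated. *)
Record foliation := Foliation {
  tsheaf :> set M -> set vfield;
  tsheaf_vfield : forall U X, open U -> tsheaf U X -> is_vfield U X;
  tsheaf_restrict : forall U W X, open U -> open W -> W `<=` U ->
    tsheaf U X -> tsheaf W X;
  tsheaf_glue : forall U X, open U ->
    (forall x, U x -> exists W : set M, exists Y : vfield,
       [/\ open W, W x, W `<=` U, tsheaf W Y & eq_vfield_on W X Y]) ->
    tsheaf U X;
  tsheaf_zero : forall U, open U -> tsheaf U (fun _ _ => 0);
  tsheaf_add : forall U X Y, open U -> tsheaf U X -> tsheaf U Y ->
    tsheaf U (fun a x => X a x + Y a x);
  tsheaf_scale : forall U (g : M -> Cx R) X, open U -> holo_on U g ->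
    tsheaf U X -> tsheaf U (fun a x => g x *: X a x);
  tsheaf_finite_type : forall p : M, exists U : set M, exists k : nat,
    exists X : 'I_k -> vfield, [/\ open U, U p & generates tsheaf U X];
  tsheaf_involutive : forall U X Y, open U -> tsheaf U X -> tsheaf U Y ->
    tsheaf U (lie_bracket X Y) }.

(* Complement of the singular set: the points near which the quotient of the
   tangent sheaf by the sheaf of F is locally free. *)
Definition regular_locus (F : foliation) : set M :=
  [set p | exists U : set M, exists r : nat, exists X : 'I_r -> vfield,
     [/\ open U, U p, generates F U X
       & forall a, chart_at p a -> row_free (\matrix_(i < r) X i a p)]].

(* The norm on row vectors is the sup norm, so the image of c is the unit
   polydisc; the plaques of c are the fibres of its coordinates of index >= r. *)
Definition foliated_chart (F : foliation) (c : chart R n M) (r : nat) :=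
  [/\ atlas c, chart_dom c `<=` regular_locus F,
      c @` chart_dom c = [set z : 'rV[Cx R]_n | `|z| < 1]
    & forall W X, open W -> W `<=` chart_dom c -> is_vfield W X ->
        (F W X <-> forall x, W x -> forall j : 'I_n, (r <= j)%N ->
                     X c x ord0 j = 0)].

Definition same_plaque (F : foliation) (p q : M) :=
  exists c : chart R n M, exists r : nat,
    [/\ foliated_chart F c r, chart_dom c p, chart_dom c q
      & forall j : 'I_n, (r <= j)%N -> c p ord0 j = c q ord0 j].

Definition is_leaf (F : foliation) (L : set M) :=
  exists2 p, regular_locus F p
    & L = [set q | clos_refl_trans M (same_plaque F) p q].

End VectorFields.

Section LineBundles.
Context (R : realType) (n : nat) (M : complex_manifold R n).

(* Holomorphic line bundles, given by local trivializations over an open cover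
   and their transition functions. *)
Record line_bundle := LineBundle {
  lb_index : Type;
  lb_dom : lb_index -> set M;
  lb_trans : lb_index -> lb_index -> M -> Cx R;
  lb_open : forall i, open (lb_dom i);
  lb_cover : forall x, exists i, lb_dom i x;
  lb_holo : forall i j, holo_on (lb_dom i `&` lb_dom j) (lb_trans i j);
  lb_neq0 : forall i j x, lb_dom i x -> lb_dom j x -> lb_trans i j x != 0;
  lb_cocycle : forall i j k x, lb_dom i x -> lb_dom j x -> lb_dom k x ->
    lb_trans i j x * lb_trans j k x = lb_trans i k x }.

Definition presection (B : line_bundle) := lb_index B -> M -> Cx R.

(* Local expressions are normalized to 0 off the trivializing open sets, so
   that sections are equal iff they are equal as functions. *)
Definition global_section (B : line_bundle) : set (presection B) :=
  [set s | [/\ forall i, holo_on (lb_dom i) (s i),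
               forall i x, ~ lb_dom i x -> s i x = 0
             & forall i j x, lb_dom i x -> lb_dom j x ->
                 s i x = lb_trans i j x * s j x]].

Definition zero_section (B : line_bundle) : presection B := fun _ _ => 0.

Definition linear_system (B : line_bundle) (V : set (presection B)) :=
  [/\ V `<=` @global_section B, V (@zero_section B)
    & forall (c : Cx R) s t, V s -> V t -> V (fun i x => c * s i x + t i x)].

Definition finite_dimensional (B : line_bundle) (V : set (presection B)) :=
  exists k : nat, exists b : 'I_k -> presection B,
    (forall j, V (b j)) /\
    forall s, V s -> exists c : 'I_k -> Cx R,
      s = (fun i x => \sum_j c j * b j i x).

Definition flat_contact_at (B : line_bundle) (X : vfield M)
    (s : presection B) (p : M) :=
  forall i a, lb_dom i p -> chart_at p a ->
    forall k : nat, iter k (lieD a X) (s i) p = 0.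

Definition leaf_flat_contact (F : foliation M) (B : line_bundle) (L : set M)
    (s : presection B) :=
  forall p, L p -> forall U X, open U -> U p -> F U X ->
    flat_contact_at X s p.

End LineBundles.

(* First integrals are meromorphic maps, holomorphic when Z = set0.  Points of
   indeterminacy cannot be excluded: the foliation of C^2 by the lines through
   the origin has the first integral x/y, but any continuous map on C^2 that is
   constant on its leaves is constant.  The last clause says that the fibres of
   f, as subsets of the complement of Z, are invariant. *)
Definition first_integral (R : realType) (n m : nat)
    (M : complex_manifold R n) (N : complex_manifold R m)
    (F : foliation M) (f : M -> N) :=
  exists Z : set M,
    [/\ meromorphic_map f Z,
        exists x y, [/\ ~ Z x, ~ Z y & f x <> f y]
      & forall (L : set M) (y : N), is_leaf F L ->
          L `&` (f @^-1` [set y] `\` Z) !=set0 ->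
          L `\` Z `<=` f @^-1` [set y]].

Definition has_first_integral (R : realType) (n : nat)
    (M : complex_manifold R n) (F : foliation M) :=
  exists m : nat, exists N : complex_manifold R m, exists f : M -> N,
    first_integral F f.

(* Main.v *)
(* Call a section flat at x to order m if its derivatives at x along all words of
   length at most m in F vanish.  Since F is involutive, words are symmetric up to
   shorter words, so by polarization flat contact with the fields of F amounts to
   flatness to all orders.  For each m, the points at which some nonzero element
   of V is flat to order m form an analytic set, given locally by minors; it
   contains the leaves L_i, hence is M.  At each point the elements of V flat to
   order m form a decreasing sequence of nonzero spaces, so some nonzero element
   is flat to all orders.  Flatness to all orders propagates along plaques, since
   a holomorphic function whose iterated derivatives along v vanish at a point
   vanishes along v near that point; this gives the second assertion.

   For the first one, if M is not connected a locally constant map works.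
   Otherwise choose a tuple t_0, ..., t_(k-1) of independent elements of V, of
   minimal length, some nonzero combination d of which is flat at each point to
   each order.  Then k >= 2, and the ratio d_1 / d_0 for d flat to a large enough
   order m is a meromorphic map to the projective line: its graph is given by
   minors, and minimality keeps the locus of indeterminacy nowhere dense.  It is
   constant on leaves because combinations flat to all orders propagate, and it
   is not constant, again by minimality. *)

(* Holomorphic means differentiable over the complex numbers, so the analysis starts from Goursat's
   argument. Its only outcome used later is a bound for the differential by the supremum on a ball.
   The substitution z = e^w turns circles into vertical segments, so integrals along segments
   suffice. Existence and symmetry of second derivatives and the vanishing of flat functions all
   follow from this bound, without power series: applied k times on shrinking balls it gives k-th
   derivatives of size (C k / r)^k, and k^k <= 4^k k! makes the Taylor remainder of order k tend to
   0 on a smaller ball.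

   Flat contact is about powers of a single field. This condition is not linear in the field and
   cannot be tested on generators, hence the words. An infinite order has no finite set of local
   equations, so the loci are studied at a fixed order. The order m of the first integral is chosen
   so that the coordinate d_0 is injective on the flat combinations at one point; its value off the
   indeterminacy locus can still be read off from any combination flat to all orders there. *)
Require Import Defs.
From HB Require Import structures.
From mathcomp Require Import all_boot all_order all_algebra.
From mathcomp Require Import all_classical all_reals all_analysis.
From mathcomp Require Import complex ring lra perm.
Set Implicit Arguments.
Unset Strict Implicit.
Unset Printing Implicit Defensive.
Import Order.TTheory GRing.Theory Num.Theory numFieldNormedType.Exports.
Local Open Scope classical_set_scope.
Local Open Scope ring_scope.

(** * Real-valued norms and differentiability *)

Section RealNorm.
Context {R : realType}.
Local Notation K := (Cx R).
Implicit Types V W : normedModType K.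

Definition rc (x : R) : K := Complex x 0.
Definition re (z : K) : R := complex.Re z.
Definition im (z : K) : R := complex.Im z.
Definition mk (x y : R) : K := Complex x y.

(* Norms over [Cx R] have values in [Cx R]; [nr] is real-valued. *)
Definition nr {V} (x : V) : R := re `|x|.

Lemma rcD x y : rc (x + y) = rc x + rc y.
Proof. exact: (rmorphD (real_complex R)). Qed.
Lemma rcM x y : rc (x * y) = rc x * rc y.
Proof. exact: (rmorphM (real_complex R)). Qed.
Lemma rcN x : rc (- x) = - rc x.
Proof. exact: (rmorphN (real_complex R)). Qed.
Lemma rc0 : rc 0 = 0. Proof. by []. Qed.
Lemma rc1 : rc 1 = 1. Proof. by []. Qed.
Lemma rcV x : rc x^-1 = (rc x)^-1.
Proof. exact: (fmorphV (real_complex R)). Qed.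
Lemma rc_lt x y : (rc x < rc y) = (x < y).
Proof. exact: ltcR. Qed.
Lemma rc_le x y : (rc x <= rc y) = (x <= y).
Proof. exact: lecR. Qed.
Lemma rc_inj : injective rc. Proof. exact: complexI. Qed.

Lemma reD (z w : K) : re (z + w) = re z + re w.
Proof. by case: z w => [a b] [c d]. Qed.
Lemma imD (z w : K) : im (z + w) = im z + im w.
Proof. by case: z w => [a b] [c d]. Qed.
Lemma reN (z : K) : re (- z) = - re z. Proof. by case: z. Qed.
Lemma imN (z : K) : im (- z) = - im z. Proof. by case: z. Qed.
Lemma reM (z w : K) : re (z * w) = re z * re w - im z * im w.
Proof. by case: z w => [a b] [c d]. Qed.
Lemma imM (z w : K) : im (z * w) = re z * im w + im z * re w.
Proof. by case: z w => [a b] [c d]. Qed.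
Lemma mkE (z : K) : mk (re z) (im z) = z. Proof. by case: z. Qed.
Lemma re_im_eq (z w : K) : re z = re w -> im z = im w -> z = w.
Proof. by case: z w => [a b] [c d] /= -> ->. Qed.

Lemma nrE V (x : V) : `|x| = rc (nr x).
Proof.
rewrite /nr /re /rc; have h : (0 : R[i]) <= (`|x| : R[i]) := normr_ge0 x.
by move: (ger0_Im h); case: (`|x|) => a b /= ->.
Qed.

Lemma nr_ge0 V (x : V) : 0 <= nr x.
Proof. by rewrite -rc_le -nrE rc0 normr_ge0. Qed.
Lemma nrD V (x y : V) : nr (x + y) <= nr x + nr y.
Proof. by rewrite -rc_le rcD -!nrE ler_normD. Qed.
Lemma nrN V (x : V) : nr (- x) = nr x.
Proof. by rewrite /nr normrN. Qed.
Lemma nrB V (x y : V) : nr (x - y) = nr (y - x).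
Proof. by rewrite /nr distrC. Qed.
Lemma nrBD V (x y : V) : nr (x - y) <= nr x + nr y.
Proof. by rewrite (le_trans (nrD _ _))// nrN. Qed.
Lemma nr_trans V (x y z : V) : nr (x - z) <= nr (x - y) + nr (y - z).
Proof. by rewrite (le_trans _ (nrD _ _))// addrA subrK. Qed.
Lemma nr0 V : nr (0 : V) = 0.
Proof. by rewrite /nr normr0. Qed.
Lemma nr_eq0 V (x : V) : (nr x == 0) = (x == 0).
Proof. by rewrite -(inj_eq rc_inj) -nrE rc0 normr_eq0. Qed.
Lemma nr_gt0 V (x : V) : (0 < nr x) = (x != 0).
Proof. by rewrite lt_def nr_ge0 andbT nr_eq0. Qed.
Lemma nrZ V (a : K) (x : V) : nr (a *: x) = nr a * nr x.
Proof. by apply: rc_inj; rewrite rcM -!nrE normrZ. Qed.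
Lemma nrM (a b : K) : nr (a * b) = nr a * nr b.
Proof. by apply: rc_inj; rewrite rcM -!nrE normrM. Qed.
Lemma nrV (a : K) : nr a^-1 = (nr a)^-1.
Proof. by apply: rc_inj; rewrite rcV -!nrE normfV. Qed.
Lemma nr_rc (x : R) : nr (rc x) = `|x|.
Proof. by rewrite /nr normc_def /= expr0n addr0 sqrtr_sqr. Qed.
Lemma nr_sqrt (z : K) : nr z = Num.sqrt (re z ^+ 2 + im z ^+ 2).
Proof. by rewrite /nr normc_def. Qed.
Lemma re_le_nr (z : K) : `|re z| <= nr z.
Proof.
by rewrite nr_sqrt -sqrtr_sqr ler_sqrt ?addr_ge0 ?sqr_ge0// lerDl sqr_ge0.
Qed.
Lemma im_le_nr (z : K) : `|im z| <= nr z.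
Proof.
by rewrite nr_sqrt -sqrtr_sqr ler_sqrt ?addr_ge0 ?sqr_ge0// lerDr sqr_ge0.
Qed.
Lemma nr_le_reim (z : K) : nr z <= `|re z| + `|im z|.
Proof.
have zE : z = rc (re z) + mk 0 1 * rc (im z).
  by apply: re_im_eq; rewrite ?reD ?imD ?reM ?imM /=; ring.
rewrite {1}zE (le_trans (nrD _ _))// nrM !nr_rc.
have -> : nr (mk 0 1) = 1.
  by rewrite nr_sqrt /= expr0n expr1n add0r sqrtr1.
by rewrite mul1r.
Qed.

(** In the order of [Cx R] a positive number is real, so every epsilon can be traded for one in
    [R]. *)
Lemma gt0_rc (e : K) : 0 < e -> e = rc (re e) /\ 0 < re e.
Proof.
move=> e0; have eE : e = rc (nr e) by rewrite -nrE gtr0_norm.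
by split; [rewrite [in RHS]eE|rewrite eE /= -rc_lt -eE].
Qed.

Lemma nbhs_nr V (x : V) (A : set V) :
  nbhs x A <-> exists2 e : R, 0 < e & forall y, nr (y - x) < e -> A y.
Proof.
split=> [/nbhs_normP [e /= e0 He]|[e e0 He]].
  have [eE ep] := gt0_rc e0; exists (re e) => //.
  move=> y hy; apply: He; rewrite /= distrC nrE eE rc_lt //.
apply/nbhs_normP; exists (rc e); first by rewrite /= rc_lt.
by move=> y /=; rewrite distrC nrE rc_lt => /He.
Qed.

Lemma nbhs_neq0 (z : K) : z != 0 -> nbhs z [set w : K | w != 0].
Proof.
rewrite -nr_gt0 => z0; apply: (proj2 (@nbhs_nr _ z _)); exists (nr z) => // w hw; apply/negP => /eqP w0.
by move: hw; rewrite w0 sub0r nrN ltxx.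
Qed.

Lemma openP_nr V (A : set V) :
  open A <-> forall x, A x -> exists2 e : R, 0 < e & forall y, nr (y - x) < e -> A y.
Proof.
by rewrite openE; split=> h x /h /nbhs_nr.
Qed.

Lemma open_nr_ball V (x : V) (r : R) : open [set y | nr (y - x) < r].
Proof.
apply/openP_nr => y /= hy; exists (r - nr (y - x)); first by rewrite subr_gt0.
by move=> z hz; have := nr_trans z y x; lra.
Qed.

Lemma continuousP_nr V W (f : V -> W) (x : V) :
  {for x, continuous f} <->
  forall e : R, 0 < e -> exists2 d : R, 0 < d &
     forall y, nr (y - x) < d -> nr (f y - f x) < e.
Proof.
split=> [cf e e0|h].
  have /cf : nbhs (f x) [set w | nr (w - f x) < e] by apply/nbhs_nr; exists e.
  by move=> /nbhs_nr.
move=> A /nbhs_nr[e e0 he]; have [d d0 hd] := h e e0.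
by apply/nbhs_nr; exists d => // y /hd; exact: he.
Qed.

Lemma diff_nr V W (f : V -> W) (x : V) : differentiable f x ->
  forall e : R, 0 < e -> exists2 d : R, 0 < d &
    forall h, nr h < d -> nr (f (x + h) - f x - 'd f x h) <= e * nr h.
Proof.
move=> /diff_locallyP [_ /eqaddoP df] e e0.
have /df : 0 < rc e by rewrite rc_lt.
move=> /nbhs_nr[d d0 hd]; exists d => // h hh.
have := hd h; rewrite subr0 => /(_ hh) /=.
rewrite !fctE /= !nrE -rcM rc_le => hl.
apply: le_trans hl; rewrite le_eqVlt; apply/orP; left; apply/eqP.
by rewrite (addrC x h) /shift /= /cst opprD addrA.
Qed.

(** A linear map between arbitrary normed spaces need not be continuous; the bound [B] supplies
    continuity. *)
Lemma is_diff_nr V W (f : V -> W) (L : {linear V -> W}) (x : V) (B : R) :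
  (forall h, nr (L h) <= B * nr h) ->
  (forall e : R, 0 < e -> exists2 d : R, 0 < d &
    forall h, nr h < d -> nr (f (x + h) - f x - L h) <= e * nr h) ->
  is_diff x f L.
Proof.
move=> hB hf.
have cL : continuous L.
  move=> y; apply/continuousP_nr => e e0.
  have B1 : 0 < `|B| + 1 by rewrite ltr_wpDl.
  exists (e / (`|B| + 1)); first by rewrite divr_gt0.
  move=> z; rewrite ltr_pdivlMr// => hz.
  rewrite -linearB (le_lt_trans (hB _))//; apply: le_lt_trans hz.
  by rewrite mulrC ler_wpM2l ?nr_ge0// (le_trans (ler_norm _))// lerDl.
have hd : f \o shift x = cst (f x) + L +o_ 0 id.
  apply/eqaddoP => e e0.
  have [eE ep] := gt0_rc e0; have [//|d d0 hd] := hf (re e).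
  apply/nbhs_nr; exists d => // h; rewrite subr0 => /hd hh.
  rewrite !fctE /= !nrE eE -rcM rc_le; apply: le_trans hh.
  rewrite le_eqVlt; apply/orP; left; apply/eqP.
by rewrite (addrC x h) /shift /= /cst opprD addrA.
have dE := diff_unique cL hd.
apply: DiffDef => //; apply/diff_locallyP; split; first by rewrite dE.
by rewrite dE.
Qed.

Lemma diff_bounded V W (f : V -> W) (x : V) : differentiable f x ->
  exists2 B : R, 0 < B & forall h, nr ('d f x h) <= B * nr h.
Proof.
move=> df; have := linear_lipschitz (diff_continuous df).
move=> [k k0 hk]; have [kE kp] := gt0_rc k0; exists (re k) => // h.
by rewrite -rc_le rcM -!nrE -kE hk.
Qed.

Lemma is_derive_eps (f : R -> R) (t d : R) :
  (forall e : R, 0 < e -> exists2 b : R, 0 < b &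
    forall h, `|h| < b -> `|f (t + h) - f t - d * h| <= e * `|h|) ->
  is_derive t 1 f d.
Proof.
move=> H.
have c : h^-1 *: ((f \o shift t) (h *: 1) - f t) @[h --> 0^'] --> d.
  apply/cvgrPdist_le => e e0; have [b b0 hb] := H e e0.
  apply/nbhs_normP; exists b => //= h /=; rewrite ?sub0r ?normrN => hh h0.
  rewrite -[h^-1 *: _]/(h^-1 * _) -[h *: 1]/(h * 1) mulr1 distrC.
  have -> : h^-1 * (f (h + t) - f t) - d = h^-1 * (f (t + h) - f t - d * h).
    by rewrite (addrC h); field.
  rewrite normrM normfV mulrC ler_pdivrMr ?normr_gt0//.
  exact: hb.
by apply: DeriveDef; [apply/cvg_ex; exists d|exact: (cvg_lim _ c)].
Qed.

End RealNorm.

(** * Paths in the complex plane *)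

Section Paths.
Context {R : realType}.
Local Notation K := (Cx R).
Local Notation rc := (@rc R).

(** Componentwise, so that the mean value theorem and the fundamental theorem of calculus for real
    functions apply. *)
Definition cder (P : R -> K) (t : R) (d : K) :=
  is_derive t 1 (fun s => re (P s)) (re d) /\
  is_derive t 1 (fun s => im (P s)) (im d).

Lemma cder_eps (P : R -> K) (t : R) (d : K) :
  (forall e : R, 0 < e -> exists2 b : R, 0 < b &
    forall h, `|h| < b -> nr (P (t + h) - P t - d * rc h) <= e * `|h|) ->
  cder P t d.
Proof.
move=> H; split; apply: is_derive_eps => e e0; have [b b0 hb] := H e e0;
  exists b => // h /hb; apply: le_trans.
- rewrite (le_trans _ (re_le_nr _))// !reD !reN reM /= mulr0 subr0 //.
- rewrite (le_trans _ (im_le_nr _))// !imD !imN imM /= mulr0 add0r //.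
Qed.

Lemma cderD P Q t (a b : K) : cder P t a -> cder Q t b ->
  cder (fun s => P s + Q s) t (a + b).
Proof.
move=> [p1 p2] [q1 q2]; split.
- rewrite reD (_ : (fun s => re (P s + Q s)) = (fun s => re (P s)) + (fun s => re (Q s))).
    exact: is_deriveD.
  by apply/funext => s; rewrite reD.
- rewrite imD (_ : (fun s => im (P s + Q s)) = (fun s => im (P s)) + (fun s => im (Q s))).
    exact: is_deriveD.
  by apply/funext => s; rewrite imD.
Qed.

Lemma cderN P t (a : K) : cder P t a -> cder (fun s => - P s) t (- a).
Proof.
move=> [p1 p2]; split.
- rewrite reN (_ : (fun s => re (- P s)) = - (fun s => re (P s))).
    exact: is_deriveN.
  by apply/funext => s; rewrite reN.
- rewrite imN (_ : (fun s => im (- P s)) = - (fun s => im (P s))).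
    exact: is_deriveN.
  by apply/funext => s; rewrite imN.
Qed.

Lemma cderB P Q t (a b : K) : cder P t a -> cder Q t b ->
  cder (fun s => P s - Q s) t (a - b).
Proof. by move=> p q; apply: cderD => //; exact: cderN. Qed.

Lemma cder_affine (a b : K) t : cder (fun s => a + rc s * b) t b.
Proof.
apply: cder_eps => e e0; exists 1 => // h _.
have -> : a + rc (t + h) * b - (a + rc t * b) - b * rc h = 0 by rewrite rcD; ring.
by rewrite nr0 mulr_ge0 // ltW.
Qed.

Lemma cder_reparam P (s t u : R) (d : K) : cder P (s + u * (t - s)) d ->
  cder (fun x => P (s + x * (t - s))) u (d * rc (t - s)).
Proof.
have h : is_derive u 1 (fun x => s + x * (t - s)) (t - s).
  apply: is_derive_eps => e e0; exists 1 => // x _.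
  have -> : s + (u + x) * (t - s) - (s + u * (t - s)) - (t - s) * x = 0 by ring.
  by rewrite normr0 mulr_ge0 // ltW.
move=> [p q]; split.
- rewrite reM /= mulr0 subr0; exact: (@is_derive1_comp R (fun s => re (P s)) (fun x => s + x * (t - s)) _ _ _ p h).
- rewrite imM /= mulr0 add0r; exact: (@is_derive1_comp R (fun s => im (P s)) (fun x => s + x * (t - s)) _ _ _ q h).
Qed.

(** By the mean value theorem, b - p and b + p have nonnegative increments. *)
Lemma real_mean_value (p b p' b' : R -> R) :
  (forall t : R, 0 <= t <= 1 -> is_derive t 1 p (p' t)) ->
  (forall t : R, 0 <= t <= 1 -> is_derive t 1 b (b' t)) ->
  (forall t, 0 <= t <= 1 -> `|p' t| <= b' t) ->
  `|p 1 - p 0| <= b 1 - b 0.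
Proof.
have key (p0 b0 dp db : R -> R) :
  (forall t : R, 0 <= t <= 1 -> is_derive t 1 p0 (dp t)) ->
  (forall t : R, 0 <= t <= 1 -> is_derive t 1 b0 (db t)) ->
  (forall t, 0 <= t <= 1 -> dp t <= db t) -> p0 1 - p0 0 <= b0 1 - b0 0.
  move=> hp hb hpb.
  have hd (t : R) : 0 <= t <= 1 -> is_derive t 1 (b0 - p0) (db t - dp t).
    by move=> ht; apply: is_deriveB; [exact: hb|exact: hp].
  have [||c] := @MVT R (b0 - p0) (fun t => db t - dp t) 0 1 ltr01.
  - by move=> x; rewrite in_itv /= => /andP[x0 x1]; apply: hd; rewrite !ltW.
  - apply: derivable_within_continuous => x; rewrite in_itv /= => hx.
    exact: (@ex_derive _ _ _ _ _ _ _ (hd x hx)).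
  rewrite in_itv /= subr0 mulr1 !fctE => /andP[c0 c1] E.
  have hc : 0 <= c <= 1 by rewrite (ltW c0) (ltW c1).
  by have := hpb c hc; lra.
move=> hp hb hpb; rewrite ler_norml; apply/andP; split.
- have := key (- p) b (fun t => - p' t) b'.
  rewrite !fctE => k; have : - p 1 - - p 0 <= b 1 - b 0; last by lra.
  apply: k => // t ht; first by apply: is_deriveN; exact: hp.
  by have := hpb t ht; rewrite ler_norml => /andP[]; lra.
- apply: (key p b p' b') => // t ht.
  by have := hpb t ht; rewrite ler_norml => /andP[].
Qed.

(** The factor 2 comes from treating real and imaginary parts separately. A bound [b'] that varies
    with t is what the Taylor estimate needs. *)
Lemma mean_value (P g : R -> K) (b b' : R -> R) :
  (forall t, 0 <= t <= 1 -> cder P t (g t)) ->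
  (forall t : R, 0 <= t <= 1 -> is_derive t 1 b (b' t)) ->
  (forall t, 0 <= t <= 1 -> nr (g t) <= b' t) ->
  nr (P 1 - P 0) <= 2 * (b 1 - b 0).
Proof.
move=> hP hb hg; rewrite (le_trans (nr_le_reim _))// mulr_natl mulr2n lerD//.
- rewrite reD reN; apply: (@real_mean_value (fun s => re (P s)) b (fun s => re (g s)) b') => // t ht.
    by have [] := hP t ht.
  by rewrite (le_trans (re_le_nr _))// hg.
- rewrite imD imN; apply: (@real_mean_value (fun s => im (P s)) b (fun s => im (g s)) b') => // t ht.
    by have [] := hP t ht.
  by rewrite (le_trans (im_le_nr _))// hg.
Qed.

Lemma is_derive_lin (c t : R) : is_derive t 1 (fun s => c * s) c.
Proof.
apply: is_derive_eps => e e0; exists 1 => // x _.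
have -> : c * (t + x) - c * t - c * x = 0 by ring.
by rewrite normr0 mulr_ge0 // ltW.
Qed.

Lemma mean_value_const (P g : R -> K) (C : R) :
  (forall t, 0 <= t <= 1 -> cder P t (g t)) ->
  (forall t, 0 <= t <= 1 -> nr (g t) <= C) ->
  nr (P 1 - P 0) <= 2 * C.
Proof.
move=> hP hg; have := @mean_value P g (fun s => C * s) (fun=> C) hP.
by rewrite mulr1 mulr0 subr0; apply => // t _; exact: is_derive_lin.
Qed.

Lemma cder_line (V : normedModType K) (F : V -> K) (x u : V) (t : R) :
  differentiable F (x + rc t *: u) ->
  cder (fun s => F (x + rc s *: u)) t ('d F (x + rc t *: u) u).
Proof.
move=> dF; apply: cder_eps => e e0.
have u1 : 0 < nr u + 1 by rewrite ltr_wpDl ?nr_ge0.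
have [|d d0 hd] := diff_nr dF (e := e / (nr u + 1)); first by rewrite divr_gt0.
exists (d / (nr u + 1)); first by rewrite divr_gt0.
move=> h; rewrite ltr_pdivlMr// => hh.
have hu : nr (rc h *: u) <= `|h| * (nr u + 1).
  by rewrite nrZ nr_rc ler_wpM2l// lerDl.
have := hd (rc h *: u) (le_lt_trans hu hh).
rewrite linearZ /= -[rc h *: 'd F _ u]/(rc h * _) rcD scalerDl addrA mulrC.
move=> /le_trans; apply.
apply: (le_trans (ler_wpM2l _ hu)); first by rewrite divr_ge0 ?ltW.
by rewrite mulrCA divfK ?gt_eqF// mulrC.
Qed.

Lemma mean_value_line (V : normedModType K) (F : V -> K) (x u : V) (C : R) :
  (forall t, 0 <= t <= 1 -> differentiable F (x + rc t *: u)) ->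
  (forall t, 0 <= t <= 1 -> nr ('d F (x + rc t *: u) u) <= C) ->
  nr (F (x + u) - F x) <= 2 * C.
Proof.
move=> dF hC.
have := @mean_value_const (fun s => F (x + rc s *: u)) (fun s => 'd F (x + rc s *: u) u) C.
by rewrite rc1 scale1r rc0 scale0r addr0; apply => // t ht; apply: cder_line; exact: dF.
Qed.

Lemma real_primitive (u : R -> R) :
  (forall t, 0 <= t <= 1 -> {for t, continuous u}) ->
  exists p : R -> R, forall t : R, 0 <= t <= 1 -> is_derive t 1 p (u t).
Proof.
move=> cu.
(* Clamping extends [u] continuously to the line, so that [0, 1] lies inside the interval [-1, 2] on
   which the primitive is taken. *)
pose cl (t : R) := Num.max 0 (Num.min 1 t).
have cl01 t : 0 <= cl t <= 1 by rewrite /cl le_max lexx /= ge_max ler01 ge_min lexx.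
have clE (t : R) : 0 <= t <= 1 -> cl t = t by case/andP=> ? ?; rewrite /cl min_r// max_r.
have ccl : continuous cl.
  move=> t; apply: continuous_max; first exact: cvg_cst.
  by apply: continuous_min; [exact: cvg_cst|exact: cvg_id].
pose v := u \o cl.
have cv : continuous v by move=> t; apply: continuous_comp; [exact: ccl|exact/cu/cl01].
exists (fun x => (\int[lebesgue_measure]_(t in [set` `[(-1), x]]) v t)%R) => t /andP[t0 t1].
have t2 : t < 2 by lra.
have [|||+ E] := @continuous_FTC1_closed R v (-1) t 2 t2.
- apply: continuous_compact_integrable; first exact: segment_compact.
  exact: continuous_subspaceT.
- lra.
- exact: cv.
move=> dF; apply: DeriveDef => //; rewrite -derive1E E /v /= clE//.
by rewrite t0.
Qed.

Definition seg_primitive (f : K -> K) (a b : K) (P : R -> K) :=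
  forall t, 0 <= t <= 1 -> cder P t (f (a + rc t * (b - a)) * (b - a)).

Lemma seg_primitive_ex (f : K -> K) (a b : K) :
  (forall t, 0 <= t <= 1 -> {for a + rc t * (b - a), continuous f}) ->
  exists P, seg_primitive f a b P.
Proof.
move=> cf; pose g t := f (a + rc t * (b - a)) * (b - a).
have cg t : 0 <= t <= 1 -> forall e : R, 0 < e -> exists2 d : R, 0 < d &
   forall s, `|s - t| < d -> nr (g s - g t) < e.
  move=> ht e e0.
  have c1 : 0 < nr (b - a) + 1 by rewrite ltr_wpDl ?nr_ge0.
  have /continuousP_nr h := cf t ht.
  have [|d d0 hd] := h (e / (nr (b - a) + 1)); first by rewrite divr_gt0.
  exists (d / (nr (b - a) + 1)); first by rewrite divr_gt0.
  move=> s; rewrite ltr_pdivlMr// => hs; rewrite /g -mulrBl nrM.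
  have : nr (f (a + rc s * (b - a)) - f (a + rc t * (b - a))) < e / (nr (b - a) + 1).
    apply: hd; rewrite opprD addrACA subrr add0r -mulrBl -rcN -rcD nrM nr_rc (le_lt_trans _ hs)//.
    by rewrite ler_wpM2l// lerDl.
  rewrite ltr_pdivlMr//; apply: le_lt_trans.
  by rewrite ler_wpM2l ?nr_ge0// lerDl.
have [|p hp] := @real_primitive (fun s => re (g s)).
  move=> t ht; apply/cvgrPdist_lt => e e0; have [d d0 hd] := cg t ht e e0.
  apply/nbhs_normP; exists d => // s /=; rewrite distrC => /hd.
  by apply: le_lt_trans; rewrite distrC -reN -reD re_le_nr.
have [|q hq] := @real_primitive (fun s => im (g s)).
  move=> t ht; apply/cvgrPdist_lt => e e0; have [d d0 hd] := cg t ht e e0.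
  apply/nbhs_normP; exists d => // s /=; rewrite distrC => /hd.
  by apply: le_lt_trans; rewrite distrC -imN -imD im_le_nr.
by exists (fun t => mk (p t) (q t)) => t ht; split; [exact: hp|exact: hq].
Qed.

(* The increment along the segment of a primitive of [f], and [0] if there is none. *)
Definition seg_int (f : K -> K) (a b : K) : K :=
  xget 0 [set v | exists2 P, seg_primitive f a b P & v = P 1 - P 0].

(** Two primitives along the segment differ by a path with zero derivative, so their increments
    agree. *)
Lemma seg_intP f a b P : seg_primitive f a b P -> seg_int f a b = P 1 - P 0.
Proof.
move=> hP; rewrite /seg_int; case: xgetP => [v _ [Q hQ ->]|/(_ (P 1 - P 0))[]]; last by exists P.
apply/eqP; rewrite -subr_eq0 -nr_eq0; apply/eqP/le_anti; rewrite nr_ge0 andbT.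
have := @mean_value_const (fun s => Q s - P s) (fun=> 0) 0.
rewrite mulr0 (_ : Q 1 - Q 0 - _ = Q 1 - P 1 - (Q 0 - P 0)); last by ring.
apply => t ht; last by rewrite nr0.
by rewrite -(subrr (f (a + rc t * (b - a)) * (b - a))); apply: cderB; [exact: hQ|exact: hP].
Qed.

Lemma seg_primitive_sub f a b P (s t : R) : 0 <= s <= 1 -> 0 <= t <= 1 ->
  seg_primitive f a b P ->
  seg_primitive f (a + rc s * (b - a)) (a + rc t * (b - a))
    (fun x => P (s + x * (t - s))).
Proof.
move=> hs ht hP x hx.
have h : 0 <= s + x * (t - s) <= 1 by apply/andP; split; nra.
have := cder_reparam (hP _ h).
rewrite (_ : f _ * _ * _ = f (a + rc s * (b - a) + rc x * (a + rc t * (b - a) - (a + rc s * (b - a)))) * (a + rc t * (b - a) - (a + rc s * (b - a))))//.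
rewrite (_ : a + rc (s + x * (t - s)) * (b - a) = a + rc s * (b - a) + rc x * (a + rc t * (b - a) - (a + rc s * (b - a)))); first by rewrite rcD rcN; ring.
by rewrite rcD rcM rcD rcN; ring.
Qed.

Lemma seg_int_sub f a b P (s t : R) : 0 <= s <= 1 -> 0 <= t <= 1 ->
  seg_primitive f a b P ->
  seg_int f (a + rc s * (b - a)) (a + rc t * (b - a)) = P t - P s.
Proof.
move=> hs ht hP; rewrite (seg_intP (seg_primitive_sub hs ht hP)).
by congr (P _ - P _); ring.
Qed.

Lemma linK (V : normedModType K) (L : {linear K -> V}) (u : K) : L u = u *: L 1.
Proof. by rewrite -linearZ /= -[u *: 1]/(u * 1) mulr1. Qed.

(** Since [G] is a primitive of [g], the difference is the increment of a path with derivative (f -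
    g) (b - a). *)
Lemma seg_int_est f (G g : K -> K) (a b : K) (e : R) :
  (forall t, 0 <= t <= 1 -> {for a + rc t * (b - a), continuous f}) ->
  (forall z, is_diff z G (fun h => h * g z)) ->
  (forall t, 0 <= t <= 1 -> nr (f (a + rc t * (b - a)) - g (a + rc t * (b - a))) <= e) ->
  nr (seg_int f a b - (G b - G a)) <= 2 * (e * nr (b - a)).
Proof.
move=> cf dG hfg; have [P hP] := seg_primitive_ex cf; rewrite (seg_intP hP).
have := @mean_value_const (fun s => P s - G (a + rc s *: (b - a)))
   (fun s => (f (a + rc s * (b - a)) - g (a + rc s * (b - a))) * (b - a)) (e * nr (b - a)).
rewrite rc1 scale1r rc0 scale0r addr0 subrKC.
rewrite (_ : P 1 - P 0 - _ = P 1 - G b - (P 0 - G a)); last by ring.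
apply => t ht; last by rewrite nrM ler_wpM2r ?nr_ge0 ?hfg.
rewrite mulrBl; apply: cderB; first exact: hP.
have [dd dv] := dG (a + rc t *: (b - a)).
have := cder_line dd; rewrite dv => h; rewrite (mulrC (g _)); exact: h.
Qed.

End Paths.

(** * Cauchy's theorem on parallelograms *)

Section Goursat.
Context {R : realType}.
Local Notation K := (Cx R).
Local Notation rc := (@rc R).
Variables (f : K -> K) (p u v : K).

Definition par_pt (s t : R) : K := p + rc s * u + rc t * v.

Definition par_int (s t d : R) : K :=
  seg_int f (par_pt s t) (par_pt (s + d) t) +
  seg_int f (par_pt (s + d) t) (par_pt (s + d) (t + d)) +
  seg_int f (par_pt (s + d) (t + d)) (par_pt s (t + d)) +
  seg_int f (par_pt s (t + d)) (par_pt s t).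

Lemma nr_sum4 (a b c d : K) (m : R) : nr a <= m -> nr b <= m -> nr c <= m -> nr d <= m ->
  nr (a + b + c + d) <= 4 * m.
Proof.
move=> ha hb hc hd.
have := nrD (a + b + c) d; have := nrD (a + b) c; have := nrD a b; lra.
Qed.

Lemma nr_sum4_lt (a b c d : K) (m : R) : nr a < m -> nr b < m -> nr c < m -> nr d < m ->
  nr (a + b + c + d) < 4 * m.
Proof.
move=> ha hb hc hd.
have := nrD (a + b + c) d; have := nrD (a + b) c; have := nrD a b; lra.
Qed.

Lemma par_vec (d x y : R) : `|x| <= d -> `|y| <= d ->
  nr (rc x * u + rc y * v) <= d * (nr u + nr v + 1).
Proof.
move=> hx hy; have d0 : 0 <= d by rewrite (le_trans _ hx).
rewrite (le_trans (nrD _ _))// !nrM !nr_rc mulrDr mulr1 mulrDr -addrA lerD//.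
  by rewrite ler_wpM2r ?nr_ge0.
by rewrite -[leLHS]addr0 lerD// ler_wpM2r ?nr_ge0.
Qed.

Hypothesis df : forall s t, 0 <= s <= 1 -> 0 <= t <= 1 -> differentiable f (par_pt s t).

Lemma par_seg s t s' t' x :
  par_pt s t + rc x * (par_pt s' t' - par_pt s t) =
  par_pt (s + x * (s' - s)) (t + x * (t' - t)).
Proof. by rewrite /par_pt !rcD !rcM !rcD !rcN; ring. Qed.

Lemma cvx01 (s s' x : R) : 0 <= s <= 1 -> 0 <= s' <= 1 -> 0 <= x <= 1 ->
  0 <= s + x * (s' - s) <= 1.
Proof. by move=> *; apply/andP; split; nra. Qed.

Lemma par_prim s t s' t' : 0 <= s <= 1 -> 0 <= t <= 1 -> 0 <= s' <= 1 -> 0 <= t' <= 1 ->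
  exists P, seg_primitive f (par_pt s t) (par_pt s' t') P.
Proof.
move=> hs ht hs' ht'; apply: seg_primitive_ex => x hx; rewrite par_seg.
by apply/differentiable_continuous/df; exact: cvx01.
Qed.

(** The three points may come in any order; reversal of a segment is obtained from the case
    [x = z]. *)
Lemma par_int_add s t s' t' (x y z : R) :
  0 <= s <= 1 -> 0 <= t <= 1 -> 0 <= s' <= 1 -> 0 <= t' <= 1 ->
  0 <= x <= 1 -> 0 <= y <= 1 -> 0 <= z <= 1 ->
  let q x := par_pt (s + x * (s' - s)) (t + x * (t' - t)) in
  seg_int f (q x) (q z) = seg_int f (q x) (q y) + seg_int f (q y) (q z).
Proof.
move=> hs ht hs' ht' hx hy hz q; rewrite /q -!par_seg.
have [P hP] := par_prim hs ht hs' ht'.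
by rewrite !(seg_int_sub _ _ hP)//; ring.
Qed.

(** Each outer side is cut at its midpoint, and every inner side occurs twice with opposite
    orientations. *)
Lemma par_int_half (s t d : R) : 0 <= s -> 0 <= t -> 0 <= d -> s + d <= 1 -> t + d <= 1 ->
  par_int s t d = par_int s t (d / 2) + par_int (s + d / 2) t (d / 2) +
    par_int s (t + d / 2) (d / 2) + par_int (s + d / 2) (t + d / 2) (d / 2).
Proof.
move=> s0 t0 d0 s1 t1.
have a1 a b c e : 0 <= a <= 1 -> 0 <= b <= 1 -> 0 <= c <= 1 -> 0 <= e <= 1 ->
   seg_int f (par_pt a b) (par_pt c e) =
   seg_int f (par_pt a b) (par_pt ((a + c) / 2) ((b + e) / 2)) +
   seg_int f (par_pt ((a + c) / 2) ((b + e) / 2)) (par_pt c e).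
  move=> ha hb hc he.
  have /= := @par_int_add a b c e 0 (1/2) 1 ha hb hc he.
  have c0 (y z : R) : y + 0 * (z - y) = y by ring.
  have c1 (y z : R) : y + 1 * (z - y) = z by ring.
  have ch (y z : R) : y + 1 / 2 * (z - y) = (y + z) / 2 by field.
  by rewrite !c0 !c1 !ch; apply; lra.
have a2 a b c e : 0 <= a <= 1 -> 0 <= b <= 1 -> 0 <= c <= 1 -> 0 <= e <= 1 ->
   seg_int f (par_pt a b) (par_pt c e) = - seg_int f (par_pt c e) (par_pt a b).
  move=> ha hb hc he; have /= := @par_int_add a b c e 0 1 0 ha hb hc he.
  have /= := @par_int_add a b c e 0 0 0 ha hb hc he.
  have c0 (y z : R) : y + 0 * (z - y) = y by ring.
  have c1 (y z : R) : y + 1 * (z - y) = z by ring.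
  rewrite !c0 !c1.
  have i0 : 0 <= (0 : R) <= 1 by rewrite lexx ler01.
  have i1 : 0 <= (1 : R) <= 1 by rewrite lexx ler01.
  move=> /(_ i0 i0 i0) h1 /(_ i0 i1 i0) h2.
  have h3 : seg_int f (par_pt a b) (par_pt a b) = 0.
    by apply: (addrI (seg_int f (par_pt a b) (par_pt a b))); rewrite addr0 -h1.
  by apply/eqP; rewrite -addr_eq0 -h2 h3.
have E2 x : x + d / 2 + d / 2 = x + d by field.
rewrite /par_int !E2.
have i1 : 0 <= s <= 1 by apply/andP; split; lra.
have i2 : 0 <= s + d <= 1 by apply/andP; split; lra.
have i3 : 0 <= s + d / 2 <= 1 by apply/andP; split; lra.
have i4 : 0 <= t <= 1 by apply/andP; split; lra.
have i5 : 0 <= t + d <= 1 by apply/andP; split; lra.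
have i6 : 0 <= t + d / 2 <= 1 by apply/andP; split; lra.
rewrite (a1 s t (s + d) t)// (a1 (s + d) t (s + d) (t + d))//.
rewrite (a1 (s + d) (t + d) s (t + d))// (a1 s (t + d) s t)//.
rewrite (_ : (s + (s + d)) / 2 = s + d / 2); last by field.
rewrite (_ : (s + d + s) / 2 = s + d / 2); last by field.
rewrite (_ : (t + (t + d)) / 2 = t + d / 2); last by field.
rewrite (_ : (t + d + t) / 2 = t + d / 2); last by field.
rewrite (_ : (s + d + (s + d)) / 2 = s + d); last by field.
rewrite (_ : (t + d + (t + d)) / 2 = t + d); last by field.
rewrite (_ : (t + t) / 2 = t); last by field.
rewrite (_ : (s + s) / 2 = s); last by field.
rewrite (a2 (s + d / 2) (t + d / 2) s (t + d / 2))//.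
rewrite (a2 (s + d / 2) (t + d / 2) (s + d / 2) t)//.
rewrite (a2 (s + d) (t + d / 2) (s + d / 2) (t + d / 2))//.
rewrite (a2 (s + d / 2) (t + d) (s + d / 2) (t + d / 2))//.
ring.
Qed.

(** Near a point where [f] is differentiable it equals its affine approximation [g] up to a small
    multiple of the distance. The primitive [G] of [g] has increments that cancel around the
    boundary, so only the error contributes. *)
Lemma par_int_small (e : R) (S T : R) : 0 < e -> 0 <= S <= 1 -> 0 <= T <= 1 ->
  exists2 b : R, 0 < b & forall s t d, 0 <= s <= S -> S <= s + d <= 1 ->
    0 <= t <= T -> T <= t + d <= 1 -> d < b -> nr (par_int s t d) <= e * d ^+ 2.
Proof.
move=> e0 hS hT.
pose C := nr u + nr v + 1.
have C0 : 0 < C by rewrite ltr_wpDl// addr_ge0 ?nr_ge0.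
(* The 8 is made of the four sides and the factor 2 of [mean_value]. *)
pose z0 := par_pt S T; pose e1 := e / (8 * C ^+ 2).
have e10 : 0 < e1 by rewrite divr_gt0// mulr_gt0// exprn_gt0.
have [b b0 hb] := diff_nr (df hS hT) e10.
exists (b / C); first by rewrite divr_gt0.
move=> s t d /andP[s0 s1] /andP[s2 s3] /andP[t0 t1] /andP[t2 t3]; rewrite ltr_pdivlMr// => hd.
have d0 : 0 <= d by lra.
pose c := 'd f z0 1.
pose G z := f z0 * z + c * (2^-1 * (z - z0) ^+ 2).
pose g z := f z0 + c * (z - z0).
have dG z : is_diff z G (fun h => h * g z).
  have sE (y w : K) : y *: w = y * w by [].
  have -> : G = f z0 *: (id : K -> K) + (c * 2^-1) *: ((id - cst z0 : K -> K) ^+ 2).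
    by apply/funext => w; rewrite /G !fctE !sE mulrA.
  have d1 : is_diff z (id - cst z0 : K -> K) (id - 0) by exact: is_diffB.
  have d2 := is_diffX 1 d1.
  have d3 := is_diffZ (c * 2^-1) d2.
  have d4 := is_diffZ (f z0) (is_diff_id z).
  have d5 := is_diffD d4 d3.
  apply: (is_diff_eq d5).
  apply/funext => h.
  rewrite /g !fctE !sE expr1.
  by field.
have near (s' t' : R) : s <= s' <= s + d -> t <= t' <= t + d ->
    nr (f (par_pt s' t') - g (par_pt s' t')) <= e1 * (d * C).
  move=> /andP[? ?] /andP[? ?].
  have hz : nr (par_pt s' t' - z0) <= d * C.
    rewrite (_ : _ - z0 = rc (s' - S) * u + rc (t' - T) * v); last first.
      by rewrite /z0 /par_pt !rcD !rcN; ring.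
    by apply: par_vec; rewrite ler_norml; apply/andP; split; lra.
  have := hb (par_pt s' t' - z0) (le_lt_trans hz hd).
  rewrite subrKC (linK ('d f z0)) -/c => h.
  rewrite (_ : f _ - g _ = f (par_pt s' t') - f z0 - (par_pt s' t' - z0) *: c); last first.
    by rewrite /g -[_ *: c]/(_ * c); ring.
  by apply: (le_trans h); rewrite ler_wpM2l // ltW.
have seg s1' t1' s2' t2' : s <= s1' <= s + d -> t <= t1' <= t + d ->
    s <= s2' <= s + d -> t <= t2' <= t + d ->
    nr (seg_int f (par_pt s1' t1') (par_pt s2' t2') - (G (par_pt s2' t2') - G (par_pt s1' t1'))) <=
     2 * (e1 * (d * C) * (d * C)).
  move=> /andP[? ?] /andP[? ?] /andP[? ?] /andP[? ?].
  have hx x : 0 <= x <= 1 -> s <= s1' + x * (s2' - s1') <= s + d by move=> ?; apply/andP; split; nra.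
  have hy x : 0 <= x <= 1 -> t <= t1' + x * (t2' - t1') <= t + d by move=> ?; apply/andP; split; nra.
  apply: (le_trans (seg_int_est _ dG _)).
  - move=> x hx01; rewrite par_seg; apply/differentiable_continuous/df.
      by have := hx x hx01; lra.
    by have := hy x hx01; lra.
  - by move=> x hx01; rewrite par_seg; apply: near; [exact: hx|exact: hy].
  apply: ler_wpM2l => //; apply: ler_wpM2l.
    by rewrite (mulr_ge0 (ltW e10))// mulr_ge0// ltW.
  rewrite (_ : _ - _ = rc (s2' - s1') * u + rc (t2' - t1') * v); last first.
    by rewrite /par_pt !rcD !rcN; ring.
  by apply: par_vec; rewrite ler_norml; apply/andP; split; lra.
pose D s1' t1' s2' t2' := seg_int f (par_pt s1' t1') (par_pt s2' t2') - (G (par_pt s2' t2') - G (par_pt s1' t1')).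
have -> : par_int s t d = D s t (s + d) t + D (s + d) t (s + d) (t + d) +
   D (s + d) (t + d) s (t + d) + D s (t + d) s t by rewrite /par_int /D; ring.
have -> : e * d ^+ 2 = 4 * (2 * (e1 * (d * C) * (d * C))).
  by rewrite /e1; field; rewrite gt_eqF.
have i1 : s <= s <= s + d by apply/andP; split; lra.
have i2 : s <= s + d <= s + d by apply/andP; split; lra.
have i3 : t <= t <= t + d by apply/andP; split; lra.
have i4 : t <= t + d <= t + d by apply/andP; split; lra.
by apply: nr_sum4; apply: seg.
Qed.

Lemma exp_half_lt (b : R) : 0 < b -> exists n, (2^-1 : R) ^+ n < b.
Proof.
move=> b0; have := archi_boundP (ltW (x := 0) (y := b^-1) ltac:(by rewrite invr_gt0)).
set N := Num.bound _ => hN; exists N.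
have h1 : N%:R <= (2 : R) ^+ N by rewrite -natrX ler_nat ltnW// ltn_expl.
have h2 : b^-1 < (2 : R) ^+ N by apply: lt_le_trans h1.
by rewrite exprVn invf_plt ?posrE ?exprn_gt0.
Qed.

Lemma nested_real (s h : nat -> R) : (forall n, 0 <= h n) -> (forall n, s n <= s n.+1) ->
  (forall n, s n.+1 + h n.+1 <= s n + h n) ->
  exists S, forall n, s n <= S <= s n + h n.
Proof.
move=> h0 hs hh.
have up n k : s n <= s (n + k)%N.
  by elim: k => [|k IH]; rewrite ?addn0 ?addnS// (le_trans IH).
have down n k : s (n + k)%N + h (n + k)%N <= s n + h n.
  by elim: k => [|k IH]; rewrite ?addn0 ?addnS// (le_trans _ IH).
have cross m n : s m <= s n + h n.
  case: (leqP m n) => mn.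
    by rewrite (le_trans (up m (n - m)%N))// subnKC// lerDl.
  rewrite (le_trans _ (down n (m - n)%N))// subnKC ?(ltnW mn)// lerDl//.
exists (sup (range s)) => n; apply/andP; split.
  apply: sup_ubound; last by exists n.
  by exists (s 0%N + h 0%N) => _ [m _ <-]; exact: cross.
by apply: ge_sup; [exists (s 0%N), 0%N|move=> _ [m _ <-]; exact: cross].
Qed.

(** Goursat's bisection: if the integral has size eta > 0, at each stage one of the four quarters,
    of side h, keeps an integral of size at least eta h^2. The nested parallelograms shrink to a
    point (S, T), where [par_int_small] bounds these integrals by (eta / 2) h^2. *)
Lemma par_int_eq0 : par_int 0 0 1 = 0.
Proof.
apply/eqP; rewrite -nr_eq0; apply/negPn/negP => neq.
have eta0 : 0 < nr (par_int 0 0 1) by rewrite lt_def neq nr_ge0.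
set eta := nr _ in eta0.
pose h n : R := 2^-1 ^+ n.
have hp n : 0 < h n by rewrite exprn_gt0 ?invr_gt0.
have hS n : h n.+1 = h n / 2 by rewrite /h exprSr.
pose ok n (q : R * R) := [/\ 0 <= q.1, 0 <= q.2, q.1 + h n <= 1, q.2 + h n <= 1 &
   eta * h n ^+ 2 <= nr (par_int q.1 q.2 (h n))].
pose rel n (q q' : R * R) := [/\ q.1 <= q'.1, q'.1 + h n.+1 <= q.1 + h n,
   q.2 <= q'.2 & q'.2 + h n.+1 <= q.2 + h n].
have step n q : ok n q -> exists q', ok n.+1 q' /\ rel n q q'.
  case: q => s t [/= s0 t0 s1 t1 hq].
  have := hp n; have hn2 := hS n; set d := h n in s1 t1 hq hn2 *; move=> d0.
  have d20 : 0 <= d / 2 by rewrite divr_ge0 ?(ltW d0).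
  have d2d : d / 2 + d / 2 = d by field.
  have A (x : R) : 0 <= x -> x + d <= 1 -> [/\ 0 <= x + d / 2, x <= x + d / 2,
     x + d / 2 <= x + d, x + d / 2 + d / 2 <= x + d & x + d / 2 + d / 2 <= 1].
    by move=> x0 x1; clear -x0 x1 d0; split; lra.
  have [a1 a2 a3 a4 a5] := A s s0 s1; have [b1 b2 b3 b4 b5] := A t t0 t1.
  have a6 : s + d / 2 <= 1 := le_trans a3 s1; have b6 : t + d / 2 <= 1 := le_trans b3 t1.
  have E := par_int_half s0 t0 (ltW d0) s1 t1.
  rewrite /ok /rel hn2 /= -/d.
  have [h1|h1] := leP (eta * (d / 2) ^+ 2) (nr (par_int s t (d / 2))).
    by exists (s, t) => /=; repeat split.
  have [h2|h2] := leP (eta * (d / 2) ^+ 2) (nr (par_int (s + d / 2) t (d / 2))).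
    by exists (s + d / 2, t) => /=; repeat split.
  have [h3|h3] := leP (eta * (d / 2) ^+ 2) (nr (par_int s (t + d / 2) (d / 2))).
    by exists (s, t + d / 2) => /=; repeat split.
  have [h4|h4] := leP (eta * (d / 2) ^+ 2) (nr (par_int (s + d / 2) (t + d / 2) (d / 2))).
    by exists (s + d / 2, t + d / 2) => /=; repeat split.
  exfalso; move: hq; rewrite E; apply/negP; rewrite -ltNge.
  have -> : eta * d ^+ 2 = 4 * (eta * (d / 2) ^+ 2) by field.
  move: h1 h2 h3 h4; set m := eta * _; clear => h1 h2 h3 h4.
  exact: nr_sum4_lt.
have [g hg] : exists g : nat -> R * R -> R * R, forall n q, ok n q -> ok n.+1 (g n q) /\ rel n q (g n q).
  have /choice [g hg] : forall nq : nat * (R * R), exists q', ok nq.1 nq.2 -> ok nq.1.+1 q' /\ rel nq.1 nq.2 q'.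
    move=> [n q] /=; have [/step[q' ?]|?] := pselect (ok n q); first by exists q'.
    by exists q.
  by exists (fun n q => g (n, q)) => n q; exact: (hg (n, q)).
pose q := fix q n := if n is m.+1 then g m (q m) else (0, 0).
have okq n : ok n (q n).
  elim: n => [|n IH]; last by have [] := hg n _ IH.
  by rewrite /ok /h expr0 /= expr1n mulr1 add0r; split.
have relq n : rel n (q n) (q n.+1) by have [] := hg n _ (okq n).
have [||S hS'] := @nested_real (fun n => (q n).1) h (fun n => ltW (hp n)).
- by move=> n; have [] := relq n.
- by move=> n; have [] := relq n.
have [||T hT'] := @nested_real (fun n => (q n).2) h (fun n => ltW (hp n)).
- by move=> n; have [] := relq n.
- by move=> n; have [] := relq n.
have S01 : 0 <= S <= 1 by have := hS' 0%N; have [/= ] := okq 0%N; lra.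
have T01 : 0 <= T <= 1 by have := hT' 0%N; have [/= ] := okq 0%N; lra.
have [|b b0 hb] := par_int_small (e := eta / 2) _ S01 T01; first by rewrite divr_gt0.
have [n hn] := exp_half_lt b0.
have [q1 q2 q3 q4 q5] := okq n.
have /andP[a1 a2] := hS' n; have /andP[a3 a4] := hT' n.
have := hb (q n).1 (q n).2 (h n); rewrite q1 q2 a1 a2 a3 a4 q3 q4 => /(_ isT isT isT isT hn).
move=> /(le_trans q5); apply/negP; rewrite -ltNge.
by rewrite ltr_pM2r ?exprn_gt0// ltr_pdivrMr// ltr_pMr// ltr1n.
Qed.

End Goursat.

(** * Cauchy's estimate *)

Section Cauchy.
Context {R : realType}.
Local Notation K := (Cx R).
Local Notation rc := (@rc R).

Lemma linKE (y w : K) : y *: w = y * w. Proof. by []. Qed.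

Lemma convex_lt (X X' r s : R) : X < r -> X' < r -> 0 <= s -> s <= 1 ->
  X + s * (X' - X) < r.
Proof.
move=> h1 h2 s0 s1; have [h|h] := leP X X'.
  by apply: le_lt_trans h2; nra.
by apply: le_lt_trans h1; nra.
Qed.

(** * Primitives on a half-plane *)

Section HalfPlane.
Variables (f : K -> K) (r : R).
Hypothesis df : forall z : K, re z < r -> differentiable f z.

Let x0 : R := r - 1.

(** The path runs along the real axis and then vertically, and so stays in the half-plane. *)
Definition half_prim (z : K) : K :=
  seg_int f (rc x0) (rc (re z)) + seg_int f (rc (re z)) z.

Let cf (z : K) : re z < r -> {for z, continuous f}.
Proof. by move=> /df /differentiable_continuous. Qed.

Let seg_add (a b : K) (s t u : R) :
  (forall x, 0 <= x <= 1 -> re (a + rc x * (b - a)) < r) ->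
  0 <= s <= 1 -> 0 <= t <= 1 -> 0 <= u <= 1 ->
  let q x := a + rc x * (b - a) in
  seg_int f (q s) (q u) = seg_int f (q s) (q t) + seg_int f (q t) (q u).
Proof.
move=> hr hs ht hu q.
have [|P hP] := @seg_primitive_ex _ f a b; first by move=> x /hr /cf.
by rewrite /q !(seg_int_sub _ _ hP)//; ring.
Qed.

Let frac01 (y m M : R) : m < M -> m <= y <= M -> 0 <= (y - m) / (M - m) <= 1.
Proof.
move=> mM /andP[h1 h2]; have d0 : 0 < M - m by lra.
by rewrite ler_pdivrMr// divr_ge0 ?subr_ge0 ?(ltW mM)//= mul1r; lra.
Qed.

Let vert_add (x y1 y2 y3 : R) : x < r ->
  seg_int f (mk x y1) (mk x y3) = seg_int f (mk x y1) (mk x y2) + seg_int f (mk x y2) (mk x y3).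
Proof.
move=> xr; pose m := `|y1| + `|y2| + `|y3| + 1.
have m0 : - m < m.
  by have := normr_ge0 y2; have := normr_ge0 y1; have := normr_ge0 y3; rewrite /m; lra.
have pt y : mk x y = mk x (- m) + rc ((y - (- m)) / (m - (- m))) * (mk x m - mk x (- m)).
  apply: re_im_eq; rewrite ?reD ?imD ?reM ?imM ?reD ?imD ?reN ?imN /=.
    by ring.
  by field; lra.
have b y : `|y| <= m -> 0 <= (y - (- m)) / (m - (- m)) <= 1.
  by rewrite ler_norml => h; exact: frac01.
have b1 : `|y1| <= m by rewrite /m; have := normr_ge0 y2; have := normr_ge0 y3; lra.
have b2 : `|y2| <= m by rewrite /m; have := normr_ge0 y1; have := normr_ge0 y3; lra.
have b3 : `|y3| <= m by rewrite /m; have := normr_ge0 y2; have := normr_ge0 y1; lra.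
rewrite (pt y1) (pt y2) (pt y3); apply: seg_add; try exact: b.
move=> t ht; rewrite reD reM reD imD reN imN /=; lra.
Qed.

Let horiz_add (y x1 x2 x3 : R) : x1 < r -> x2 < r -> x3 < r ->
  seg_int f (mk x1 y) (mk x3 y) = seg_int f (mk x1 y) (mk x2 y) + seg_int f (mk x2 y) (mk x3 y).
Proof.
move=> r1 r2 r3; pose m := - (`|x1| + `|x2| + `|x3| + 1).
pose M := Num.max x1 (Num.max x2 x3).
have n1 := ler_normlP x1; have n2 := ler_normlP x2; have n3 := ler_normlP x3.
have [M1 M2 M3] : [/\ x1 <= M, x2 <= M & x3 <= M] by rewrite /M !le_max !lexx !orbT.
have Mr : M < r by rewrite /M !gt_max r1 r2.
have [m1 m2 m3] : [/\ m < x1, m < x2 & m < x3].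
  have := normr_ge0 x2; have := normr_ge0 x1; have := normr_ge0 x3.
  have := ler_norm (- x2); have := ler_norm (- x1); have := ler_norm (- x3).
  by rewrite !normrN /m => *; split; lra.
have mM : m < M by lra.
have pt x : mk x y = mk m y + rc ((x - m) / (M - m)) * (mk M y - mk m y).
  apply: re_im_eq; rewrite ?reD ?imD ?reM ?imM ?reD ?imD ?reN ?imN /=.
    by field; lra.
  by ring.
have b x : m < x -> x <= M -> 0 <= (x - m) / (M - m) <= 1.
  by move=> h1 h2; apply: frac01 => //; rewrite (ltW h1).
rewrite (pt x1) (pt x2) (pt x3); apply: seg_add; try exact: b.
move=> t /andP[t0 t1]; rewrite reD reM reD imD reN imN /= subrr mulr0 subr0; nra.
Qed.

Let J := seg_int f.

(** Goursat on the rectangle between the real axis and the height Y exchanges the path along the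
    axis for the one at height Y. *)
Let half_prim_diff (X Y X' Y' : R) : X < r -> X' < r ->
  half_prim (mk X' Y') - half_prim (mk X Y) =
  J (mk X Y) (mk X' Y) + J (mk X' Y) (mk X' Y').
Proof.
move=> zr hr.
have Q : J (mk X 0) (mk X' 0) + J (mk X' 0) (mk X' Y) + J (mk X' Y) (mk X Y) + J (mk X Y) (mk X 0) = 0.
  have := @par_int_eq0 R f (mk X 0) (rc (X' - X)) (mk 0 Y).
  rewrite /par_int !add0r.
  have pe s t : par_pt (mk X 0) (rc (X' - X)) (mk 0 Y) s t = mk (X + s * (X' - X)) (t * Y).
    by apply: re_im_eq; rewrite /par_pt ?reD ?imD ?reM ?imM /=; ring.
  rewrite !pe !mul0r !mul1r !addr0 subrKC; apply => s t /andP[s0 s1] _.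
  by rewrite pe; apply: df => /=; exact: convex_lt.
have -> : half_prim (mk X' Y') = J (mk x0 0) (mk X' 0) + J (mk X' 0) (mk X' Y') by [].
have -> : half_prim (mk X Y) = J (mk x0 0) (mk X 0) + J (mk X 0) (mk X Y) by [].
have x0r : x0 < r by rewrite /x0; lra.
have A1 : J (mk x0 0) (mk X' 0) = _ := @horiz_add 0 x0 X X' x0r zr hr.
(* [A5] and [A6] make integrals over degenerate segments vanish; with this, [A2] and [A4] say that
   reversal changes the sign. *)
have A2 : J (mk X Y) (mk X Y) = _ := @horiz_add Y X X' X zr hr zr.
have A3 : J (mk X' 0) (mk X' Y') = _ := @vert_add X' 0 Y Y' hr.
have A4 : J (mk X 0) (mk X 0) = _ := @vert_add X 0 Y 0 zr.
have A5 : J (mk X 0) (mk X 0) = _ := @vert_add X 0 0 0 zr.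
have A6 : J (mk X Y) (mk X Y) = _ := @horiz_add Y X X X zr zr zr.
rewrite -!/(J _ _) in A1 A2 A3 A4 A5 A6.
rewrite {}A1 {}A3.
move: Q A2 A4 A5 A6.
move: (J (mk X 0) (mk X' 0)) (J (mk X' 0) (mk X' Y)) (J (mk X' Y) (mk X Y)) (J (mk X Y) (mk X 0)).
move: (J (mk X Y) (mk X Y)) (J (mk X 0) (mk X 0)) (J (mk X Y) (mk X' Y)) (J (mk X 0) (mk X Y)).
move: (J (mk x0 0) (mk X 0)) (J (mk X' Y) (mk X' Y')) => q1 q2 q3 q4 q5 q6 p1 p2 p3 p4 Q A2 A4 A5 A6.
have z3 : q3 = 0 by apply: (addrI q3); rewrite addr0 -A6.
have z4 : q4 = 0 by apply: (addrI q4); rewrite addr0 -A5.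
have p3E : p3 = - q5 by apply/eqP; rewrite -addr_eq0 addrC -A2 z3.
have p4E : p4 = - q6 by apply/eqP; rewrite -addr_eq0 addrC -A4 z4.
have p1E : p1 = q5 + q6 - p2.
  by apply/eqP; rewrite -subr_eq0 -Q p3E p4E; apply/eqP; ring.
rewrite p1E; ring.
Qed.

(** The increment of the primitive is an integral over one horizontal and one vertical segment, of
    length at most |h| and close to [z], where [f] is close to [f z]. *)
Lemma half_primP (z : K) : re z < r -> is_diff z half_prim (fun h => h *: f z).
Proof.
move=> zr.
have key h : re (z + h) < r -> half_prim (z + h) - half_prim z =
    seg_int f z (mk (re (z + h)) (im z)) + seg_int f (mk (re (z + h)) (im z)) (z + h).
  by move=> hr; have := half_prim_diff (im z) (im (z + h)) zr hr; rewrite !mkE.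
have sx_lin : linear ( *:%R ^~ (f z) : K -> K).
  by move=> u y w; rewrite scalerDl scalerA.
pose sxlM := GRing.isLinear.Build _ _ _ _ _ sx_lin.
pose sxL : {linear K -> K} := HB.pack ( *:%R ^~ (f z) : K -> K) sxlM.
have -> : (fun h => h *: f z) = sxL by [].
have L0 : forall h : K, nr (sxL h) <= nr (f z) * nr h.
  by move=> h; rewrite nrZ mulrC.
apply: (is_diff_nr L0) => e e0.
(* Two segments, each with the factor 2 of [mean_value]. *)
have e4 : 0 < e / 4 by rewrite divr_gt0.
have /continuousP_nr/(_ _ e4)[d d0 hd] := cf zr.
have rz : 0 < r - re z by rewrite subr_gt0.
exists (Num.min d (r - re z)); first by rewrite lt_min d0.
move=> h; rewrite lt_min => /andP[h1 h2].
have hre := re_le_nr h; have him := im_le_nr h.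
have hr : re (z + h) < r by rewrite reD; have := ler_norm (re h); lra.
rewrite key//.
have dG w : is_diff w (fun x => f z * x) (fun h => h * (fun=> f z) w).
  have := is_diffZ (f z) (is_diff_id w) => dd.
  by apply: (is_diff_eq dd); apply/funext => x; rewrite !fctE linKE mulrC.
have est a b : nr (a - z) <= nr h -> nr (b - z) <= nr h ->
    nr (b - a) <= nr h ->
    (forall t, 0 <= t <= 1 -> nr (a + rc t * (b - a) - z) <= nr h) ->
    nr (seg_int f a b - (f z * b - f z * a)) <= 2 * (e / 4 * nr h).
  move=> ha hb hba hab; apply: (le_trans (seg_int_est _ dG _)).
  - move=> t /hab ht; apply: cf; have := re_le_nr (a + rc t * (b - a) - z).
    rewrite (reD (a + rc t * (b - a))) reN; have := ler_norm (re (a + rc t * (b - a)) - re z); lra.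
  - by move=> t /hab ht; apply/ltW/hd; apply: le_lt_trans h1.
  - by rewrite ler_wpM2l// ler_wpM2l// ltW.
set m := mk _ _.
have mz : m - z = rc (re h) by apply: re_im_eq; rewrite ?reD ?imD ?reN ?imN /m /= ?reD; ring.
have zm : z + h - m = mk 0 (im h).
  by apply: re_im_eq; rewrite ?reD ?imD ?reN ?imN /m /= ?reD; ring.
have nmz : nr (m - z) <= nr h by rewrite mz nr_rc.
have nzm : nr (z + h - m) <= nr h.
  by rewrite zm (le_trans (nr_le_reim _))//= normr0 add0r.
have E1 : nr (seg_int f z m - (f z * m - f z * z)) <= 2 * (e / 4 * nr h).
  apply: est => //; first by rewrite subrr nr0 nr_ge0.
  move=> t /andP[t0 t1]; rewrite addrAC subrr add0r nrM nr_rc ger0_norm//.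
  by rewrite -[leRHS]mul1r ler_pM ?nr_ge0.
have E2 : nr (seg_int f m (z + h) - (f z * (z + h) - f z * m)) <= 2 * (e / 4 * nr h).
  apply: est => //; first by rewrite addrAC subrr add0r.
  move=> t /andP[t0 t1]; rewrite zm addrAC mz.
  have -> : rc (re h) + rc t * mk 0 (im h) = mk (re h) (t * im h).
    by apply: re_im_eq; rewrite ?reD ?imD ?reM ?imM /=; ring.
  rewrite !nr_sqrt /= ler_sqrt ?addr_ge0 ?sqr_ge0// lerD2l exprMn.
  by rewrite -[leRHS]mul1r ler_wpM2r ?sqr_ge0// expr_le1.
rewrite [sxL h]linKE (_ : _ - _ = seg_int f z m - (f z * m - f z * z) + (seg_int f m (z + h) - (f z * (z + h) - f z * m))); last by ring.
by rewrite (le_trans (nrD _ _))//; lra.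
Qed.

End HalfPlane.

Lemma derive_eps (f : R -> R) (t d : R) : is_derive t 1 f d ->
  forall e : R, 0 < e -> exists2 b : R, 0 < b &
    forall h, `|h| < b -> `|f (t + h) - f t - d * h| <= e * `|h|.
Proof.
move=> df; have [/derivable1_diffP dd dE] := df.
move: (dd) => /diff_locallyP [_ /eqaddoP h] e e0.
have /nbhs_normP[b /= b0 hb] := h e e0.
exists b => // x xb; have := hb x; rewrite /= sub0r normrN => /(_ xb).
rewrite !fctE /= /shift /= (addrC x) /cst opprD addrA.
have -> : 'd f t x = d * x.
  rewrite -dE deriveE// -[x in LHS]mulr1 -[x * 1]/(x *: 1) linearZ /=.
  by rewrite -[_ *: _]/(_ * _) mulrC.
by [].
Qed.

(** * The complex exponential *)

Definition ce (w : K) : K := rc (expR (re w)) * mk (cos (im w)) (sin (im w)).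

Lemma ceD (w h : K) : ce (w + h) = ce w * ce h.
Proof.
rewrite /ce reD imD expRD cosD sinD rcM.
by apply: re_im_eq; rewrite !(reM, imM) /=; ring.
Qed.

Lemma ce0 : ce 0 = 1.
Proof.
by rewrite /ce /= expR0 cos0 sin0; apply: re_im_eq; rewrite !(reM, imM) /=; ring.
Qed.

Lemma nr_ce w : nr (ce w) = expR (re w).
Proof.
rewrite /ce nrM nr_rc ger0_norm ?expR_ge0//.
by rewrite (nr_sqrt (mk _ _)) /= cos2Dsin2 sqrtr1 mulr1.
Qed.

Lemma ce_neq0 w : ce w != 0.
Proof. by rewrite -nr_eq0 nr_ce gt_eqF ?expR_gt0. Qed.

Lemma ceN w : ce (- w) = (ce w)^-1.
Proof.
apply: (mulfI (ce_neq0 w)); rewrite divff ?ce_neq0// -ceD subrr; exact: ce0.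
Qed.

Lemma ce_period w : ce (w + mk 0 (pi *+ 2)) = ce w.
Proof. by rewrite /ce reD imD /= addr0 cosD2pi sinD2pi. Qed.

(** Here [E], [c] and [s] stand for exp x, cos y and sin y, and the conclusions bound the real and
    imaginary parts of e^(x + i y) - 1 - (x + i y). The sum 4 + 5 is the 9 of [ce_small]. *)
Lemma exp_est (x y n E c s e : R) : `|x| <= n -> `|y| <= n -> n <= e -> e <= 1 ->
  `|E - 1 - x| <= e * `|x| -> `|c - 1| <= e * `|y| -> `|s - y| <= e * `|y| ->
  `|E * c - 1 - x| <= 4 * e * n /\ `|E * s - y| <= 5 * e * n.
Proof.
move=> hx hy ne e1 hE hc hs.
have n0 : 0 <= n := le_trans (normr_ge0 _) hx.
have e0 : 0 <= e := le_trans n0 ne.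
have hE' : `|E - 1 - x| <= e * n by apply: (le_trans hE); rewrite ler_wpM2l.
have hc' : `|c - 1| <= e * n by apply: (le_trans hc); rewrite ler_wpM2l.
have hs' : `|s - y| <= e * n by apply: (le_trans hs); rewrite ler_wpM2l.
have en : e * n <= n by rewrite -[leRHS]mul1r ler_wpM2r.
have hE1 : `|E - 1| <= 2 * n.
  have -> : E - 1 = (E - 1 - x) + x by ring.
  by rewrite (le_trans (ler_normD _ _))//; lra.
have hE3 : `|E| <= 3.
  have -> : E = (E - 1) + 1 by ring.
  by rewrite (le_trans (ler_normD _ _))// normr1; lra.
have hs2 : `|s| <= 2 * n.
  have -> : s = (s - y) + y by ring.
  by rewrite (le_trans (ler_normD _ _))//; lra.
split.
- have -> : E * c - 1 - x = (E - 1 - x) + E * (c - 1) by ring.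
  rewrite (le_trans (ler_normD _ _))// normrM.
  have := ler_pM (normr_ge0 _) (normr_ge0 _) hE3 hc'; lra.
- have -> : E * s - y = (E - 1) * s + (s - y) by ring.
  rewrite (le_trans (ler_normD _ _))// normrM.
  have := ler_pM (normr_ge0 _) (normr_ge0 _) hE1 hs2.
  have : n * n <= e * n by rewrite ler_wpM2r.
  lra.
Qed.

Lemma ce_small (e : R) : 0 < e -> exists2 d : R, 0 < d &
  forall h, nr h < d -> nr (ce h - 1 - h) <= e * nr h.
Proof.
move=> e0; pose e1 := Num.min (e / 9) 1.
have e10 : 0 < e1 by rewrite lt_min ltr01 divr_gt0.
have e11 : e1 <= 1 by rewrite ge_min lexx orbT.
have e1e : e1 <= e / 9 by rewrite ge_min lexx.
have [b1 b10 h1] := derive_eps (is_derive_expR 0) e10.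
have [b2 b20 h2] := derive_eps (is_derive_cos 0) e10.
have [b3 b30 h3] := derive_eps (is_derive_sin 0) e10.
exists (Num.min e1 (Num.min b1 (Num.min b2 b3))); first by rewrite lt_min e10 lt_min b10 lt_min b20 b30.
move=> h; rewrite lt_min => /andP[he]; rewrite lt_min => /andP[k1].
rewrite lt_min => /andP[k2 k3].
have hx := re_le_nr h; have hy := im_le_nr h.
have := h1 _ (le_lt_trans hx k1); have := h2 _ (le_lt_trans hy k2).
have := h3 _ (le_lt_trans hy k3).
rewrite !add0r expR0 sin0 cos0 oppr0 mul0r !subr0 !mul1r ?addr0.
move=> q3 q2 q1.
have [r1 r2] := exp_est hx hy (ltW he) e11 q1 q2 q3.
rewrite (le_trans (nr_le_reim _))//.
have -> : re (ce h - 1 - h) = expR (re h) * cos (im h) - 1 - re h.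
  by rewrite /ce; case: (h) => a b; rewrite /= mul0r subr0.
have -> : im (ce h - 1 - h) = expR (re h) * sin (im h) - im h.
  by rewrite /ce; case: (h) => a b; rewrite /= mul0r addr0 oppr0 addr0.
have h9 : e1 * nr h <= e / 9 * nr h by rewrite ler_wpM2r ?nr_ge0.
apply: (le_trans (lerD r1 r2)); clear -h9; move: e1 h9 => e1 h9.
have -> : 4 * e1 * nr h + 5 * e1 * nr h = 9 * (e1 * nr h) by ring.
lra.
Qed.

Lemma is_diff_scale (f : K -> K) (z d : K) :
  (forall e : R, 0 < e -> exists2 b : R, 0 < b &
    forall h, nr h < b -> nr (f (z + h) - f z - h * d) <= e * nr h) ->
  is_diff z f (fun h => h * d).
Proof.
move=> H.
have sx_lin : linear ( *:%R^~ d : K -> K).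
  by move=> u y w; rewrite scalerDl scalerA.
pose sxlM := GRing.isLinear.Build _ _ _ _ _ sx_lin.
pose sxL : {linear K -> K} := HB.pack ( *:%R ^~ d : K -> K) sxlM.
have L0 : forall h : K, nr (sxL h) <= nr d * nr h by move=> h; rewrite nrZ mulrC.
exact: (is_diff_nr L0).
Qed.

Lemma is_diff_ce (w : K) : is_diff w ce (fun h => h * ce w).
Proof.
apply: is_diff_scale => e e0.
have [|d d0 hd] := @ce_small (e / nr (ce w)).
  by rewrite divr_gt0// nr_gt0 ce_neq0.
exists d => // h /hd hh; rewrite ceD.
have -> : ce w * ce h - ce w - h * ce w = ce w * (ce h - 1 - h) by ring.
rewrite nrM mulrC -ler_pdivlMr ?nr_gt0 ?ce_neq0//.
by apply: (le_trans hh); rewrite mulrAC.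
Qed.

Lemma line_const (F : K -> K) (r : R) (w w' : K) :
  (forall z, re z < r -> is_diff z F (fun=> 0)) -> re w < r -> re w' < r -> F w = F w'.
Proof.
move=> dF wr wr'; apply/esym/eqP; rewrite -subr_eq0 -nr_eq0; apply/eqP/le_anti; rewrite nr_ge0 andbT.
have h t : 0 <= t <= 1 -> re (w + rc t *: (w' - w)) < r.
  move=> /andP[t0 t1]; rewrite linKE reD reM reD reN /= mul0r subr0; exact: convex_lt.
have := @mean_value_line R K F w (w' - w) 0; rewrite mulr0 subrKC; apply => t /h /dF [] // _ ->.
by rewrite nr0.
Qed.

(* With z = e^w, the function f(e^w) e^(-w) has a primitive P on a half-plane, and
   P(w + 2 i pi) - P(w) does not depend on w.  It tends to 2 i pi f'(0) when Re w
   tends to -oo, and is bounded by integration over the circle |z| = r / 2. *)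
Lemma cauchy_unit (f : K -> K) (r M : R) : 0 < r ->
  (forall z, nr z < r -> differentiable f z) ->
  (forall z, nr z < r -> nr (f z) <= M) ->
  nr ('d f 0 1) <= 4 * M / r.
Proof.
move=> r0 df hM.
pose rho := ln r.
have inr w : re w < rho -> nr (ce w) < r.
  by rewrite nr_ce => h; rewrite -(lnK r0) ltr_expR.
pose H w := f (ce w) * (ce w)^-1.
have dce w : differentiable ce w by have [] := is_diff_ce w.
have dH w : re w < rho -> differentiable H w.
  move=> /inr hw; apply: differentiableM.
    by apply: differentiable_comp => //; exact: df.
  by apply: differentiableV => //; exact: ce_neq0.
pose P := half_prim H rho.
have dP w : re w < rho -> is_diff w P (fun h => h * H w) by move=> /(half_primP dH).
pose T : K := mk 0 (@pi R *+ 2).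
have pi0 : 0 < (pi *+ 2 : R) by rewrite mulrn_wgt0// pi_gt0.
have nT : nr T = pi *+ 2.
  by rewrite nr_sqrt /= expr0n add0r sqrtr_sqr ger0_norm// ltW.
have HT w : H (w + T) = H w by rewrite /H ce_period.
have reT w : re (w + T) = re w by rewrite reD addr0.
have vert w t : re (w + rc t *: T) = re w.
  by rewrite reD linKE reM /= mul0r mulr0 subrr addr0.
pose F w := P (w + T) - P w.
have dF w : re w < rho -> is_diff w F (fun=> 0).
  move=> hw.
  have d1 : is_diff (w + T) P (fun h => h * H (w + T)) by apply: dP; rewrite reT.
  have d2 : is_diff w (fun x : K => x + T) (id + 0).
    by have := is_diffD (is_diff_id w) (is_diff_cst T w).
  have d3 := @is_diff_comp _ _ _ _ _ _ _ _ _ d2 d1.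
  have d4 := is_diffB d3 (dP w hw).
  apply: (is_diff_eq d4); apply/funext => h.
  by rewrite !fctE /= addr0 HT subrr.
have cF w w' : re w < rho -> re w' < rho -> F w = F w' by exact: line_const.
pose c := 'd f 0 1.
have r2 : 0 < r / 2 by rewrite divr_gt0.
have r2r : r / 2 < r by rewrite ltr_pdivrMr// ltr_pMr// ltr1n.
pose w0 := rc (ln (r / 2)).
have w0r : re w0 < rho by rewrite /w0 /rho /= ltr_ln.
have F0 : nr (F w0) <= 4 * (pi *+ 2) * M / r.
  have -> : 4 * (pi *+ 2) * M / r = 2 * (pi *+ 2 * (M / (r / 2))) by field; rewrite gt_eqF.
  apply: mean_value_line => t _; first by have [] := dP (w0 + rc t *: T) ltac:(by rewrite vert).
  have [_ ->] := dP (w0 + rc t *: T) ltac:(by rewrite vert).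
  rewrite nrM nT ler_wpM2l ?(ltW pi0)// /H nrM nrV nr_ce vert /= lnK// ler_wpM2r ?invr_ge0 ?(ltW r2)//.
  by apply: hM; rewrite nr_ce vert /= lnK.
have FE : F w0 = c * T.
  apply/eqP; rewrite -subr_eq0 -nr_eq0; apply/negPn/negP => neq.
  have eta0 : 0 < nr (F w0 - c * T) by rewrite lt_def neq nr_ge0.
  set eta := nr _ in eta0.
  pose e := eta / (4 * (pi *+ 2)).
  have e0 : 0 < e by rewrite divr_gt0// mulr_gt0.
  have d0r : differentiable f 0 by apply: df; rewrite nr0.
  have [b b0 hb] := diff_nr d0r e0.
  pose m := Num.min b r / 2.
  have m0 : 0 < m by rewrite divr_gt0// lt_min b0.
  have mlt : m < Num.min b r by rewrite ltr_pdivrMr// ltr_pMr ?ltr1n// lt_min b0.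
  have [mb mr] : m < b /\ m < r by move: mlt; rewrite lt_min => /andP[].
  pose w := rc (ln m).
  have wr : re w < rho by rewrite /w /rho /= ltr_ln.
  (* The subtracted function is a primitive of c + f(0) e^(-x). Its second term has period [T], so
     it shifts the increment over a period by c T exactly, while the derivative left is (f(z) - f(0)
     - c z) / z with z = e^x, which is small for small z. *)
  pose Q x := P x - (c * x - f 0 * ce (- x)).
  have dQ x : re x < rho -> is_diff x Q (fun h => h * (H x - c - f 0 * (ce x)^-1)).
    move=> hx.
    have d1 : is_diff x (fun y : K => c * y) (fun h => c * h) by exact: (is_diffZ c (is_diff_id x)).
    have d2 : is_diff x (fun y : K => - y) (fun h => - h) by exact: (is_diffN (is_diff_id x)).
    have d3 := @is_diff_comp _ _ _ _ _ _ _ _ _ d2 (is_diff_ce (- x)).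
    have d4 : is_diff x (fun y : K => f 0 * ce (- y)) (fun h => f 0 * (- h * ce (- x))).
      exact: (is_diffZ (f 0) d3).
    have d5 := is_diffB (dP x hx) (is_diffB d1 d4).
    apply: (is_diff_eq d5); apply/funext => h; rewrite !fctE -ceN; ring.
  have QT : Q (w + T) - Q w = F w0 - c * T.
    rewrite (cF w0 w)// /Q /F.
    have -> : ce (- (w + T)) = ce (- w) by rewrite !ceN ce_period.
    ring.
  have := @mean_value_line R K Q w T (pi *+ 2 * e).
  rewrite QT -/eta => /(_ _ _)/wrap[].
  - by move=> t _; have [] := dQ (w + rc t *: T) ltac:(by rewrite vert).
  - move=> t _; have [_ ->] := dQ (w + rc t *: T) ltac:(by rewrite vert).
    rewrite nrM nT ler_wpM2l ?(ltW pi0)//.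
    set z := ce (w + rc t *: T).
    have zm : nr z = m by rewrite nr_ce vert /= lnK.
    have z0 : z != 0 by rewrite ce_neq0.
    have := hb z; rewrite zm add0r => /(_ mb).
    rewrite (linK ('d f 0)) -/c linKE => hz.
    have -> : H (w + rc t *: T) - c - f 0 * z^-1 = (f z - f 0 - z * c) * z^-1.
      by rewrite /H -/z; field.
    by rewrite nrM nrV zm ler_pdivrMr.
  apply/negP; rewrite -ltNge.
  have -> : 2 * (pi *+ 2 * e) = eta / 2.
    rewrite /e; have := gt_eqF pi0; move: (pi *+ 2) => x /negbT x0.
    by field.
  by rewrite ltr_pdivrMr// ltr_pMr// ltr1n.
move: F0; rewrite FE nrM nT -/c.
have -> : 4 * (pi *+ 2) * M / r = 4 * M / r * (pi *+ 2) by field; rewrite gt_eqF.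
by rewrite ler_pM2r.
Qed.

End Cauchy.

(** * Derivatives of holomorphic functions *)

Section Holomorphic.
Context {R : realType} {V : normedModType (Cx R)}.
Local Notation K := (Cx R).
Local Notation rc := (@rc R).
Implicit Types (f g : V -> K) (x y u v w : V).

Lemma near_diff_nr f g x (b : R) : 0 < b -> (forall y, nr (y - x) < b -> f y = g y) ->
  differentiable f x -> is_diff x g ('d f x).
Proof.
move=> b0 fg df; have [B _ hB] := diff_bounded df.
apply: (is_diff_nr hB) => e e0; have [d d0 hd] := diff_nr df e0.
exists (Num.min d b); first by rewrite lt_min d0.
move=> h; rewrite lt_min => /andP[h1 h2].
rewrite -!fg; first exact: hd.
  by rewrite subrr nr0.
by rewrite addrAC subrr add0r.
Qed.

Lemma is_diff_line f x v (t : K) : differentiable f (x + t *: v) ->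
  is_diff t (fun s : K => f (x + s *: v)) (fun h => h * 'd f (x + t *: v) v).
Proof.
move=> df.
have d1 : is_diff t (fun s : K => x + s *: v) (fun h => h *: v).
  have := is_diffD (is_diff_cst x t) (is_diff_scalel t v) => d.
  by apply: (is_diff_eq d); apply/funext => h; rewrite !fctE add0r.
have d2 := @is_diff_comp _ _ _ _ _ _ _ _ _ d1 (differentiableP df).
by apply: (is_diff_eq d2); apply/funext => h /=; rewrite linearZ.
Qed.

Definition holo_ball f x (r : R) := forall y, nr (y - x) < r -> differentiable f y.
Definition bound_ball f x (r M : R) := forall y, nr (y - x) < r -> nr (f y) <= M.

Lemma ball_sub x y (s r : R) : nr (y - x) + s <= r ->
  forall z, nr (z - y) < s -> nr (z - x) < r.
Proof. by move=> h z hz; have := nr_trans z y x; lra. Qed.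

(** The one-variable estimate, on the disc of radius r / |u| in the complex line through [x] along
    [u]. *)
Lemma cauchy_est f x (r M : R) u : 0 < r -> holo_ball f x r -> bound_ball f x r M ->
  nr ('d f x u) <= 4 * M / r * nr u.
Proof.
move=> r0 df hM.
have [->|u0] := eqVneq u 0; first by rewrite linear0 !nr0 mulr0.
have nu : 0 < nr u by rewrite nr_gt0.
have hb (z : K) : nr z < r / nr u -> nr (x + z *: u - x) < r.
  by rewrite ltr_pdivlMr// addrAC subrr add0r nrZ.
have := @cauchy_unit R (fun s => f (x + s *: u)) (r / nr u) M.
rewrite divr_gt0// => /(_ isT) H.
have [|dd dE] := @is_diff_line f x u 0; first by apply: df; rewrite scale0r addr0 subrr nr0.
have := H _ _; rewrite dE mul1r scale0r addr0 => {}H.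
have : nr ('d f x u) <= 4 * M / (r / nr u).
  apply: H => z /hb hz; last exact: hM.
  by have [] := @is_diff_line f x u z (df _ hz).
by rewrite invf_div mulrA mulrAC.
Qed.

Lemma bound_ge0 f x (r M : R) : 0 < r -> bound_ball f x r M -> 0 <= M.
Proof. by move=> r0 hM; apply: (le_trans (nr_ge0 (f x))); apply: hM; rewrite subrr nr0. Qed.

Lemma cauchy_est_at f x y (r s M : R) u : 0 < s -> nr (y - x) + s <= r ->
  holo_ball f x r -> bound_ball f x r M -> nr ('d f y u) <= 4 * M / s * nr u.
Proof.
by move=> s0 hs df hM; apply: cauchy_est => // z hz; [apply: df|apply: hM]; apply: ball_sub hz.
Qed.

Lemma seg_ball x y z (r t : R) : nr (y - x) < r -> nr (z - x) < r -> 0 <= t <= 1 ->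
  nr (y + rc t *: (z - y) - x) < r.
Proof.
move=> hy hz /andP[t0 t1].
have -> : y + rc t *: (z - y) - x = rc (1 - t) *: (y - x) + rc t *: (z - x).
  have -> : z - y = (z - x) - (y - x) by rewrite opprB addrA subrK.
  by rewrite addrAC rcD rcN rc1 scalerBl scale1r scalerBr addrA addrAC.
rewrite (le_lt_trans (nrD _ _))// !nrZ !nr_rc !ger0_norm ?subr_ge0//.
have := convex_lt hy hz t0 t1; apply: le_lt_trans.
rewrite le_eqVlt; apply/orP; left; apply/eqP; ring.
Qed.

(** On the half ball Cauchy's estimate gives 8 M / r, which the mean value inequality doubles. *)
Lemma lip_est f x y z (r M : R) : 0 < r -> holo_ball f x r -> bound_ball f x r M ->
  nr (y - x) < r / 2 -> nr (z - x) < r / 2 -> nr (f z - f y) <= 16 * M / r * nr (z - y).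
Proof.
move=> r0 df hM hy hz.
have := @mean_value_line R V f y (z - y) (8 * M / r * nr (z - y)); rewrite subrKC.
have -> : 2 * (8 * M / r * nr (z - y)) = 16 * M / r * nr (z - y) by ring.
apply => t ht; have h := seg_ball hy hz ht.
  by apply: df; apply: (lt_trans h); rewrite ltr_pdivrMr// ltr_pMr// ltr1n.
have -> : 8 * M / r = 4 * M / (r / 2) by field; rewrite gt_eqF.
by apply: cauchy_est_at df hM; lra.
Qed.

Lemma locally_bounded_nr f x : differentiable f x -> exists2 r : R, 0 < r & bound_ball f x r (nr (f x) + 1).
Proof.
move=> /differentiable_continuous /continuousP_nr /(_ 1 ltr01)[d d0 hd].
exists d => // y /hd h; have := nr_trans (f y) (f x) 0; rewrite !subr0; lra.
Qed.

Lemma inv_limit (C : R) (b : R) : 0 < b -> exists n : nat, C / n.+1%:R < b.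
Proof.
move=> b0; pose D := `|C| + 1.
have D0 : 0 < D by rewrite ltr_wpDl.
exists (Num.bound (D / b)).
have := archi_boundP (ltW (divr_gt0 D0 b0)); set N := Num.bound _ => hN.
rewrite ltr_pdivrMr ?ltr0n// mulrC -ltr_pdivrMr//.
apply: (@lt_trans _ _ N%:R); last by rewrite ltr_nat.
apply: le_lt_trans hN; rewrite ler_pM2r ?invr_gt0//.
by rewrite (le_trans (ler_norm _))// lerDl.
Qed.

(** The limit is the supremum of the lower bounds a i - c i, which yields the error bound at every
    index directly. *)
Lemma real_cauchy_limit (a c : nat -> R) :
  (forall i j, `|a i - a j| <= c i + c j) ->
  exists l : R, forall i, `|a i - l| <= c i.
Proof.
move=> H.
have ub j : ubound (range (fun i => a i - c i)) (a j + c j).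
  by move=> _ [i _ <-]; have := H i j; rewrite ler_norml => /andP[]; lra.
exists (sup (range (fun i => a i - c i))) => i.
rewrite ler_norml; apply/andP; split.
  have : sup (range (fun i => a i - c i)) <= a i + c i.
    by apply: ge_sup => //; exists (a 0%N - c 0%N), 0%N.
  lra.
have : a i - c i <= sup (range (fun i => a i - c i)).
  by apply: sup_ubound; [exists (a 0%N + c 0%N); exact: ub|exists i].
lra.
Qed.

Lemma cauchy_limit (a : nat -> K) (c : nat -> R) :
  (forall i j, nr (a i - a j) <= c i + c j) ->
  exists l : K, forall i, nr (a i - l) <= 2 * c i.
Proof.
move=> H.
have [|p hp] := @real_cauchy_limit (fun i => re (a i)) c.
  by move=> i j; apply: le_trans (H i j); rewrite -reN -reD re_le_nr.
have [|q hq] := @real_cauchy_limit (fun i => im (a i)) c.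
  by move=> i j; apply: le_trans (H i j); rewrite -imN -imD im_le_nr.
exists (mk p q) => i; rewrite (le_trans (nr_le_reim _))// !(reD, imD, reN, imN) /=.
have := hp i; have := hq i; lra.
Qed.

Lemma nr_small_eq0 (a : K) (C : R) : (forall n : nat, nr a <= C / n.+1%:R) -> a = 0.
Proof.
move=> H; apply/eqP; rewrite -nr_eq0; apply/negPn/negP => neq.
have a0 : 0 < nr a by rewrite lt_def neq nr_ge0.
by have [n hn] := inv_limit C a0; have := le_lt_trans (H n) hn; rewrite ltxx.
Qed.

Lemma diff_subE f g x u : differentiable f x -> differentiable g x ->
  'd (f - g) x u = 'd f x u - 'd g x u.
Proof.
move=> df dg; apply: (etrans (esym (deriveE u (differentiableB df dg)))).
have h1 : derivable f x u := diff_derivable df.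
have h2 : derivable g x u := diff_derivable dg.
rewrite (deriveB h1 h2).
by congr (_ - _); apply: deriveE.
Qed.

Lemma lin_est (a p q p1 p2 p3 : K) (X X1 X2 : R) :
  nr (a *: p + q - p1) <= X -> nr (p - p2) <= X1 -> nr (q - p3) <= X2 ->
  nr (p1 - (a *: p2 + p3)) <= X + nr a * X1 + X2.
Proof.
rewrite !linKE => h1 h2 h3.
have -> : p1 - (a * p2 + p3) = a * (p - p2) + (q - p3) - (a * p + q - p1) by ring.
have := nrBD (a * (p - p2) + (q - p3)) (a * p + q - p1).
have := nrD (a * (p - p2)) (q - p3); rewrite nrM.
have := ler_wpM2l (nr_ge0 a) h2; lra.
Qed.

(* The difference quotients [dq h] converge to [D] together with their
   differentials, by Cauchy's estimate. *)
Section SecondDerivative.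
Variables (f : V -> K) (x0 v : V) (r M : R).
Hypothesis r0 : 0 < r.
Hypothesis df : holo_ball f x0 r.
Hypothesis hM : bound_ball f x0 r M.

Ltac rlra := have ? := r0; lra.

Let M0 : 0 <= M. Proof. exact: bound_ge0 hM. Qed.

Definition dq (h : K) x := h^-1 * (f (x + h *: v) - f x).

Let D x := 'd f x v.

Lemma sum_ballZ x y (h : K) (a b c : R) : nr (x - y) < a -> nr h * nr v < b -> a + b <= c ->
  nr (x + h *: v - y) < c.
Proof.
by move=> h1 h2 h3; rewrite addrAC (le_lt_trans (nrD _ _))// nrZ; rlra.
Qed.

Lemma dq_diff h x : nr (x - x0) < r / 2 -> nr h * nr v < r / 2 ->
  is_diff x (dq h) (fun u => h^-1 * ('d f (x + h *: v) u - 'd f x u)).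
Proof.
move=> h1 h2.
have e1 : differentiable f (x + h *: v) by apply: df; apply: (sum_ballZ h1 h2); rlra.
have e2 : differentiable f x by apply: df; rlra.
have d1 : is_diff x (fun y : V => y + h *: v) id.
  have := is_diffD (is_diff_id x) (is_diff_cst (h *: v) x) => d.
  by apply: (is_diff_eq d); apply/funext => w; rewrite !fctE addr0.
have d2 := @is_diff_comp _ _ _ _ _ _ _ _ _ d1 (differentiableP e1).
have d3 := is_diffZ h^-1 (is_diffB d2 (differentiableP e2)).
by apply: (is_diff_eq d3); apply/funext => u.
Qed.

Lemma dq_diffE h x u : nr (x - x0) < r / 2 -> nr h * nr v < r / 2 ->
  'd (dq h) x u = h^-1 * ('d f (x + h *: v) u - 'd f x u).
Proof.
move=> h1 h2; have E := diff_val (is_diff_def := dq_diff h1 h2).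
exact: (congr1 (fun k : V -> K => k u) E).
Qed.

Let M1 := 8 * M / r * nr v.
Let M1_ge0 : 0 <= M1.
Proof. by rewrite /M1 mulr_ge0 ?nr_ge0// divr_ge0 ?(ltW r0)// mulr_ge0. Qed.

Lemma D_bound x : nr (x - x0) < r / 2 -> nr (D x) <= M1.
Proof.
move=> hx; rewrite /M1.
have -> : 8 * M / r = 4 * M / (r / 2) by field; rewrite gt_eqF.
by apply: cauchy_est_at df hM; rlra.
Qed.

Lemma dq_bound h x : h != 0 -> nr (x - x0) < r / 4 -> nr h * nr v < r / 4 ->
  nr (dq h x) <= 2 * M1.
Proof.
move=> hn h1 h2; have hp : 0 < nr h by rewrite nr_gt0.
rewrite nrM nrV mulrC ler_pdivrMr// -mulrA.
apply: mean_value_line => t /andP[t0 t1].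
  apply: df; rewrite scalerA; apply: (sum_ballZ h1 (b := r / 4)); last by rlra.
  rewrite nrM nr_rc ger0_norm// -mulrA; apply: le_lt_trans h2.
  by rewrite -[leRHS]mul1r ler_wpM2r// mulr_ge0 ?nr_ge0.
rewrite linearZ nrM mulrC ler_wpM2r ?nr_ge0//.
apply: D_bound; rewrite scalerA; apply: (sum_ballZ h1 (b := r / 4)); last by rlra.
rewrite nrM nr_rc ger0_norm// -mulrA; apply: le_lt_trans h2.
by rewrite -[leRHS]mul1r ler_wpM2r// mulr_ge0 ?nr_ge0.
Qed.

(** The constant of [lip_est] for the bound 2 M1 of [dq h] on the ball of radius r / 4. *)
Let L := 128 * M1 / r.
Let L_ge0 : 0 <= L.
Proof. by rewrite /L divr_ge0 ?(ltW r0)// mulr_ge0. Qed.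

Lemma dq_lip h x y : h != 0 -> nr (x - x0) < r / 8 -> nr (y - x0) < r / 8 ->
  nr h * nr v < r / 4 -> nr (dq h y - dq h x) <= L * nr (y - x).
Proof.
move=> hn h1 h2 h3.
have -> : L = 16 * (2 * M1) / (r / 4) by rewrite /L; field; rewrite gt_eqF.
have r4 : 0 < r / 4 by rlra.
apply: (lip_est (f := dq h) (x := x0) (r := r / 4) (M := 2 * M1)) => //; last 2 first.
- rlra.
- rlra.
- move=> z hz; have hz2 : nr (z - x0) < r / 2 by rlra.
  by have [] := dq_diff hz2 (h := h) ltac:(rlra).
- by move=> z hz; apply: dq_bound.
Qed.

Lemma dq_lim x : nr (x - x0) < r -> forall e : R, 0 < e -> exists2 d : R, 0 < d &
  forall h, h != 0 -> nr h < d -> nr (dq h x - D x) <= e.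
Proof.
move=> hx e e0.
have v1 : 0 < nr v + 1 by rewrite ltr_wpDl ?nr_ge0.
have [|d d0 hd] := diff_nr (df hx) (e := e / (nr v + 1)); first by rewrite divr_gt0.
exists (d / (nr v + 1)); first by rewrite divr_gt0.
move=> h hn; rewrite ltr_pdivlMr// => hh.
have hp : 0 < nr h by rewrite nr_gt0.
have hv : nr (h *: v) <= nr h * (nr v + 1) by rewrite nrZ ler_wpM2l ?nr_ge0// lerDl.
have := hd (h *: v) (le_lt_trans hv hh).
rewrite linearZ /= linKE => H.
have -> : dq h x - D x = h^-1 * (f (x + h *: v) - f x - h * D x).
  by rewrite /dq /D; field.
rewrite nrM nrV mulrC ler_pdivrMr//; apply: (le_trans H).
apply: (le_trans (ler_wpM2l _ hv)); first by rewrite divr_ge0 ?ltW.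
by rewrite mulrCA divfK ?gt_eqF// mulrC.
Qed.

Lemma rc_small (b : R) : 0 < b -> exists2 h : K, h != 0 & nr h < b.
Proof.
move=> b0; exists (rc (b / 2)); last by rewrite nr_rc ger0_norm ?divr_ge0 ?ltW//; rlra.
by rewrite -nr_gt0 nr_rc ger0_norm ?divr_ge0 ?divr_gt0 ?ltW.
Qed.

Lemma rc_small_v (b c : R) : 0 < b -> 0 < c -> exists h : K, [/\ h != 0, nr h < b & nr h * nr v < c].
Proof.
move=> b0 c0.
have v1 : 0 < nr v + 1 by rewrite ltr_wpDl ?nr_ge0.
have [|h hn] := @rc_small (Num.min b (c / (nr v + 1))); first by rewrite lt_min b0 divr_gt0.
rewrite lt_min => /andP[h1 h2]; exists h; split => //.
move: h2; rewrite ltr_pdivlMr//; apply: le_lt_trans.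
by rewrite ler_wpM2l ?nr_ge0// lerDl.
Qed.

(** The Lipschitz constant of [dq h] does not depend on [h], so it passes to the limit. *)
Lemma D_lip x y : nr (x - x0) < r / 8 -> nr (y - x0) < r / 8 ->
  nr (D y - D x) <= L * nr (y - x).
Proof.
move=> h1 h2; apply/ler_addgt0Pr => e e0.
have e2 : 0 < e / 2 by rlra.
have [|a a0 ha] := @dq_lim x _ _ e2; first by rlra.
have [|b b0 hb] := @dq_lim y _ _ e2; first by rlra.
have [||h [hn hh hv]] := @rc_small_v (Num.min a b) (r / 4); first by rewrite lt_min a0.
  by rlra.
move: hh; rewrite lt_min => /andP[/ha-/(_ hn) q1 /hb-/(_ hn) q2].
have q3 := dq_lip hn h1 h2 hv.
have -> : D y - D x = (dq h y - dq h x) - (dq h y - D y) + (dq h x - D x) by ring.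
have := nrD ((dq h y - dq h x) - (dq h y - D y)) (dq h x - D x).
have := nrBD (dq h y - dq h x) (dq h y - D y); rlra.
Qed.

(** A rate linear in [h] and uniform in [x]: on the segment from x to x + h v, the derivative of [f]
    along [v] differs from [D x] by at most L |h v|. *)
Lemma dq_close h x : h != 0 -> nr (x - x0) < r / 16 -> nr h * nr v < r / 16 ->
  nr (dq h x - D x) <= 2 * (L * nr v) * nr h.
Proof.
move=> hn h1 h2; have hp : 0 < nr h by rewrite nr_gt0.
have -> : dq h x - D x = h^-1 * (f (x + h *: v) - f x - h * D x).
  by rewrite /dq; field.
rewrite nrM nrV mulrC ler_pdivrMr//.
have := @mean_value_const R (fun s => f (x + rc s *: (h *: v)) - (f x + rc s * (h * D x)))
   (fun s => 'd f (x + rc s *: (h *: v)) (h *: v) - h * D x) (L * nr v * nr h * nr h).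
have -> : f (x + rc 1 *: (h *: v)) - (f x + rc 1 * (h * D x)) - (f (x + rc 0 *: (h *: v)) - (f x + rc 0 * (h * D x))) = f (x + h *: v) - f x - h * D x.
  by rewrite !rc1 !rc0 scale1r scale0r addr0 mul0r mul1r; ring.
have -> : 2 * (L * nr v * nr h * nr h) = 2 * (L * nr v) * nr h * nr h by ring.
have hb t : 0 <= t <= 1 -> nr (x + rc t *: (h *: v) - x0) < r / 8.
  move=> /andP[t0 t1].
  rewrite scalerA; apply: (sum_ballZ h1 (b := r / 16)); last by rlra.
  rewrite nrM nr_rc ger0_norm// -mulrA; apply: le_lt_trans h2.
  by rewrite -[leRHS]mul1r ler_wpM2r// mulr_ge0 ?nr_ge0.
apply => t ht.
  apply: cderB; last exact: cder_affine.
  by apply: cder_line; apply: df; have := hb t ht; rlra.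
rewrite linearZ /= linKE -mulrBr nrM mulrC ler_wpM2r ?nr_ge0//.
have xb : nr (x - x0) < r / 8 by rlra.
apply: (le_trans (D_lip xb (hb t ht))).
rewrite -mulrA ler_wpM2l// addrAC subrr add0r !nrZ nr_rc.
case/andP: ht => t0 t1; rewrite ger0_norm// (mulrC (nr v)).
by rewrite -[leRHS]mul1r ler_wpM2r// mulr_ge0 ?nr_ge0.
Qed.

Let C := 2 * (L * nr v).
Let C_ge0 : 0 <= C. Proof. by rewrite mulr_ge0// mulr_ge0// nr_ge0. Qed.

(** From [lip_est] on the ball of radius r / 16, which gives 16 C / (r / 16); the 64 C / r of
    Cauchy's estimate is smaller. *)
Let A := 256 * C / r.
Let A_ge0 : 0 <= A.
Proof. apply: divr_ge0; [exact: mulr_ge0|exact: ltW]. Qed.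

Let dqB_bound h k : h != 0 -> k != 0 -> nr h * nr v < r / 16 -> nr k * nr v < r / 16 ->
  bound_ball (dq h - dq k) x0 (r / 16) (C * (nr h + nr k)).
Proof.
move=> hn kn h1 h2 y hy; rewrite !fctE.
have -> : dq h y - dq k y = (dq h y - D y) - (dq k y - D y) by ring.
apply: (le_trans (nrBD _ _)); rewrite mulrDr lerD//; exact: dq_close.
Qed.

Let dqB_diff h k : nr h * nr v < r / 16 -> nr k * nr v < r / 16 ->
  holo_ball (dq h - dq k) x0 (r / 16).
Proof.
move=> h1 h2 y hy; apply: differentiableB.
  by have [] := dq_diff (x := y) (h := h) ltac:(rlra) ltac:(rlra).
by have [] := dq_diff (x := y) (h := k) ltac:(rlra) ltac:(rlra).
Qed.

Lemma dq_cauchy h k u : h != 0 -> k != 0 -> nr h * nr v < r / 16 -> nr k * nr v < r / 16 ->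
  nr ('d (dq h) x0 u - 'd (dq k) x0 u) <= A * (nr h + nr k) * nr u.
Proof.
move=> hn kn h1 h2; have r16 : 0 < r / 16 by rlra.
have x00 : nr (x0 - x0) < r / 2 by rewrite subrr nr0; rlra.
have [d1 _] := dq_diff x00 (h := h) ltac:(rlra).
have [d2 _] := dq_diff x00 (h := k) ltac:(rlra).
have H := cauchy_est u r16 (dqB_diff h1 h2) (dqB_bound hn kn h1 h2).
have E := diff_subE u d1 d2.
have {}H := eq_ind _ (fun z : K => nr z <= _) H _ E.
apply: (le_trans H); apply: ler_wpM2r; first exact: nr_ge0.
have -> : 4 * (C * (nr h + nr k)) / (r / 16) = 64 * C / r * (nr h + nr k).
  by field; rewrite gt_eqF.
rewrite ler_wpM2r ?addr_ge0 ?nr_ge0// /A ler_wpM2r ?invr_ge0 ?(ltW r0)// ler_wpM2r//.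
by rewrite ler_nat.
Qed.

(** The bound holds for dq h - dq k, and k tends to 0. It makes [D] inherit the first-order
    expansion of [dq h] at [x0], up to a small multiple of |y - x0|. *)
Lemma dqD_lip h y : h != 0 -> nr h * nr v < r / 16 -> nr (y - x0) < r / 32 ->
  nr ((dq h y - D y) - (dq h x0 - D x0)) <= A * nr h * nr (y - x0).
Proof.
move=> hn h1 hy; apply/ler_addgt0Pr => e e0.
have r16 : 0 < r / 16 by rlra.
have e4 : 0 < e / 4 by lra.
have x00 : nr (x0 - x0) < r / 32 by rewrite subrr nr0; rlra.
have [|a a0 ha] := @dq_lim y _ _ e4; first by rlra.
have [|b b0 hb] := @dq_lim x0 _ _ e4; first by rlra.
pose m := A * nr (y - x0) + 1.
have m0 : 0 < m by rewrite ltr_wpDl// mulr_ge0 ?nr_ge0.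
have [||k [kn]] := @rc_small_v (Num.min (e / 4 / m) (Num.min a b)) (r / 16).
- by rewrite lt_min divr_gt0// lt_min a0.
- by rlra.
rewrite lt_min => /andP[km]; rewrite lt_min => /andP[ka kb] kv.
have q1 := ha k kn ka; have q2 := hb k kn kb.
have := lip_est r16 (dqB_diff h1 kv) (dqB_bound hn kn h1 kv) (y := x0) (z := y) ltac:(rlra) ltac:(rlra).
rewrite !fctE.
have -> : 16 * (C * (nr h + nr k)) / (r / 16) = A * (nr h + nr k).
  by rewrite /A; field; rewrite gt_eqF.
move=> q3.
have q4 : A * nr k * nr (y - x0) <= e / 4.
  move: km; rewrite ltr_pdivlMr// => /ltW; apply: le_trans.
  have -> : A * nr k * nr (y - x0) = nr k * (A * nr (y - x0)) by ring.
  by rewrite ler_wpM2l ?nr_ge0// /m lerDl.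
have -> : (dq h y - D y) - (dq h x0 - D x0) = ((dq h y - dq k y) - (dq h x0 - dq k x0))
   + (dq k y - D y) - (dq k x0 - D x0) by ring.
have := nrBD ((dq h y - dq k y) - (dq h x0 - dq k x0) + (dq k y - D y)) (dq k x0 - D x0).
have := nrD ((dq h y - dq k y) - (dq h x0 - dq k x0)) (dq k y - D y).
move: q3; rewrite mulrDr mulrDl.
move: (A * nr h * nr (y - x0)) (A * nr k * nr (y - x0)) q4 q1 q2 => X Y; lra.
Qed.

Let c0 := r / 32 / (nr v + 1).
Let c00 : 0 < c0.
Proof. by rewrite divr_gt0 ?ltr_wpDl ?nr_ge0// divr_gt0. Qed.
Let hs (j : nat) : K := rc (c0 / j.+1%:R).
Let hs_neq0 j : hs j != 0.
Proof. by rewrite -nr_gt0 nr_rc normr_gt0 gt_eqF// divr_gt0. Qed.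
Let nr_hs j : nr (hs j) = c0 / j.+1%:R.
Proof. by rewrite nr_rc ger0_norm// divr_ge0// ltW. Qed.
Let hs_v j : nr (hs j) * nr v < r / 16.
Proof.
rewrite nr_hs.
have h1 : c0 / j.+1%:R <= c0 by rewrite ler_pdivrMr ?ltr0n// ler_pMr// ler1n.
have h2 : c0 * (nr v + 1) = r / 32 by rewrite /c0 divfK// gt_eqF// ltr_wpDl ?nr_ge0.
apply: (@le_lt_trans _ _ (r / 32)); last by rlra.
rewrite -h2 ler_pM ?nr_ge0 ?lerDl//; last by rewrite divr_ge0// ltW.
Qed.

Lemma dq_limit_ex : exists l : V -> K, forall h u, h != 0 -> nr h * nr v < r / 16 ->
  nr ('d (dq h) x0 u - l u) <= A * nr h * nr u.
Proof.
have H u : exists l : K, forall j, nr ('d (dq (hs j)) x0 u - l) <= 2 * (A * nr (hs j) * nr u).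
  apply: cauchy_limit => i j.
  by rewrite -mulrDl -mulrDr; apply: dq_cauchy.
have [l hl] := choice H; exists l => h u hn hv.
apply/ler_addgt0Pr => e e0.
have [j hj] := inv_limit (3 * A * c0 * nr u) e0.
have q1 := hl u j; have q2 := dq_cauchy u hn (hs_neq0 j) hv (hs_v j).
apply: (le_trans (nr_trans _ ('d (dq (hs j)) x0 u) _)); apply: (le_trans (lerD q2 q1)).
have -> : A * (nr h + nr (hs j)) * nr u + 2 * (A * nr (hs j) * nr u) = A * nr h * nr u + 3 * (A * nr (hs j) * nr u) by ring.
rewrite lerD2l nr_hs; apply: ltW; apply: le_lt_trans hj.
by rewrite le_eqVlt; apply/orP; left; apply/eqP; ring.
Qed.

(** The second conclusion concerns the difference quotients along [v] of the differential of [f] at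
    [u]; the symmetry of second derivatives rests on it. *)
Lemma second_derivative : exists L2 : {linear V -> K}, is_diff x0 D L2 /\
  forall (h : K) u, h != 0 -> nr h * nr v < r / 16 ->
    nr (h^-1 * ('d f (x0 + h *: v) u - 'd f x0 u) - L2 u) <= A * nr h * nr u.
Proof.
have [l hl] := dq_limit_ex.
have x00 : nr (x0 - x0) < r / 2 by rewrite subrr nr0; rlra.
have llin : linear l.
  move=> a u w; apply/eqP; rewrite -subr_eq0; apply/eqP.
  apply: (@nr_small_eq0 _ (A * c0 * (nr (a *: u + w) + nr a * nr u + nr w))) => n.
  have q1 := hl _ (a *: u + w) (hs_neq0 n) (hs_v n).
  have q2 := hl _ u (hs_neq0 n) (hs_v n).
  have q3 := hl _ w (hs_neq0 n) (hs_v n).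
  move: q1 q2 q3; rewrite linearP !nr_hs.
  move: ('d (dq (hs n)) x0 u) ('d (dq (hs n)) x0 w) (l (a *: u + w)) (l u) (l w) => p q p1 p2 p3.
  move: (nr (a *: u + w)) (nr u) (nr w) => N N1 N2.
  have -> : A * c0 * (N + nr a * N1 + N2) / n.+1%:R = A * (c0 / n.+1%:R) * N
     + nr a * (A * (c0 / n.+1%:R) * N1) + A * (c0 / n.+1%:R) * N2 by ring.
  move: (A * (c0 / n.+1%:R) * N) (A * (c0 / n.+1%:R) * N1) (A * (c0 / n.+1%:R) * N2) => X X1 X2.
  exact: lin_est.
pose lM := GRing.isLinear.Build _ _ _ _ _ llin.
pose lL : {linear V -> K} := HB.pack l lM.
exists lL; split; last first.
  move=> h u hn hv; have hv2 : nr h * nr v < r / 2 by rlra.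
  have E := dq_diffE u x00 hv2.
  exact: (eq_ind _ (fun z : K => nr (z - l u) <= _) (hl h u hn hv) _ E).
have [B B0 hB] := diff_bounded (ltac:(by have [] := dq_diff x00 (h := hs 0) ltac:(have := hs_v 0; rlra)) : differentiable (dq (hs 0)) x0).
apply: (@is_diff_nr _ _ _ _ _ _ (B + A * nr (hs 0%N))).
  move=> h; have := hl _ h (hs_neq0 0%N) (hs_v 0%N); have := hB h.
  rewrite mulrDl -[lL h]/(l h); move: ('d (dq (hs 0)) x0 h) (l h) => p q h1 h2.
  have := nrBD p (p - q); rewrite subKr => h3.
  by apply: (le_trans h3); apply: lerD.
move=> e e0.
have e2 : 0 < e / 2 by lra.
have AA : 0 < 2 * A + 1 by have := A_ge0; lra.
have [||h [hn hh hv]] := @rc_small_v (e / 2 / (2 * A + 1)) (r / 16).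
- by rewrite divr_gt0.
- by rlra.
have [d1 _] := dq_diff x00 (h := h) ltac:(rlra).
have [d d0 hd] := diff_nr d1 e2.
exists (Num.min d (r / 32)); first by rewrite lt_min d0; rlra.
move=> u; rewrite lt_min => /andP[/hd q1 ur].
have := @dqD_lip h (x0 + u) hn hv; rewrite addrAC subrr add0r => /(_ ur) q2.
have q3 := hl h u hn hv.
have q4 : 2 * (A * nr h * nr u) <= e / 2 * nr u.
  rewrite mulrA ler_wpM2r ?nr_ge0//; move: hh; rewrite ltr_pdivlMr// => /ltW; apply: le_trans.
  by rewrite mulrA (mulrC _ (nr h)) ler_wpM2l ?nr_ge0// lerDl.
move: q1 q2 q3 q4; rewrite -[lL u]/(l u).
move: ('d (dq h) x0 u) (l u) (D (x0 + u)) (D x0) (dq h (x0 + u)) (dq h x0) => p q p1 p2 p3 p4.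
move: (A * nr h * nr u) => X q1 q2 q3 q4.
have -> : p1 - p2 - q = (p3 - p4 - p) - ((p3 - p1) - (p4 - p2)) + (p - q) by ring.
have := nrD ((p3 - p4 - p) - ((p3 - p1) - (p4 - p2))) (p - q).
have := nrBD (p3 - p4 - p) ((p3 - p1) - (p4 - p2)).
have -> : e * nr u = e / 2 * nr u + e / 2 * nr u by field.
move: (e / 2 * nr u) q1 q4 => Y q1 q4; lra.
Qed.

End SecondDerivative.

End Holomorphic.

(** * Symmetry of second derivatives, Taylor bounds and flat functions *)

Section OpenSets.
Context {R : realType} {V : normedModType (Cx R)}.
Local Notation K := (Cx R).
Local Notation rc := (@rc R).
Implicit Types (f g : V -> K) (x y u v w : V) (U : set V).

Definition holo_open U f := forall x, U x -> differentiable f x.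

Lemma holo_bounded_ball U f x : open U -> holo_open U f -> U x ->
  exists2 r : R, 0 < r & (forall y, nr (y - x) < r -> U y) /\
     (holo_ball f x r /\ bound_ball f x r (nr (f x) + 1)).
Proof.
move=> /openP_nr oU df Ux; have [a a0 ha] := oU x Ux.
have [b b0 hb] := locally_bounded_nr (df x Ux).
exists (Num.min a b); first by rewrite lt_min a0.
split; first by move=> y; rewrite lt_min => /andP[/ha].
by split=> y; rewrite lt_min => /andP[/ha h1 /hb h2] //; exact: df.
Qed.

Lemma holo_derive_aux U f v x : open U -> holo_open U f -> U x ->
  is_diff x (fun y => 'D_v f y) ('d (fun y => 'd f y v) x) /\
  exists2 r : R, 0 < r & exists A : R, forall (h : K) u, h != 0 -> nr h * nr v < r ->
    nr (h^-1 * ('d f (x + h *: v) u - 'd f x u) - 'D_u (fun y => 'D_v f y) x) <= A * nr h * nr u.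
Proof.
move=> oU df Ux; have [r r0 [rU [rdf rM]]] := holo_bounded_ball oU df Ux.
have [L2 [dL2 hL2]] := @second_derivative R V f x v r (nr (f x) + 1) r0 rdf rM.
have [d1 E1] := dL2.
have dd : is_diff x (fun y => 'D_v f y) ('d (fun y => 'd f y v) x).
  apply: (near_diff_nr (b := r) r0 _ d1) => y hy.
  exact: (esym (deriveE v (rdf y hy))).
split => //; exists (r / 16); first by rewrite divr_gt0.
eexists => h u hn hv; have H := hL2 h u hn hv.
have [d2 E2] := dd.
have E : 'D_u (fun y => 'D_v f y) x = L2 u.
  apply: (etrans (deriveE u d2)); apply: (etrans (congr1 (fun k : V -> K => k u) E2)).
  exact: (congr1 (fun k : V -> K => k u) E1).
exact: (eq_ind _ (fun z : K => nr (_ - z) <= _) H _ (esym E)).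
Qed.

Lemma holo_derive U f v : open U -> holo_open U f -> holo_open U (fun y => 'D_v f y).
Proof. by move=> oU df x Ux; have [[]] := holo_derive_aux v oU df Ux. Qed.

Lemma lin_scale (L : {linear V -> K}) (a : K) u : L (a *: u) = a * L u.
Proof. by rewrite linearZ. Qed.

Lemma sym_est (t e : R) (p q p1 p2 g1 g2 dg : K) : 0 < t -> rc t != 0 ->
  p1 = g1 -> p2 = g2 -> dg = rc t * q ->
  nr ((rc t)^-1 * (p1 - p2) - p) <= e / 2 -> nr (g1 - g2 - dg) <= t * (e / 2) ->
  nr (p - q) <= e.
Proof.
move=> t0 tn <- <- -> q1 q2.
have q3 : nr ((rc t)^-1 * (p1 - p2) - q) <= e / 2.
  have -> : (rc t)^-1 * (p1 - p2) - q = (rc t)^-1 * (p1 - p2 - rc t * q) by field.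
  by rewrite nrM nrV nr_rc gtr0_norm// mulrC ler_pdivrMr// (mulrC (e / 2)).
have -> : p - q = ((rc t)^-1 * (p1 - p2) - q) - ((rc t)^-1 * (p1 - p2) - p) by ring.
have := nrBD ((rc t)^-1 * (p1 - p2) - q) ((rc t)^-1 * (p1 - p2) - p); lra.
Qed.

(** The difference quotient along [v] of the derivative of [f] along [u] has two limits: D_u (D_v f)
    by [holo_derive_aux], and D_v (D_u f) because D_u f is differentiable. *)
Lemma derive_sym U f u v x : open U -> holo_open U f -> U x ->
  'D_u (fun y => 'D_v f y) x = 'D_v (fun y => 'D_u f y) x.
Proof.
move=> oU df Ux.
have [_ [r r0 [A hA]]] := holo_derive_aux v oU df Ux.
have dG := holo_derive u oU df Ux.
have [a a0 [aU _]] := holo_bounded_ball oU df Ux.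
apply/eqP; rewrite -subr_eq0 -nr_eq0; apply/eqP/le_anti; rewrite nr_ge0 andbT.
apply/ler_addgt0Pr => e e0; rewrite add0r.
have e4 : 0 < e / 2 by lra.
have v1 : 0 < nr v + 1 by rewrite ltr_wpDl ?nr_ge0.
have [|d d0 hd] := diff_nr dG (e := e / 2 / (nr v + 1)); first by rewrite divr_gt0.
pose m := `|A| * nr u + 1.
have m0 : 0 < m by rewrite ltr_wpDl// mulr_ge0 ?nr_ge0.
pose t := Num.min (e / 2 / m) (Num.min (r / (nr v + 1)) (Num.min (d / (nr v + 1)) (a / (nr v + 1)))) / 2.
have t0 : 0 < t by rewrite divr_gt0// !lt_min !divr_gt0.
have : t < Num.min (e / 2 / m) (Num.min (r / (nr v + 1)) (Num.min (d / (nr v + 1)) (a / (nr v + 1)))).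
  by rewrite ltr_pdivrMr// ltr_pMr ?ltr1n// !lt_min !divr_gt0.
rewrite !lt_min !ltr_pdivlMr// => /andP[tm /andP[tr /andP[td ta]]].
have tv : t * nr v <= t * (nr v + 1) by rewrite ler_wpM2l ?(ltW t0)// lerDl.
have nt : nr (rc t) = t by rewrite nr_rc gtr0_norm.
have tn : rc t != 0 by rewrite -nr_gt0 nt.
have q1 := hA (rc t) u tn ltac:(by rewrite nt; apply: le_lt_trans tr).
have Uxt : U (x + rc t *: v).
  by apply: aU; rewrite addrAC subrr add0r nrZ nt; apply: le_lt_trans ta.
have tv2 : nr (rc t *: v) < d by rewrite nrZ nt; exact: le_lt_trans td.
have q2 := hd (rc t *: v) tv2.
have e1 := esym (deriveE u (df _ Uxt)); have e2 := esym (deriveE u (df _ Ux)).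
have e3 : 'd (fun y => 'D_u f y) x (rc t *: v) = rc t * 'D_v (fun y => 'D_u f y) x.
  apply: (etrans (lin_scale _ _ _)); congr (_ * _); exact: (esym (deriveE v dG)).
have q4 : A * nr (rc t) * nr u <= e / 2.
  have {}tm : t * m <= e / 2 by lra.
  rewrite nt; apply: (le_trans _ tm); rewrite /m mulrAC (mulrC t).
  apply: ler_wpM2r; first exact: ltW.
  apply: (@le_trans _ _ (`|A| * nr u)); last by rewrite lerDl.
  by rewrite ler_wpM2r ?nr_ge0// ler_norm.
have q5 : e / 2 / (nr v + 1) * nr (rc t *: v) <= t * (e / 2).
  rewrite nrZ nt mulrAC ler_pdivrMr//.
  have -> : e / 2 * (t * nr v) = t * (e / 2) * nr v by ring.
  apply: ler_wpM2l; first by apply: mulr_ge0; exact: ltW.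
  by rewrite lerDl.
exact: (sym_est t0 tn e1 e2 e3 (le_trans q1 q4) (le_trans q2 q5)).
Qed.

Definition iter_derive v k f : V -> K := iter k (fun g y => 'D_v g y) f.

Lemma holo_iter_derive U f v k : open U -> holo_open U f -> holo_open U (iter_derive v k f).
Proof.
by move=> oU df; elim: k => [|k IH] //=; exact: holo_derive.
Qed.

(* Cauchy's estimate in [k] steps, each of which shrinks the ball by r / (2 k). *)
Lemma iter_derive_bound f x v (r M : R) k j : 0 < r -> (0 < k)%N ->
  holo_ball f x r -> bound_ball f x r M -> (j <= k)%N ->
  bound_ball (iter_derive v j f) x (r - r / 2 * (j%:R / k%:R))
    (M * (8 * k%:R / r * nr v) ^+ j).
Proof.
move=> r0 k0 df hM; have kp : 0 < (k%:R : R) by rewrite ltr0n.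
have s0 : 0 < r / 2 / k%:R by rewrite !divr_gt0.
have dfj i : holo_ball (iter_derive v i f) x r.
  exact: (@holo_iter_derive [set y | nr (y - x) < r] f v i (open_nr_ball x r) df).
elim: j => [_|j IH jk] y.
  by rewrite mul0r mulr0 subr0 expr0 mulr1; exact: hM.
move=> hy; rewrite /iter_derive iterS -/(iter_derive v j f).
have yr : nr (y - x) < r.
  apply: (lt_le_trans hy); rewrite gerBl; apply: mulr_ge0; first by rewrite divr_ge0// ltW.
  exact: divr_ge0.
rewrite (deriveE v (dfj j y yr)).
have e1 : r / 2 * (j.+1%:R / k%:R) = r / 2 * (j%:R / k%:R) + r / 2 / k%:R.
  by rewrite -natr1; field; rewrite gt_eqF.
have := @cauchy_est_at R V (iter_derive v j f) x y (r - r / 2 * (j%:R / k%:R)) (r / 2 / k%:R) (M * (8 * k%:R / r * nr v) ^+ j) v s0.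
have -> : 4 * (M * (8 * k%:R / r * nr v) ^+ j) / (r / 2 / k%:R) * nr v = M * (8 * k%:R / r * nr v) ^+ j.+1.
  by rewrite exprS; field; rewrite !gt_eqF.
apply.
- by move: hy; rewrite e1; lra.
- move=> z hz; apply: dfj; apply: (lt_le_trans hz).
  rewrite gerBl; apply: mulr_ge0; first by rewrite divr_ge0// ltW.
  exact: divr_ge0.
- by apply: IH; exact: ltnW.
Qed.

(** k^k is at most the product of the k factors 2 k, ..., k + 1, which is binomial(2 k, k) k!, and
    this binomial is one term in the expansion of (1 + 1)^(2 k). *)
Lemma expn_fact_bound k : (k ^ k <= 4 ^ k * k`!)%N.
Proof.
have h1 : (k ^ k <= (k + k) ^_ k)%N.
  have h n : (n <= k)%N -> (k ^ n <= (k + k) ^_ n)%N.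
    elim: n => [|n IH] nk; first by rewrite expn0 ffactn0.
    rewrite expnSr ffactnSr leq_mul ?IH//; first exact: ltnW.
    by rewrite -addnBA ?leq_addr// ltnW.
  exact: h.
apply: (leq_trans h1); rewrite -bin_ffact leq_mul2r; apply/orP; right.
have -> : (4 ^ k = 2 ^ (k + k))%N by rewrite expnD -expnMn.
have -> : (2 ^ (k + k) = \sum_(i < (k + k).+1) 'C(k + k, i))%N.
  by rewrite -[2%N]/(1 + 1)%N expnDn; apply: eq_bigr => i _; rewrite !exp1n !muln1.
have hk : (k < (k + k).+1)%N by rewrite ltnS leq_addr.
by rewrite (bigD1 (Ordinal hk))//= leq_addr.
Qed.

Lemma is_derive_monomial (C s : R) j :
  is_derive s 1 (fun x : R => C / j.+1%:R * x ^+ j.+1) (C * s ^+ j).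
Proof.
have dX : is_derive s 1 (@GRing.exp R ^~ j.+1) (j.+1%:R * s ^+ j).
  apply: DeriveDef; first exact: exprn_derivable.
  by rewrite exp_derive /= -![_ *: _]/(_ * _) mulr1.
have dZ := is_deriveZ (C / j.+1%:R) dX.
have E : (C / j.+1%:R) *: (j.+1%:R * s ^+ j) = C * s ^+ j.
  by rewrite -[LHS]/(C / j.+1%:R * (j.+1%:R * s ^+ j)) mulrA divfK// pnatr_eq0.
exact: (is_derive_eq dZ E).
Qed.

(** Downward integration from the k-th derivative: the derivative of order k - j vanishes at [x] for
    j > 0, and each integration gains t / j and the factor 2 |c|, the 2 being that of
    [mean_value]. *)
Lemma taylor_bound f x v (r B : R) k : 0 < r -> holo_ball f x r ->
  (forall j, (j < k)%N -> iter_derive v j f x = 0) ->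
  bound_ball (iter_derive v k f) x r B ->
  forall j, (j <= k)%N -> forall (c : K) (t : R), nr c * nr v < r -> 0 <= t <= 1 ->
    nr (iter_derive v (k - j) f (x + (rc t * c) *: v)) <= B * (2 * nr c) ^+ j * t ^+ j / j`!%:R.
Proof.
move=> r0 df h0 hB.
have dfj i : holo_ball (iter_derive v i f) x r.
  exact: (@holo_iter_derive [set y | nr (y - x) < r] f v i (open_nr_ball x r) df).
have inb (c : K) (t : R) : nr c * nr v < r -> 0 <= t <= 1 -> nr (x + (rc t * c) *: v - x) < r.
  move=> hc /andP[t0 t1]; rewrite addrAC subrr add0r nrZ nrM nr_rc ger0_norm//.
  apply: le_lt_trans hc; rewrite -mulrA -[leRHS]mul1r ler_wpM2r// mulr_ge0 ?nr_ge0//.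
elim=> [_|j IH jk] c t hc ht.
  rewrite subn0 !expr0 !mulr1 divr1; apply: hB; exact: inb.
have kj : (k - j = (k - j.+1).+1)%N by rewrite subnSK.
have {}IH := IH (ltnW jk) c.
set g := iter_derive v (k - j.+1) f.
have gD : iter_derive v (k - j) f = (fun y => 'D_v g y) by rewrite kj.
have gx : g x = 0 by apply: h0; rewrite ltn_subrL /= (leq_ltn_trans _ jk).
case/andP: (ht) => t0 t1.
have st s : 0 <= s <= 1 -> 0 <= s * t <= 1.
  move=> /andP[s0 s1]; rewrite mulr_ge0//= -[leRHS]mul1r ler_pM//.
have stE s : x + rc s *: ((rc t * c) *: v) = x + (rc (s * t) * c) *: v.
  by rewrite scalerA rcM mulrA.
have f0 : (j`!%:R : R) != 0 by rewrite pnatr_eq0 -lt0n fact_gt0.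
have j0 : (j.+1%:R : R) != 0 by rewrite pnatr_eq0.
pose C := B * (2 * nr c) ^+ j * t ^+ j.+1 * nr c / j`!%:R.
have := @mean_value R (fun s => g (x + rc s *: ((rc t * c) *: v)))
  (fun s => 'd g (x + rc s *: ((rc t * c) *: v)) ((rc t * c) *: v))
  (fun s => C / j.+1%:R * s ^+ j.+1) (fun s => C * s ^+ j).
rewrite rc1 rc0 scale1r scale0r addr0 gx subr0 expr1n mulr1 expr0n mulr0 subr0.
have -> : 2 * (C / j.+1%:R) = B * (2 * nr c) ^+ j.+1 * t ^+ j.+1 / j.+1`!%:R.
  rewrite /C factS natrM [(2 * nr c) ^+ j.+1]exprS; field.
  by rewrite f0 /= addrC natr1 j0.
apply.
- move=> s hs; apply: cder_line; apply: dfj; rewrite stE; apply: inb => //; exact: st.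
- move=> s hs.
  exact: is_derive_monomial.
- move=> s hs; have hh := inb c (s * t) hc (st s hs).
  rewrite linearZ /= linKE nrM nrM nr_rc ger0_norm//.
  have := IH (s * t) hc (st s hs); rewrite gD stE.
  rewrite (deriveE v (dfj _ _ hh)).
  move: ('d g _ v) => p hp.
  have := ler_wpM2l (mulr_ge0 t0 (nr_ge0 c)) hp; move=> /le_trans; apply.
  rewrite le_eqVlt; apply/orP; left; apply/eqP.
  by rewrite /C [(s * t) ^+ j]exprMn [t ^+ j.+1]exprS; field.
Qed.

(** The k-th derivative is at most M (8 k |v| / r)^k on the half ball, so [taylor_bound] and
    [expn_fact_bound] give M (64 |c v| / r)^k. The radius r / 128 makes the ratio at most 1 / 2. *)
Lemma flat_vanish f x v (r M : R) (c : K) : 0 < r -> holo_ball f x r -> bound_ball f x r M ->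
  (forall k, iter_derive v k f x = 0) -> nr (c *: v) < r / 128 -> f (x + c *: v) = 0.
Proof.
move=> r0 df hM h0 hc.
have M0 : 0 <= M by exact: bound_ge0 hM.
have r2 : 0 < r / 2 by lra.
have key k : (0 < k)%N -> nr (f (x + c *: v)) <= M * 2^-1 ^+ k.
  move=> k0; have kp : 0 < (k%:R : R) by rewrite ltr0n.
  have hB : bound_ball (iter_derive v k f) x (r / 2) (M * (8 * k%:R / r * nr v) ^+ k).
    have := @iter_derive_bound f x v r M k k r0 k0 df hM (leqnn k).
    by rewrite divff ?gt_eqF// mulr1 (_ : r - r / 2 = r / 2); last by field.
  have df2 : holo_ball f x (r / 2) by move=> y hy; apply: df; lra.
  have h01 : 0 <= (1 : R) <= 1 by rewrite ler01 lexx.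
  have hc2 : nr c * nr v < r / 2 by rewrite -nrZ; lra.
  have := taylor_bound r2 df2 (fun j _ => h0 j) hB (leqnn k) hc2 h01.
  rewrite subnn rc1 mul1r expr1n mulr1 => /le_trans; apply.
  rewrite -mulrA -mulrA ler_wpM2l//.
  rewrite mulrA -exprMn.
  have -> : 8 * k%:R / r * nr v * (2 * nr c) = k%:R * (16 * nr (c *: v) / r).
    by rewrite nrZ; ring.
  rewrite exprMn mulrAC.
  have q1 : (k%:R : R) ^+ k / k`!%:R <= 4 ^+ k.
    by rewrite ler_pdivrMr ?ltr0n ?fact_gt0// -!natrX -natrM ler_nat expn_fact_bound.
  have q2 : 0 <= 16 * nr (c *: v) / r by rewrite divr_ge0 ?(ltW r0)// mulr_ge0// nr_ge0.
  apply: (@le_trans _ _ (4 ^+ k * (16 * nr (c *: v) / r) ^+ k)).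
    by rewrite ler_wpM2r// exprn_ge0.
  rewrite -exprMn lerXn2r// ?nnegrE ?mulr_ge0//.
  - exact: nr_ge0.
  - by rewrite invr_ge0 ltW.
  have -> : 4 * (16 * nr (c *: v) / r) = nr (c *: v) * 64 / r by ring.
  by rewrite ler_pdivrMr//; lra.
apply/eqP; rewrite -nr_eq0; apply/negPn/negP => neq.
have a0 : 0 < nr (f (x + c *: v)) by rewrite lt_def neq nr_ge0.
have [n hn] := @exp_half_lt R (nr (f (x + c *: v)) / (M + 1)) (ltac:(by rewrite divr_gt0// ltr_wpDl)).
have := key n.+1 isT; apply/negP; rewrite -ltNge.
move: hn; rewrite ltr_pdivlMr ?ltr_wpDl//; apply: le_lt_trans.
have e0 : 0 <= (2^-1 : R) ^+ n by rewrite exprn_ge0// invr_ge0.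
rewrite exprS; move: (2^-1 ^+ n) e0 => X X0; nra.
Qed.

(** Vanishing near [x] kills all derivatives at [x] along y - x. The radius r / 128 reached does not
    depend on [b]. *)
Lemma zero_vanish f x y (r M b : R) : 0 < r -> holo_ball f x r -> bound_ball f x r M ->
  0 < b -> (forall z, nr (z - x) < b -> f z = 0) -> nr (y - x) < r / 128 -> f y = 0.
Proof.
move=> r0 df hM b0 hz hy.
have h k : forall z, nr (z - x) < b -> iter_derive (y - x) k f z = 0.
  elim: k => [|k IH] z zb; first exact: hz.
  rewrite /iter_derive iterS -/(iter_derive _ k f).
  have d0 : is_diff z (iter_derive (y - x) k f) ('d (cst (0 : K)) z).
    apply: (@near_diff_nr _ _ (cst 0) _ z (b - nr (z - x))) => //; first by lra.
    by move=> w hw; rewrite IH//; have := nr_trans w z x; lra.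
  have [dd dE] := d0.
  apply: (etrans (deriveE _ dd)); apply: (etrans (congr1 (fun k : V -> K => k _) dE)).
  by rewrite diff_cst.
have := @flat_vanish f x (y - x) r M 1 r0 df hM.
rewrite scale1r subrKC; apply => // k; apply: h; by rewrite subrr nr0.
Qed.

End OpenSets.

(** * Coordinate calculus *)

Section Differentiability.
Context {R : realType}.
Local Notation K := (Cx R).
Implicit Types V W : normedModType K.

Lemma near_differentiable V W (f g : V -> W) x :
  (\forall y \near x, f y = g y) -> differentiable f x -> differentiable g x.
Proof.
move=> /nbhs_nr[b b0 fg] df; have [B _ hB] := diff_bounded df.
have [//] : is_diff x g ('d f x).
apply: (is_diff_nr hB) => e e0; have [d d0 hd] := diff_nr df e0.
exists (Num.min d b); first by rewrite lt_min d0.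
move=> h; rewrite lt_min => /andP[h1 h2].
rewrite -!fg; first exact: hd.
  by rewrite subrr nr0.
by rewrite addrAC subrr add0r.
Qed.

Lemma near_derive V W (f g : V -> W) x v :
  (\forall y \near x, f y = g y) -> 'D_v f x = 'D_v g x.
Proof.
have [->|v0] := eqVneq v 0; first by rewrite !derive0.
by move=> fg; apply: near_eq_derive.
Qed.

Lemma derive_comp V W (W' : normedModType K) (f : V -> W) (g : W -> W') x v :
  differentiable f x -> differentiable g (f x) ->
  'D_v (g \o f) x = 'D_('D_v f x) g (f x).
Proof.
move=> df dg; rewrite (deriveE _ (differentiable_comp df dg)).
by rewrite (deriveE v df) (deriveE _ dg) diff_comp.
Qed.

Lemma deriveDl V W (f : V -> W) x u v : differentiable f x ->
  'D_(u + v) f x = 'D_u f x + 'D_v f x.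
Proof. by move=> df; rewrite !(deriveE _ df) linearD. Qed.

Lemma deriveBl V W (f : V -> W) x u v : differentiable f x ->
  'D_(u - v) f x = 'D_u f x - 'D_v f x.
Proof. by move=> df; rewrite !(deriveE _ df) linearB. Qed.

Lemma deriveZl V W (f : V -> W) x (c : K) v : differentiable f x ->
  'D_(c *: v) f x = c *: 'D_v f x.
Proof. by move=> df; rewrite !(deriveE _ df) linearZ. Qed.

Lemma derive_suml V W (f : V -> W) x (I : finType) (v : I -> V) : differentiable f x ->
  'D_(\sum_i v i) f x = \sum_i 'D_(v i) f x.
Proof.
move=> df; rewrite (deriveE _ df) linear_sum.
by apply: eq_bigr => i _; rewrite (deriveE _ df).
Qed.

Lemma differentiable_bigsum V W (I : Type) (s : seq I) (P : pred I) (f : I -> V -> W) x :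
  (forall i, P i -> differentiable (f i) x) ->
  differentiable (fun y => \sum_(i <- s | P i) f i y) x.
Proof.
move=> df; elim: s => [|i s IH].
  by rewrite (_ : (fun _ => _) = cst 0); [exact: differentiable_cst|apply/funext => y; rewrite big_nil].
have [Pi|/negbTE Pi] := boolP (P i).
  rewrite (_ : (fun _ => _) = f i + (fun y => \sum_(j <- s | P j) f j y)).
    by apply: differentiableD => //; exact: df.
  by apply/funext => y; rewrite big_cons Pi fctE.
rewrite (_ : (fun _ => _) = (fun y => \sum_(j <- s | P j) f j y))//.
by apply/funext => y; rewrite big_cons Pi.
Qed.

Lemma differentiable_bigprod V (I : Type) (s : seq I) (P : pred I) (f : I -> V -> K) x :
  (forall i, P i -> differentiable (f i) x) ->
  differentiable (fun y => \prod_(i <- s | P i) f i y) x.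
Proof.
move=> df; elim: s => [|i s IH].
  by rewrite (_ : (fun _ => _) = cst 1); [exact: differentiable_cst|apply/funext => y; rewrite big_nil].
have [Pi|/negbTE Pi] := boolP (P i).
  rewrite (_ : (fun _ => _) = f i * (fun y => \prod_(j <- s | P j) f j y)).
    by apply: differentiableM => //; exact: df.
  by apply/funext => y; rewrite big_cons Pi fctE.
rewrite (_ : (fun _ => _) = (fun y => \prod_(j <- s | P j) f j y))//.
by apply/funext => y; rewrite big_cons Pi.
Qed.

Lemma derive_bigsum V W (I : Type) (s : seq I) (f : I -> V -> W) x v :
  (forall i, differentiable (f i) x) ->
  'D_v (fun y => \sum_(i <- s) f i y) x = \sum_(i <- s) 'D_v (f i) x.
Proof.
move=> df; elim: s => [|i s IH].
  rewrite big_nil (_ : (fun _ => _) = cst 0); first exact: derive_cst.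
  by apply/funext => y; rewrite big_nil.
rewrite big_cons -IH (_ : (fun _ => _) = f i + (fun y => \sum_(j <- s) f j y)).
  rewrite deriveD//; first exact: diff_derivable.
  by apply: diff_derivable; exact: differentiable_bigsum.
by apply/funext => y; rewrite big_cons fctE.
Qed.

Lemma deriveMK V (f g : V -> K) x v : differentiable f x -> differentiable g x ->
  'D_v (fun y => f y * g y) x = f x * 'D_v g x + 'D_v f x * g x.
Proof.
move=> df dg; rewrite (_ : (fun y => _) = f * g); last by apply/funext => y; rewrite fctE.
rewrite deriveM; [|exact: diff_derivable..].
by congr (_ + _); rewrite linKE mulrC.
Qed.

Lemma differentiableMK V (f g : V -> K) x : differentiable f x -> differentiable g x ->
  differentiable (fun y => f y * g y) x.
Proof.
move=> df dg; rewrite (_ : (fun y => _) = f * g); last by apply/funext => y; rewrite fctE.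
exact: differentiableM.
Qed.

Variable n : nat.
Local Notation E := 'rV[K]_n.
Local Notation e := (@delta_mx K 1 n 0).

Lemma differentiable_entry (f : E -> E) z j : differentiable f z ->
  differentiable (fun w => f w 0 j) z.
Proof.
move=> df.
exact: (@differentiable_comp _ _ _ _ f (fun w : E => w 0 j) z df (differentiable_coord _ _ _)).
Qed.

Lemma derive_entry V (f : V -> E) z v j : differentiable f z ->
  'D_v (fun w => f w 0 j) z = ('D_v f z) 0 j.
Proof.
move=> df; have dc y : differentiable (fun w : E => w 0 j) y by exact: differentiable_coord.
rewrite (derive_comp v df (dc _)).
have lin : linear (fun w : E => w 0 j : K) by move=> a u w; rewrite !mxE.
pose lM := GRing.isLinear.Build _ _ _ _ _ lin.
pose L : {linear E -> K} := HB.pack (fun w : E => w 0 j : K) lM.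
rewrite (deriveE _ (dc _)).
have -> : (fun w : E => w 0 j) = L by [].
rewrite diff_lin// => y; apply: (@differentiable_continuous _ _ _ y L); exact: dc.
Qed.

Lemma differentiable_row V (f : V -> E) z : (forall j, differentiable (fun w => f w 0 j) z) ->
  differentiable f z.
Proof.
move=> df; rewrite (_ : f = (fun y => \sum_j f y 0 j *: e j)).
  by apply: differentiable_bigsum => j _; exact: differentiableZl.
by apply/funext => y; rewrite -row_sum_delta.
Qed.

Lemma derive_coord (f : E -> K) z v : differentiable f z ->
  'D_v f z = \sum_j v 0 j * 'D_(e j) f z.
Proof.
move=> df; rewrite {1}(row_sum_delta v) derive_suml//.
by apply: eq_bigr => j _; rewrite deriveZl.
Qed.

Lemma bracket_alg (a b s t : K) : s = t -> a - b = a + s - (b + t).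
Proof. by move=> ->; rewrite opprD addrACA subrr addr0. Qed.

Lemma mulrCA_eq (a b p q : K) : p = q -> a * (b * p) = b * (a * q).
Proof. by move=> ->; rewrite mulrCA. Qed.

Section Open.
Variable U : set E.
Hypothesis oU : open U.

Lemma differentiable_derive_along (f : E -> K) (eta : E -> E) :
  (forall z, U z -> differentiable f z) -> (forall z, U z -> differentiable eta z) ->
  forall z, U z -> differentiable (fun w => 'D_(eta w) f w) z.
Proof.
move=> df deta z Uz.
apply: (@near_differentiable _ _ (fun w => \sum_j eta w 0 j * 'D_(e j) f w)).
  near=> w; rewrite [RHS]derive_coord//; apply: df; near: w; exact: open_nbhs_nbhs.
apply: differentiable_bigsum => j _; apply: differentiableMK.
  by apply: differentiable_entry; exact: deta.
exact: (holo_derive (e j) oU df).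
Unshelve. all: by end_near. Qed.

Lemma derive_derive_along (f : E -> K) (eta : E -> E) u z :
  (forall z, U z -> differentiable f z) -> (forall z, U z -> differentiable eta z) -> U z ->
  'D_u (fun w => 'D_(eta w) f w) z =
  'D_('D_u eta z) f z + \sum_j eta z 0 j * 'D_u (fun w => 'D_(e j) f w) z.
Proof.
move=> df deta Uz.
have dj j := holo_derive (e j) oU df Uz.
have dej j : differentiable (fun w => eta w 0 j) z by apply: differentiable_entry; exact: deta.
pose G j w := eta w 0 j * 'D_(e j) f w.
have EG : \forall w \near z, 'D_(eta w) f w = \sum_j G j w.
  by near=> w; apply: derive_coord; apply: df; near: w; exact: open_nbhs_nbhs.
apply: (etrans (near_derive u EG)).
have h : 'D_u (fun w => \sum_j G j w) z = \sum_j 'D_u (G j) z.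
  by apply: derive_bigsum => j; exact: differentiableMK.
apply: (etrans h).
have h2 := derive_coord ('D_u eta z) (df z Uz).
apply: esym; apply: (etrans (congr1 (fun y => y + _) h2)).
rewrite -big_split /=; apply: eq_bigr => j _.
apply: esym; apply: (etrans (deriveMK u (dej j) (dj j))).
apply: (etrans (addrC _ _)); congr (_ * _ + _).
exact: (derive_entry u j (deta z Uz)).
Unshelve. all: by end_near. Qed.

(** The terms with second derivatives of [f] cancel by [derive_sym]; the terms with first
    derivatives form the bracket. *)
Lemma bracket_coord (f : E -> K) (xi eta : E -> E) z :
  (forall z, U z -> differentiable f z) -> (forall z, U z -> differentiable xi z) ->
  (forall z, U z -> differentiable eta z) -> U z ->
  'D_(xi z) (fun w => 'D_(eta w) f w) z - 'D_(eta z) (fun w => 'D_(xi w) f w) z =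
  'D_('D_(xi z) eta z - 'D_(eta z) xi z) f z.
Proof.
move=> df dxi deta Uz.
have E1 := derive_derive_along (xi z) df deta Uz.
have E2 := derive_derive_along (eta z) df dxi Uz.
apply: (etrans (congr2 (fun a b => a - b) E1 E2)).
apply: esym; apply: (etrans (deriveBl ('D_(xi z) eta z) ('D_(eta z) xi z) (df z Uz))).
have dj j := holo_derive (e j) oU df Uz.
have A (x y : E) : \sum_j y 0 j * 'D_x (fun w => 'D_(e j) f w) z =
    \sum_j \sum_i y 0 j * (x 0 i * 'D_(e i) (fun w => 'D_(e j) f w) z).
  apply: eq_bigr => j _; rewrite -mulr_sumr; congr (_ * _).
  exact: (derive_coord _ (dj j)).
have S : \sum_j eta z 0 j * 'D_(xi z) (fun w => 'D_(e j) f w) z =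
          \sum_j xi z 0 j * 'D_(eta z) (fun w => 'D_(e j) f w) z.
  apply: (etrans (A (xi z) (eta z))); apply: esym; apply: (etrans (A (eta z) (xi z))).
  rewrite exchange_big; apply: eq_bigr => i _; apply: eq_bigr => j _.
  exact: (mulrCA_eq _ _ (derive_sym (e i) (e j) oU df Uz)).
cbv beta; exact: (@bracket_alg _ _ _ _ S).
Qed.

End Open.
End Differentiability.

(** * Calculus on a complex manifold *)

Section Charts.
Context {R : realType} {n : nat} {T : topologicalType}.
Implicit Types (a : chart R n T) (x : T) (U : set T).

Lemma nbhs_chart_dom a x : chart_dom a x -> nbhs x (chart_dom a).
Proof. by move=> ax; apply: open_nbhs_nbhs; split => //; exact: chart_dom_open. Qed.

Lemma chart_pull a x (A : set T) : chart_dom a x -> nbhs x A ->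
  \forall z \near a x, [/\ chart_dom a (chart_inv a z), a (chart_inv a z) = z & A (chart_inv a z)].
Proof.
move=> ax xA.
have im : (a @` chart_dom a) (a x) by exists x.
have h1 : nbhs (a x) (a @` chart_dom a).
  by apply: open_nbhs_nbhs; split => //; exact: chart_img_open.
have h2 : \forall z \near a x, A (chart_inv a z).
  by apply: (chart_inv_cont im); rewrite chart_mapK.
near=> z; have Az : A (chart_inv a z) by near: z.
have [y ay yz] : (a @` chart_dom a) z by near: z.
by split => //; rewrite -yz chart_mapK.
Unshelve. all: by end_near. Qed.

Lemma open_chart_image a U : open U ->
  open [set z | (a @` chart_dom a) z /\ U (chart_inv a z)].
Proof.
move=> oU; rewrite openE => z [[x ax <-] Ux]; rewrite (chart_mapK ax) in Ux.
have nx : nbhs x U by exact: open_nbhs_nbhs.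
apply: filterS (chart_pull ax nx) => w [h1 h2 h3].
by split => //; exists (chart_inv a w).
Qed.

End Charts.

Section Manifold.
Context {R : realType} {n : nat} {M : complex_manifold R n}.
Local Notation K := (Cx R).
Local Notation E := 'rV[K]_n.
Implicit Types (a b : chart R n M) (x y : M) (U : set M) (X Y : vfield M).

Lemma chart_push a x (A : set E) : chart_dom a x -> nbhs (a x) A ->
  \forall y \near x, chart_dom a y /\ A (a y).
Proof.
move=> ax xA.
have h1 := nbhs_chart_dom ax.
have h2 : \forall y \near x, A (a y) by exact: (chart_map_cont ax).
by near=> y; split; near: y.
Unshelve. all: by end_near. Qed.

Definition hol {W : normedModType K} (f : M -> W) (x : M) :=
  forall a, chart_at x a -> differentiable (f \o chart_inv a) (a x).

Lemma chart_at_ex x : exists a, chart_at x a.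
Proof. by have [a ha ax] := atlas_cover x; exists a. Qed.

Lemma chart_nbhs x a : chart_at x a -> \forall y \near x, chart_at y a.
Proof.
move=> [ha ax]; have h1 := nbhs_chart_dom ax.
by near=> y; split => //; near: y.
Unshelve. all: by end_near. Qed.

Section Hol.
Context {W : normedModType K}.
Implicit Types f g : M -> W.

Lemma hol_chart a f x : chart_at x a -> differentiable (f \o chart_inv a) (a x) -> hol f x.
Proof.
move=> [ha ax] df b [hb bx].
have [_ dab] := atlas_compatible ha hb ax bx.
have e : a x = (a \o chart_inv b) (b x) by rewrite /comp chart_mapK.
have df' : differentiable (f \o chart_inv a) ((a \o chart_inv b) (b x)).
  by rewrite -e.
apply: (near_differentiable _ (differentiable_comp dab df')).
apply: filterS (chart_pull bx (nbhs_chart_dom ax)) => z [h1 h2 h3] /=.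
by rewrite chart_mapK.
Qed.

Lemma hol_near f g x : (\forall y \near x, f y = g y) -> hol f x -> hol g x.
Proof.
move=> fg hf a [ha ax]; apply: (near_differentiable _ (hf a (conj ha ax))).
by apply: filterS (chart_pull ax fg) => z [].
Qed.

Lemma hol_continuous f x : hol f x -> {for x, continuous f}.
Proof.
move=> hf; have [a [ha ax]] := chart_at_ex x.
have c1 := differentiable_continuous (hf a (conj ha ax)).
have c2 : {for x, continuous ((f \o chart_inv a) \o a)}.
  by apply: continuous_comp => //; exact: chart_map_cont.
move=> A; rewrite /= in c2 *.
have nE : \forall y \near x, (f \o chart_inv a \o a) y = f y.
  by apply: filterS (chart_nbhs (conj ha ax)) => y [_ ay] /=; rewrite chart_mapK.
have := c2 A; rewrite /= chart_mapK// => c3 /c3 h.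
have hA : \forall y \near x, A (f y).
  near=> y; have -> : f y = (f \o chart_inv a \o a) y by apply/esym; near: y.
  by near: y.
exact: hA.
Unshelve. all: by end_near. Qed.

Lemma hol_cst (c : W) x : hol (fun _ : M => c) x.
Proof. by move=> a _; exact: differentiable_cst. Qed.

Lemma holD f g x : hol f x -> hol g x -> hol (fun y => f y + g y) x.
Proof. by move=> hf hg a ha; exact: (differentiableD (hf a ha) (hg a ha)). Qed.

Lemma holB f g x : hol f x -> hol g x -> hol (fun y => f y - g y) x.
Proof. by move=> hf hg a ha; exact: (differentiableB (hf a ha) (hg a ha)). Qed.

Lemma hol_sum (I : Type) (s : seq I) (P : pred I) (f : I -> M -> W) x :
  (forall i, P i -> hol (f i) x) -> hol (fun y => \sum_(i <- s | P i) f i y) x.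
Proof.
move=> hf a ha.
by apply: (@differentiable_bigsum _ _ _ _ s P (fun i => f i \o chart_inv a)) => i Pi; exact: hf.
Qed.

End Hol.

Lemma holM (f g : M -> K) x : hol f x -> hol g x -> hol (fun y => f y * g y) x.
Proof. by move=> hf hg a ha; exact: (differentiableMK (hf a ha) (hg a ha)). Qed.

Lemma hol_prod (I : Type) (s : seq I) (P : pred I) (f : I -> M -> K) x :
  (forall i, P i -> hol (f i) x) -> hol (fun y => \prod_(i <- s | P i) f i y) x.
Proof.
move=> hf a ha.
by apply: (@differentiable_bigprod _ _ _ s P (fun i => f i \o chart_inv a)) => i Pi; exact: hf.
Qed.

Lemma holV (f : M -> K) x : hol f x -> f x != 0 -> hol (fun y => (f y)^-1) x.
Proof.
move=> hf fx a ha; have [_ ax] := ha.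
by apply: (differentiableV (hf a ha)); rewrite /= chart_mapK.
Qed.

Lemma hol_entry (f : M -> E) x j : hol f x -> hol (fun y => f y 0 j) x.
Proof.
by move=> hf a ha; exact: (differentiable_comp (hf a ha) (differentiable_coord _ 0 j)).
Qed.

Lemma hol_neq0_near (f : M -> K) x : hol f x -> f x != 0 -> \forall y \near x, f y != 0.
Proof. by move=> hf f0; exact: (hol_continuous hf (nbhs_neq0 f0)). Qed.

Section LieDerivative.
Variable a : chart R n M.
Hypothesis ha : atlas a.

Lemma lieD_near (X : vfield M) (f g : M -> K) x : chart_dom a x ->
  (\forall y \near x, f y = g y) -> lieD a X f x = lieD a X g x.
Proof.
move=> ax fg; apply: near_derive.
by apply: filterS (chart_pull ax fg) => z [].
Qed.

Lemma lieDD X (f g : M -> K) x : chart_dom a x -> hol f x -> hol g x ->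
  lieD a X (fun y => f y + g y) x = lieD a X f x + lieD a X g x.
Proof.
move=> ax hf hg.
by apply: (deriveD (diff_derivable (hf a _)) (diff_derivable (hg a _))).
Qed.

Lemma lieDM X (f g : M -> K) x : chart_dom a x -> hol f x -> hol g x ->
  lieD a X (fun y => f y * g y) x = f x * lieD a X g x + lieD a X f x * g x.
Proof.
move=> ax hf hg; have hx : chart_at x a by [].
have := deriveMK (X a x) (hf a hx) (hg a hx).
by rewrite /= chart_mapK.
Qed.

Lemma lieD_cst X (c : K) x : lieD a X (fun=> c) x = 0.
Proof. exact: derive_cst. Qed.

Lemma lieDZ X (c : K) (f : M -> K) x : chart_dom a x -> hol f x ->
  lieD a X (fun y => c * f y) x = c * lieD a X f x.
Proof.
by move=> ax hf; rewrite lieDM//; [rewrite lieD_cst mul0r addr0|exact: hol_cst].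
Qed.

Lemma lieD_comb (I : finType) (h : I -> M -> K) (X : I -> vfield M) (Y : vfield M) (f : M -> K) x :
  chart_dom a x -> hol f x -> Y a x = \sum_i h i x *: X i a x ->
  lieD a Y f x = \sum_i h i x * lieD a (X i) f x.
Proof.
move=> ax hf YE; have hx : chart_at x a by [].
rewrite /lieD YE (derive_suml _ (hf a hx)); apply: eq_bigr => i _.
exact: (deriveZl _ _ (hf a hx)).
Qed.

(** The transformation law in [is_vfield] is the chain rule for the change of charts. *)
Lemma lieD_chart b U X (f : M -> K) x : is_vfield U X -> U x -> chart_at x a -> chart_at x b ->
  hol f x -> lieD a X f x = lieD b X f x.
Proof.
move=> [_ XU] Ux hx hy hf; have [_ ax] := hx; have [hb bx] := hy.
rewrite /lieD (XU x Ux a b hx hy).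
have [dba _] := atlas_compatible ha hb ax bx.
have E2 : (b \o chart_inv a) (a x) = b x by rewrite /comp chart_mapK.
have df' : differentiable (f \o chart_inv b) ((b \o chart_inv a) (a x)).
  by rewrite E2; exact: hf.
have E1 := derive_comp (X a x) dba df'.
set v := 'D_(X a x) (b \o chart_inv a) (a x) in E1 *.
have E3 := congr1 (fun z => 'D_v (f \o chart_inv b) z) E2.
apply: (etrans _ (etrans E1 E3)).
apply: near_derive.
apply: filterS (chart_pull ax (nbhs_chart_dom bx)) => z [h1 h2 h3] /=.
by rewrite chart_mapK.
Qed.

Section Domain.
Variable U : set M.
Hypothesis oU : open U.

Let O := [set z | (a @` chart_dom a) z /\ U (chart_inv a z)].

Let oO : open O.
Proof. exact: open_chart_image. Qed.

Let O_img x : chart_dom a x -> U x -> O (a x).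
Proof. by move=> ax Ux; split; [exists x|rewrite chart_mapK]. Qed.

Let O_ex z : O z -> exists x, [/\ chart_dom a x, U x & z = a x].
Proof. by move=> [[x ax <-]]; rewrite chart_mapK// => Ux; exists x. Qed.

Let O_diff (W : normedModType K) (f : M -> W) : holo_on (U `&` chart_dom a) f ->
  forall z, O z -> differentiable (f \o chart_inv a) z.
Proof. by move=> hf z /O_ex[x [ax Ux ->]]; apply: hf. Qed.

Let lieD_O X (f : M -> K) z : O z ->
  (lieD a X f \o chart_inv a) z = 'D_((X a \o chart_inv a) z) (f \o chart_inv a) z.
Proof. by move=> /O_ex[x [ax Ux ->]]; rewrite /= chart_mapK. Qed.

Lemma hol_lieD X (f : M -> K) : holo_on (U `&` chart_dom a) (X a) ->
  holo_on (U `&` chart_dom a) f -> holo_on (U `&` chart_dom a) (lieD a X f).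
Proof.
move=> hX hf x [Ux ax]; apply: (@hol_chart _ a) => //.
have Oz := O_img ax Ux.
have D := differentiable_derive_along oO (O_diff hf) (O_diff hX) Oz.
apply: (near_differentiable _ D).
apply: filterS (open_nbhs_nbhs (conj oO Oz)) => z Oz'.
exact: (esym (lieD_O X f Oz')).
Qed.

Lemma lieD_bracket X Y (f : M -> K) x : holo_on (U `&` chart_dom a) (X a) ->
  holo_on (U `&` chart_dom a) (Y a) -> holo_on (U `&` chart_dom a) f ->
  U x -> chart_dom a x ->
  lieD a X (lieD a Y f) x - lieD a Y (lieD a X f) x = lieD a (lie_bracket X Y) f x.
Proof.
move=> hX hY hf Ux ax; have Oz := O_img ax Ux.
have B := bracket_coord oO (O_diff hf) (O_diff hX) (O_diff hY) Oz.
have xK : chart_inv a (a x) = x by rewrite chart_mapK.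
have near_lie Y' : \forall z \near a x, (lieD a Y' f \o chart_inv a) z =
    'D_((Y' a \o chart_inv a) z) (f \o chart_inv a) z.
  by apply: filterS (open_nbhs_nbhs (conj oO Oz)) => z; exact: lieD_O.
have E1 := near_derive (X a x) (near_lie Y).
have E2 := near_derive (Y a x) (near_lie X).
apply: (etrans (congr2 (fun p q => p - q) E1 E2)).
by move: B; rewrite /= xK.
Qed.

End Domain.
End LieDerivative.

End Manifold.

(** * Iterated derivatives along a foliation *)

Lemma poly_vanish (K : numFieldType) (p : {poly K}) : (forall c, p.[c] = 0) -> p = 0.
Proof.
move=> hp; apply/eqP; apply/negPn/negP => p0.
pose s := [seq (k%:R : K) | k <- iota 0 (size p)].
have us : uniq s by rewrite map_inj_uniq ?iota_uniq// => i j /eqP; rewrite eqr_nat => /eqP.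
have rs : all (root p) s by apply/allP => c _; rewrite /root hp.
by have := max_poly_roots p0 rs us; rewrite size_map size_iota ltnn.
Qed.

(** * Polarization of a symmetric form on words *)

Section Polarization.
Variables (K : numFieldType) (E : Type) (S : E -> Prop) (comb : K -> E -> E -> E).
Variables (m : nat) (T : seq E -> K).
Hypothesis m0 : (0 < m)%N.
Hypothesis S_comb : forall c X Y, S X -> S Y -> S (comb c X Y).
Let good l := size l = m /\ List.Forall S l.
Hypothesis T_swap : forall l1 X Y l2, good (l1 ++ X :: Y :: l2) ->
  T (l1 ++ X :: Y :: l2) = T (l1 ++ Y :: X :: l2).
Hypothesis T_lin : forall c X Y l, S X -> S Y -> good (X :: l) ->
  T (comb c X Y :: l) = T (X :: l) + c * T (Y :: l).
Hypothesis T_diag : forall X, S X -> T (nseq m X) = 0.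

Let good_cat l1 l2 : good (l1 ++ l2) <->
  [/\ (size l1 + size l2)%N = m, List.Forall S l1 & List.Forall S l2].
Proof.
rewrite /good size_cat; split.
  by move=> [h1 /List.Forall_app[]].
by move=> [h1 h2 h3]; split => //; apply/List.Forall_app.
Qed.

Let Forall_nseq k X : S X -> List.Forall S (nseq k X).
Proof. by move=> SX; elim: k => [|k IH] /=; constructor. Qed.

Let T_front l1 X l2 : good (l1 ++ X :: l2) -> T (l1 ++ X :: l2) = T (X :: l1 ++ l2).
Proof.
elim/last_ind: l1 l2 => [//|l1 Z IH] l2.
rewrite !cat_rcons => h; rewrite T_swap//; apply: IH.
move: h => /good_cat[h1 h2 h3]; apply/good_cat; split => //.
move/List.Forall_cons_iff: h3 => [hZ /List.Forall_cons_iff[hX hl]].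
by do 2 constructor => //.
Qed.

(** Linearity is assumed in the first letter only; exchanges of neighbours carry it to every
    place. *)
Let T_linr l1 c X Y l2 : S X -> S Y -> good (l1 ++ X :: l2) ->
  T (l1 ++ comb c X Y :: l2) = T (l1 ++ X :: l2) + c * T (l1 ++ Y :: l2).
Proof.
move=> SX SY g; have /good_cat[g1 g2 g3] := g.
move/List.Forall_cons_iff: (g3) => [_ hl].
have gg Z : S Z -> good (l1 ++ Z :: l2) by move=> SZ; apply/good_cat; split => //; constructor.
rewrite !T_front; [|by apply: gg => //; exact: S_comb..].
apply: T_lin => //; split; first by rewrite /= size_cat -g1 addnS.
by constructor => //; apply/List.Forall_app.
Qed.

(* Since [T] vanishes on the diagonal, so does this polynomial at every [c]; its
   linear coefficient is then zero, which trades one [X] for [Y]. *)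
Let T_poly X Y : S X -> S Y -> forall k l, List.Forall S l -> (k + size l = m)%N ->
  exists p : {poly K}, [/\ forall c, p.[c] = T (nseq k (comb c X Y) ++ l),
    p`_0 = T (nseq k X ++ l) & p`_1 = k%:R * T (nseq k.-1 X ++ Y :: l)].
Proof.
move=> SX SY; elim=> [|k IH] l hl sl.
  exists (T l)%:P; split => [c||]; first by rewrite hornerC.
    by rewrite coefC.
  by rewrite coefC mul0r.
have [||p [p1 p2 p3]] := IH (X :: l); [by constructor|by rewrite /= addnS|].
have [||q [q1 q2 q3]] := IH (Y :: l); [by constructor|by rewrite /= addnS|].
exists (p + 'X * q); split.
- move=> c; rewrite hornerD hornerM hornerX p1 q1 /=.
  have SZ := S_comb c SX SY.
  have gX : good (nseq k (comb c X Y) ++ X :: l).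
    by apply/good_cat; rewrite size_nseq /= addnS; split => //; [exact: Forall_nseq|constructor].
  rewrite -T_linr// T_front//.
  by apply/good_cat; rewrite size_nseq /= addnS; split => //; [exact: Forall_nseq|constructor].
- rewrite coefD coefXM /= addr0 p2 /= T_front//.
  by apply/good_cat; rewrite size_nseq /= addnS; split => //; [exact: Forall_nseq|constructor].
- rewrite coefD coefXM /= p3 q2; case: k {IH} sl p1 p2 p3 q1 q2 q3 => [|k] sl _ _ _ _ _ _.
    by rewrite mul0r add0r mul1r.
  rewrite /= [T (nseq k X ++ Y :: X :: l)]T_swap; last first.
    apply/good_cat; rewrite size_nseq /= !addnS -sl !addSn; split => //; first exact: Forall_nseq.
    by do 2 constructor => //.
  have -> : T (nseq k X ++ X :: Y :: l) = T (X :: nseq k X ++ Y :: l).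
    apply: T_front; apply/good_cat; rewrite size_nseq /= !addnS -sl !addSn; split => //; first exact: Forall_nseq.
    by do 2 constructor => //.
  by rewrite -[k.+2%:R]natr1 mulrDl mul1r.
Qed.

(** Induction on the number k of letters that may differ from [X]: k = 0 is the diagonal, and the
    polynomial of [T_poly] frees one more letter. *)
Lemma polarization l : good l -> T l = 0.
Proof.
have key k : (k <= m)%N -> forall X l, S X -> List.Forall S l -> (m - k + size l = m)%N ->
    T (nseq (m - k) X ++ l) = 0.
  elim: k => [_|k IH km] X l' SX hl sl.
    move: sl; rewrite subn0 => /eqP; rewrite -[eqbRHS]addn0 eqn_add2l => /eqP/size0nil ->.
    by rewrite cats0 T_diag.
  case: l' hl sl => [|Y l'] hl sl.
    move: sl; rewrite addn0 => sl; exfalso; move: sl.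
    by apply/eqP; rewrite neq_ltn ltn_subrL (leq_ltn_trans _ km).
  move/List.Forall_cons_iff: hl => [SY hl].
  have mk : (m - k = (m - k.+1).+1)%N by rewrite subnSK.
  have [|p [p1 p2 p3]] := T_poly SX SY (k := m - k) hl.
    by rewrite mk addSn -addnS.
  have p0 : p = 0.
    apply: poly_vanish => c; rewrite p1; apply: IH => //; first exact: ltnW.
      exact: S_comb.
    by rewrite mk addSn -addnS.
  move: p3; rewrite p0 coef0 mk /= => /esym/eqP.
  by rewrite mulf_eq0 pnatr_eq0 /= => /eqP.
move=> [sl hl]; case: l sl hl => [|X l] sl hl; first by move: m0; rewrite -sl.
move/List.Forall_cons_iff: hl => [SX hl].
by have := key m (leqnn m) X (X :: l) SX; rewrite subnn /=; apply => //; constructor.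
Qed.

End Polarization.

(** * Flatness to finite order along a foliation *)

Section Flat.
Context {R : realType} {n : nat} {M : complex_manifold R n}.
Local Notation K := (Cx R).
Implicit Types (a b : chart R n M) (x y : M) (U W : set M) (X Y : vfield M) (f g h : M -> K).

Definition hol_near_at f x := \forall y \near x, hol f y.

Lemma hol_near_open f x : hol_near_at f x ->
  exists U, [/\ open U, U x & forall y, U y -> hol f y].
Proof.
move=> hf; exists (interior [set y | hol f y]); split => //; first exact: open_interior.
by move=> y /interior_subset.
Qed.

Lemma near_near (P : M -> Prop) x : (\forall y \near x, P y) ->
  \forall y \near x, \forall z \near y, P z.
Proof. by move=> /nbhs_interior. Qed.

Variable F : foliation M.

(* Words rather than powers of one field: this is linear in [g], compatible with
   multiplication of the fields by functions, and can be tested on generators. *)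
Fixpoint fl a (m : nat) (g : M -> K) (x : M) : Prop :=
  g x = 0 /\ (if m is m'.+1 then
    forall U X, open U -> U x -> F U X -> fl a m' (lieD a X g) x else True).

Lemma fl0 a m g x : fl a m g x -> g x = 0.
Proof. by case: m => [|m] []. Qed.

Lemma fl_mono a m g x : fl a m.+1 g x -> fl a m g x.
Proof.
elim: m g => [|m IH] g [h1 h2]; first by split.
by split => // U X oU Ux FX; apply: IH; exact: (h2 U X oU Ux FX).
Qed.

Lemma fl_le a m m' g x : (m' <= m)%N -> fl a m g x -> fl a m' g x.
Proof.
move=> /subnK <-; elim: (m - m')%N => [|k IH]; first by rewrite add0n.
by rewrite addSn => /fl_mono.
Qed.

Lemma fl_near a m f g x : chart_at x a -> (\forall y \near x, f y = g y) ->
  fl a m f x -> fl a m g x.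
Proof.
move=> ha; elim: m f g => [|m IH] f g fg [h1 h2].
  by split => //; rewrite -(nbhs_singleton fg).
split; first by rewrite -(nbhs_singleton fg).
move=> U X oU Ux FX; apply: (IH (lieD a X f)); last exact: (h2 U X oU Ux FX).
have ca := chart_nbhs ha; have ff := near_near fg.
near=> y; apply: lieD_near; last by near: y.
by have [] : chart_at y a by near: y.
Unshelve. all: by end_near. Qed.

Lemma vfield_hol U X a : is_vfield U X -> atlas a -> holo_on (U `&` chart_dom a) (X a).
Proof. by move=> [h _]; exact: h. Qed.

Lemma hol_near_lieD a f U X x : chart_at x a -> hol_near_at f x -> open U -> U x ->
  F U X -> hol_near_at (lieD a X f) x.
Proof.
move=> [ha ax] /hol_near_open[W [oW Wx hf]] oU Ux FX.
have hX := vfield_hol (tsheaf_vfield oU FX) ha.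
have oUW : open (U `&` W) by exact: openI.
have H : holo_on ((U `&` W) `&` chart_dom a) (lieD a X f).
  apply: hol_lieD => //.
    by move=> y [[Uy _] ay]; exact: hX.
  by move=> y [[_ Wy] _]; exact: hf.
have o3 : open ((U `&` W) `&` chart_dom a) by apply: openI => //; exact: chart_dom_open.
by apply: filterS (open_nbhs_nbhs (conj o3 _)) => [y|]; [exact: H|].
Qed.

Lemma fl_add a m f g x : chart_at x a -> hol_near_at f x -> hol_near_at g x ->
  fl a m f x -> fl a m g x -> fl a m (fun y => f y + g y) x.
Proof.
move=> ha; elim: m f g => [|m IH] f g hf hg [f1 f2] [g1 g2].
  by split => //; rewrite f1 g1 addr0.
split; first by rewrite f1 g1 addr0.
move=> U X oU Ux FX; apply: (@fl_near _ _ (fun y => lieD a X f y + lieD a X g y) _ _ ha).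
  have ca := chart_nbhs ha.
  near=> y; apply/esym; have [hay ay] : chart_at y a by near: y.
  by apply: lieDD => //; near: y.
apply: IH; [exact: (hol_near_lieD ha hf oU)|exact: (hol_near_lieD ha hg oU)|exact: (f2 U X oU Ux FX)|exact: (g2 U X oU Ux FX)].
Unshelve. all: by end_near. Qed.

Lemma hol_nearM f g x : hol_near_at f x -> hol_near_at g x -> hol_near_at (fun y => f y * g y) x.
Proof.
by move=> hf hg; near=> y; apply: holM; near: y.
Unshelve. all: by end_near. Qed.

(** By Leibniz, X (h f) = h (X f) + (X h) f, and both X f and f are flat to one order less, whatever
    [h] is. *)
Lemma fl_mul a m h f x : chart_at x a -> hol_near_at h x -> hol_near_at f x ->
  fl a m f x -> fl a m (fun y => h y * f y) x.
Proof.
move=> ha; elim: m h f => [|m IH] h f hh hf Hf; have [f1 f2] := Hf.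
  by split => //; rewrite f1 mulr0.
split; first by rewrite f1 mulr0.
move=> U X oU Ux FX.
apply: (@fl_near _ _ (fun y => h y * lieD a X f y + lieD a X h y * f y) _ _ ha).
  have ca := chart_nbhs ha.
  near=> y; apply/esym; have [hay ay] : chart_at y a by near: y.
  by apply: lieDM => //; near: y.
have hXf := hol_near_lieD ha hf oU Ux FX; have hXh := hol_near_lieD ha hh oU Ux FX.
apply: fl_add => //; try exact: hol_nearM.
  by apply: IH => //; exact: (f2 U X oU Ux FX).
by apply: IH => //; exact: fl_mono.
Unshelve. all: by end_near. Qed.

Lemma fl_zero a m x : chart_at x a -> fl a m (fun=> 0) x.
Proof.
move=> ha; elim: m => [|m IH]; split => //= U X _ _ _.
by apply: (fl_near ha _ IH); apply: nearW => y; rewrite lieD_cst.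
Qed.

Lemma fl_sum a m (I : finType) (f : I -> M -> K) x : chart_at x a ->
  (forall i, hol_near_at (f i) x) -> (forall i, fl a m (f i) x) ->
  fl a m (fun y => \sum_i f i y) x.
Proof.
move=> ha hf hfl; suff [] : hol_near_at (fun y => \sum_(i <- index_enum I) f i y) x /\
    fl a m (fun y => \sum_(i <- index_enum I) f i y) x by [].
elim: (index_enum I) => [|i s [IH1 IH2]].
  split; first by apply: nearW => y a' _; rewrite (_ : _ \o _ = cst 0); [exact: differentiable_cst|apply/funext => z /=; rewrite big_nil].
  by apply: (fl_near ha _ (fl_zero m ha)); apply: nearW => y; rewrite big_nil.
split.
  have hi := hf i; near=> y.
  apply: (@hol_near _ _ _ _ (fun z => f i z + \sum_(j <- s) f j z)).
    by apply: nearW => z; rewrite big_cons.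
  by apply: holD; near: y.
apply: (@fl_near _ _ (fun z => f i z + \sum_(j <- s) f j z)) => //.
  by apply: nearW => z; rewrite big_cons.
exact: fl_add.
Unshelve. all: by end_near. Qed.

Lemma fl_chart a b m f x : chart_at x a -> chart_at x b -> hol_near_at f x ->
  fl a m f x -> fl b m f x.
Proof.
move=> ha hb; elim: m f => [|m IH] f hf [f1 f2]; first by split.
split; first exact: f1.
move=> U X oU Ux FX.
apply: (@fl_near _ _ (lieD a X f) _ _ hb).
  have ca := chart_nbhs ha; have cb := chart_nbhs hb.
  have nU : nbhs x U by exact: open_nbhs_nbhs.
  near=> y; have hay : chart_at y a by near: y.
  have hby : chart_at y b by near: y.
  have Uy : U y by near: y.
  have hfy : hol f y by near: y.
  exact: (lieD_chart (proj1 ha) (tsheaf_vfield oU FX) Uy hay hby hfy).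
by apply: IH; [exact: (hol_near_lieD ha hf oU)|exact: (f2 U X oU Ux FX)].
Unshelve. all: by end_near. Qed.

(** Near each point a field of [F] is a combination of the generators with holomorphic coefficients,
    and [fl_mul] absorbs the coefficients. *)
Lemma fl_generates a m k U (X : 'I_k -> vfield M) f x : open U -> U x -> chart_at x a ->
  generates F U X -> hol_near_at f x ->
  fl a m.+1 f x <-> f x = 0 /\ forall i, fl a m (lieD a (X i) f) x.
Proof.
move=> oU Ux ha [FX gX] hf; split=> [[f1 f2]|[f1 f2]].
  by split => // i; exact: (f2 U (X i) oU Ux (FX i)).
split => // W Y oW Wx FY.
have oUW : open (U `&` W) by exact: openI.
have FUW := tsheaf_restrict oW oUW (@subIsetr _ U W) FY.
have [W' [h [oW' W'x W'sub hh hY]]] := gX _ Y x oUW (@subIsetl _ U W) FUW (conj Ux Wx).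
apply: (@fl_near _ _ (fun y => \sum_i h i y * lieD a (X i) f y) _ _ ha).
  have ca := chart_nbhs ha.
  have nW' : nbhs x W' by exact: open_nbhs_nbhs.
  near=> y; apply/esym; have [hay ay] : chart_at y a by near: y.
  have hfy : hol f y by near: y.
  have W'y : W' y by near: y.
  exact: (lieD_comb hay ay hfy (hY y W'y a (conj hay ay))).
have hhn i : hol_near_at (h i) x.
  by apply: filterS (open_nbhs_nbhs (conj oW' W'x)) => y; exact: hh.
apply: fl_sum => // i.
  by apply: hol_nearM => //; exact: (hol_near_lieD ha hf oU).
by apply: fl_mul => //; exact: (hol_near_lieD ha hf oU).
Unshelve. all: by end_near. Qed.

Fixpoint wl a (Xs : seq (vfield M)) (g : M -> K) : M -> K :=
  if Xs is X :: Xs' then wl a Xs' (lieD a X g) else g.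

Lemma wl_cat a l1 l2 g : wl a (l1 ++ l2) g = wl a l2 (wl a l1 g).
Proof. by elim: l1 g => [|X l1 IH] g //=. Qed.

Lemma wl_nseq a k X g : wl a (nseq k X) g = iter k (lieD a X) g.
Proof. by elim: k g => [|k IH] g //=; rewrite IH -iterSr. Qed.

Section OpenDomain.
Variables (a : chart R n M) (D : set M).
Hypothesis ha : atlas a.
Hypothesis oD : open D.
Hypothesis Da : D `<=` chart_dom a.
Variable S : vfield M -> Prop.
Hypothesis SX : forall X, S X -> holo_on D (X a).

Let DE : D `&` chart_dom a = D.
Proof. by apply: setIidl. Qed.

Lemma hol_lieD_dom X f : S X -> holo_on D f -> holo_on D (lieD a X f).
Proof.
move=> /SX hX hf; have := @hol_lieD _ _ _ a ha D oD X f; rewrite DE; exact.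
Qed.

Lemma hol_wl l f : List.Forall S l -> holo_on D f -> holo_on D (wl a l f).
Proof.
elim: l f => [|X l IH] f //= /List.Forall_cons_iff[hX hl] hf.
by apply: IH => //; exact: hol_lieD_dom.
Qed.

Lemma lieD_eq_on X f g : (forall y, D y -> f y = g y) -> forall y, D y -> lieD a X f y = lieD a X g y.
Proof.
move=> fg y Dy; apply: lieD_near; first exact: Da.
by apply: filterS (open_nbhs_nbhs (conj oD Dy)).
Qed.

Lemma wl_eq_on l f g : (forall y, D y -> f y = g y) -> forall y, D y -> wl a l f y = wl a l g y.
Proof.
elim: l f g => [|X l IH] f g fg; first exact: fg.
exact: (IH _ _ (lieD_eq_on X fg)).
Qed.

Lemma lieD_lin_on X f g (c : K) : holo_on D f -> holo_on D g ->
  forall y, D y -> lieD a X (fun z => f z + c * g z) y = lieD a X f y + c * lieD a X g y.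
Proof.
move=> hf hg y Dy; have hfy : hol f y := hf y Dy; have hgy : hol g y := hg y Dy.
have hc : hol (fun z => c * g z) y by apply: holM => //; exact: hol_cst.
rewrite (lieDD ha X (Da Dy) hfy hc).
by rewrite (lieDZ ha X c (Da Dy) hgy).
Qed.

Lemma wl_lin_on l f g (c : K) : List.Forall S l -> holo_on D f -> holo_on D g ->
  forall y, D y -> wl a l (fun z => f z + c * g z) y = wl a l f y + c * wl a l g y.
Proof.
elim: l f g => [|X l IH] f g; first by [].
move=> /List.Forall_cons_iff[hX hl] hf hg y Dy.
apply: (etrans (wl_eq_on l (lieD_lin_on X c hf hg) Dy)).
exact: (IH _ _ hl (hol_lieD_dom hX hf) (hol_lieD_dom hX hg) y Dy).
Qed.

Lemma wl_sum_on (I : Type) (s : seq I) l (f : I -> M -> K) (d : I -> K) : List.Forall S l ->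
  (forall i, holo_on D (f i)) -> forall y, D y ->
  wl a l (fun z => \sum_(i <- s) d i * f i z) y = \sum_(i <- s) d i * wl a l (f i) y.
Proof.
move=> hl hf; elim: s => [|i s IH] y Dy.
  rewrite [RHS]big_nil.
  have h0 : holo_on D (fun _ : M => 0 : K) by move=> z _; exact: hol_cst.
  (* Linearity with f = g = 0 and c = -1 shows that a word sends 0 to 0. *)
  have E := wl_lin_on (-1) hl h0 h0 Dy.
  have E0 : wl a l (fun=> 0) y + -1 * wl a l (fun=> 0) y = 0 by rewrite mulN1r subrr.
  apply: (etrans _ (etrans E E0)).
  by apply: wl_eq_on => // z _; rewrite big_nil mulr0 addr0.
rewrite big_cons.
have hs : holo_on D (fun z => \sum_(j <- s) d j * f j z).
  move=> z Dz; apply: hol_sum => j _; apply: holM; first exact: hol_cst.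
  exact: (hf j z Dz).
rewrite addrC -(IH y Dy) -(wl_lin_on (d i) hl hs (hf i) Dy).
by apply: wl_eq_on => // z _; rewrite big_cons addrC.
Qed.

End OpenDomain.

Definition vcomb (c : K) (X Y : vfield M) : vfield M := fun b y => X b y + c *: Y b y.

Lemma lieD_vcomb a c X Y f y : chart_at y a -> hol f y ->
  lieD a (vcomb c X Y) f y = lieD a X f y + c * lieD a Y f y.
Proof.
move=> hay hf; apply: (etrans (deriveDl _ _ (hf a hay))); congr (_ + _).
exact: (deriveZl _ _ (hf a hay)).
Qed.

(* Exchanging two letters of a word changes it by a shorter word, which vanishes by
   induction; so words of a given length define a symmetric form. *)
Lemma words_vanish a x g : chart_at x a -> hol_near_at g x ->
  (forall U X, open U -> U x -> F U X -> forall k, iter k (lieD a X) g x = 0) ->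
  forall m U Xs, open U -> U x -> List.Forall (F U) Xs -> size Xs = m -> wl a Xs g x = 0.
Proof.
move=> [ha ax] /hol_near_open[W0 [oW0 W0x hW0]] H m; elim/ltn_ind: m => m IH.
move=> U Xs oU Ux FXs sXs.
have [m0|m0] := posnP m.
  by move: sXs; rewrite m0 => /size0nil ->; exact: (H U (fun _ _ => 0) oU Ux (tsheaf_zero F oU) 0%N).
pose D := (U `&` W0) `&` chart_dom a.
have oD : open D by apply: openI; [exact: openI|exact: chart_dom_open].
have Da : D `<=` chart_dom a by move=> y [].
have Dx : D x by [].
have SX X : F U X -> holo_on D (X a).
  move=> FX y [[Uy _] ay]; exact: (vfield_hol (tsheaf_vfield oU FX) ha).
have hg : holo_on D g by move=> y [[_ Wy] _]; exact: hW0.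
apply: (@polarization K _ (F U) vcomb m (fun l => wl a l g x)) => //.
- move=> c X Y FX FY; apply: tsheaf_add => //; apply: tsheaf_scale => //.
  by move=> y _; exact: hol_cst.
- move=> l1 X Y l2 [sl /List.Forall_app[Fl1 /List.Forall_cons_iff[FX /List.Forall_cons_iff[FY Fl2]]]].
  rewrite !wl_cat /=; set h := wl a l1 g.
  have hh : holo_on D h by exact: (hol_wl ha oD Da SX Fl1 hg).
  have hXh := hol_lieD_dom ha oD Da SX FX hh.
  have hYh := hol_lieD_dom ha oD Da SX FY hh.
  have hYX := hol_lieD_dom ha oD Da SX FY hXh.
  have hXY := hol_lieD_dom ha oD Da SX FX hYh.
  have E := wl_lin_on ha oD Da SX (-1) Fl2 hYX hXY Dx.
  have E2 : wl a l2 (fun z => lieD a Y (lieD a X h) z + -1 * lieD a X (lieD a Y h) z) x =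
     wl a (l1 ++ lie_bracket Y X :: l2) g x.
    rewrite wl_cat /=; apply: (wl_eq_on oD Da l2 _ Dx) => y Dy; rewrite mulN1r.
    have DE : D `&` chart_dom a = D by exact: setIidl.
    have := @lieD_bracket _ _ _ a ha D oD Y X h y; rewrite DE; move=> /(_ (SX Y FY) (SX X FX) hh Dy (proj2 Dy)); exact.
  have E3 : wl a (l1 ++ lie_bracket Y X :: l2) g x = 0.
    apply: (IH m.-1 _ U) => //; first by rewrite prednK.
      apply/List.Forall_app; split => //; constructor => //; exact: tsheaf_involutive.
    by move: sl; rewrite !size_cat /= !addnS => <-.
  by move: E; rewrite E2 E3 mulN1r => /esym/eqP; rewrite subr_eq0 => /eqP.
- move=> c X Y l FX FY [sl /List.Forall_cons_iff[_ Fl]] /=.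
  rewrite -(wl_lin_on ha oD Da SX c Fl (hol_lieD_dom ha oD Da SX FX hg) (hol_lieD_dom ha oD Da SX FY hg) Dx).
  apply: (wl_eq_on oD Da l _ Dx) => y Dy; apply: lieD_vcomb; [by split => //; exact: Da|exact: hg].
- by move=> X FX; rewrite wl_nseq; exact: (H U).
Qed.

Lemma flat_words a x g : chart_at x a -> hol_near_at g x ->
  (forall U X, open U -> U x -> F U X -> forall k, iter k (lieD a X) g x = 0) ->
  forall m, fl a m g x.
Proof.
move=> ha hg H.
(* Generalized to a word already applied. The next field may live on another open set, and
   restriction to the intersection keeps all letters on one. *)
suff key m : forall U Xs, open U -> U x -> List.Forall (F U) Xs -> fl a m (wl a Xs g) x.
  by move=> m; apply: (key m setT [::]) => //; exact: openT.
elim: m => [|m IH] U Xs oU Ux FXs.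
  by split => //; exact: (words_vanish ha hg H oU Ux FXs erefl).
split; first exact: (words_vanish ha hg H oU Ux FXs erefl).
move=> W X oW Wx FX.
have oUW : open (U `&` W) by exact: openI.
have -> : lieD a X (wl a Xs g) = wl a (Xs ++ [:: X]) g by rewrite wl_cat.
apply: (IH (U `&` W)) => //; apply/List.Forall_app; split.
  by apply: List.Forall_impl FXs => Y; apply: tsheaf_restrict => //; exact: subIsetl.
by constructor => //; apply: (tsheaf_restrict oW oUW _ FX); exact: subIsetr.
Qed.

End Flat.

(** * Degeneracy loci of linear systems *)

(** Rows are picked by arbitrary functions, since a repeated row only adds a zero determinant. If
    there is no kernel vector, the rank is k and some k rows form an invertible matrix. *)
Lemma minors_vanish (K : fieldType) (T : finType) (k : nat) (A : T -> 'I_k -> K) :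
  (exists2 d : 'rV[K]_k, d != 0 & forall r, \sum_j d 0 j * A r j = 0) <->
  (forall f : {ffun 'I_k -> T}, \det (\matrix_(i, j) A (f i) j) = 0).
Proof.
pose B : 'M[K]_(#|T|, k) := \matrix_(i, j) A (enum_val i) j.
have mulE (d : 'rV[K]_k) i : (d *m B^T) 0 i = \sum_j d 0 j * A (enum_val i) j.
  by rewrite mxE; apply: eq_bigr => j _; rewrite !mxE.
split=> [[d d0 dA] f|H].
  apply/eqP/negPn/negP => ndet.
  have : d *m (\matrix_(i, j) A (f i) j)^T = 0.
    by apply/rowP => i; rewrite !mxE -[RHS](dA (f i)); apply: eq_bigr => j _; rewrite !mxE.
  move/(congr1 (mulmx^~ (invmx (\matrix_(i, j) A (f i) j)^T))).
  rewrite mul0mx mulmxK ?unitmxE ?det_tr ?unitfE// => /eqP.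
  by rewrite (negbTE d0).
have nfull : ~~ row_full B.
  apply/negP => fB.
  have u : rowsub (fullrankfun fB) B \in unitmx by exact: fullrowsub_unit.
  have := H [ffun i => enum_val (fullrankfun fB i)].
  move: u; rewrite unitmxE unitfE => /negP u E; apply: u; apply/eqP; rewrite -[RHS]E.
  by congr (\det _); apply/matrixP => i j; rewrite !mxE !ffunE.
have : kermx B^T != 0.
  by rewrite kermx_eq0 /row_free mxrank_tr; move: nfull; rewrite /row_full.
move=> /rowV0Pn[d /sub_kermxP dB d0]; exists d => // r.
by have := congr1 (fun m : 'rV_#|T| => m 0 (enum_rank r)) dB; rewrite mulE enum_rankK mxE.
Qed.

Section Sections.
Context {R : realType} {n : nat} {M : complex_manifold R n}.
Local Notation K := (Cx R).
Implicit Types (a b : chart R n M) (x y p : M) (U : set M).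

Lemma hol_det k (A : 'I_k -> 'I_k -> M -> K) x : (forall i j, hol (A i j) x) ->
  hol (fun y => \det (\matrix_(i, j) A i j y)) x.
Proof.
move=> hA.
apply: (@hol_near _ _ _ _ (fun y => \sum_(s : {perm 'I_k}) (-1) ^+ s * \prod_i A i (s i) y)).
  apply: nearW => y; rewrite /determinant; apply: eq_bigr => s _; congr (_ * _).
  by apply: eq_bigr => i _; rewrite mxE.
apply: hol_sum => s _; apply: holM; first exact: hol_cst.
by apply: hol_prod => i _.
Qed.

(** Closedness follows from the local equations: one of them is nonzero at a point off [Z], hence
    near it. *)
Lemma analytic_local (Z : set M) :
  (forall p, exists U (T : finType) (h : T -> M -> K), [/\ open U, U p,
     forall i, holo_on U (h i) & forall x, U x -> (Z x <-> forall i, h i x = 0)]) ->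
  analytic_subset Z.
Proof.
move=> H; split; last first.
  move=> p; have [U [T [h [oU Up hh hZ]]]] := H p.
  exists U, #|T|, (fun i => h (enum_val i)); split => // x Ux.
  rewrite hZ//; split=> h0 i //; by have := h0 (enum_rank i); rewrite enum_rankK.
rewrite -[Z]setCK; apply: open_closedC; rewrite openE => p nZ.
have [U [T [h [oU Up hh hZ]]]] := H p.
have [i hi] : exists i, h i p <> 0.
  by apply: contrapT => /forallNP hn; apply: nZ; apply/hZ => // i; exact: contrapT.
have hne := hol_neq0_near (hh i p Up : hol (h i) p) (introN eqP hi).
have nU : nbhs p U by exact: open_nbhs_nbhs.
apply: filterS (filterI hne nU) => y [hy Uy] Zy.
by move: hy; rewrite (proj1 (hZ y Uy) Zy i) eqxx.
Qed.

Variables (F : foliation M) (B : line_bundle M).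
Local Notation presec := (presection B).

Definition flS (m : nat) (s : presec) x :=
  forall i a, lb_dom i x -> chart_at x a -> fl F a m (s i) x.

Lemma section_hol (s : presec) i x : global_section s -> lb_dom i x -> hol_near_at (s i) x.
Proof.
move=> [hs _ _] ix; apply: filterS (open_nbhs_nbhs (conj (lb_open i) ix)) => y; exact: hs.
Qed.

Lemma flS_one m (s : presec) x i a : global_section s -> lb_dom i x -> chart_at x a ->
  fl F a m (s i) x -> flS m s x.
Proof.
move=> gs ix ha Hi j b jx hb.
have hj := section_hol gs jx; have hi := section_hol gs ix.
apply: (fl_chart ha hb hj).
have [_ _ gl] := gs.
have oi : nbhs x (@lb_dom _ _ _ B i) by apply: open_nbhs_nbhs; split => //; exact: lb_open.
have oj : nbhs x (@lb_dom _ _ _ B j) by apply: open_nbhs_nbhs; split => //; exact: lb_open.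
apply: (@fl_near _ _ _ _ _ _ (fun y => lb_trans j i y * s i y) _ _ ha).
  near=> y; apply/esym; apply: gl; near: y; [exact: oj|exact: oi].
apply: fl_mul => //.
near=> y; apply: (lb_holo (i := j) (j := i)); split; near: y; [exact: oj|exact: oi].
Unshelve. all: by end_near. Qed.

Definition scomb k (d : 'I_k -> K) (t : 'I_k -> presec) : presec :=
  fun i x => \sum_j d j * t j i x.

Lemma scomb_global k (d : 'I_k -> K) (t : 'I_k -> presec) :
  (forall j, global_section (t j)) -> global_section (scomb d t).
Proof.
move=> gt; split.
- move=> i x ix; apply: hol_sum => j _; apply: holM; first exact: hol_cst.
  by have [h _ _] := gt j; exact: h.
- move=> i x ix; apply: big1 => j _; have [_ h _] := gt j.
  by rewrite h// mulr0.
- move=> i j x ix jx; rewrite /scomb mulr_sumr; apply: eq_bigr => l _.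
  by have [_ _ h] := gt l; rewrite (h i j)// mulrCA.
Qed.

(** Turns flatness to order m into finitely many equations, the same at all points of [D]: one for
    each word of length at most m in the generators. *)
Lemma fl_words a D k (X : 'I_k -> vfield M) U m g x : atlas a -> open D -> D `<=` chart_dom a ->
  D `<=` U -> open U -> generates F U X -> holo_on D g -> D x ->
  fl F a m g x <-> forall w : seq 'I_k, (size w <= m)%N -> wl a (map X w) g x = 0.
Proof.
move=> ha oD Da DU oU gX; have [FX _] := gX.
have SX Y : F U Y -> holo_on D (Y a).
  move=> FY y Dy; have h := vfield_hol (tsheaf_vfield oU FY) ha.
  by apply: h; split; [exact: DU|exact: Da].
elim: m g => [|m IH] g hg Dx.
  split=> [[h _] [|i w] //|h]; split => //; exact: (h [::]).
have hgn : hol_near_at g x by apply: filterS (open_nbhs_nbhs (conj oD Dx)) => y; exact: hg.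
have Ux : U x by exact: DU.
have hxa : chart_at x a by split => //; exact: Da.
have hl i : holo_on D (lieD a (X i) g) by exact: (hol_lieD_dom ha oD Da SX (FX i) hg).
split=> [/(fl_generates m oU Ux hxa gX hgn)[h0 h1] [|i w] sw|h].
- exact: h0.
- exact: (proj1 (IH (lieD a (X i) g) (hl i) Dx) (h1 i) w sw).
- apply/(fl_generates m oU Ux hxa gX hgn); split; first exact: (h [::]).
  move=> i; apply/(IH (lieD a (X i) g) (hl i) Dx) => w sw; exact: (h (i :: w)).
Qed.

(** [A r j] is the derivative of [t j] along the word [r] in local generators, so flatness of a
    combination is a homogeneous linear system in [d] with holomorphic coefficients. *)
Lemma flS_local m k (t : 'I_k -> presec) p : (forall j, global_section (t j)) ->
  exists U (T : finType) (A : T -> 'I_k -> M -> K), [/\ open U, U p,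
    forall r j, holo_on U (A r j) &
    forall x (d : 'I_k -> K), U x -> (flS m (scomb d t) x <-> forall r, \sum_j d j * A r j x = 0)].
Proof.
move=> gt; have [i ip] := lb_cover B p; have [a [ha ap]] := chart_at_ex p.
have [U [k0 [X [oU Up gX]]]] := tsheaf_finite_type F p; have [FX _] := gX.
pose D := (U `&` @lb_dom _ _ _ B i) `&` chart_dom a.
have oD : open D by apply: openI; [apply: openI => //; exact: lb_open|exact: chart_dom_open].
have Da : D `<=` chart_dom a by move=> y [].
have DU : D `<=` U by move=> y [[]].
have Di : D `<=` @lb_dom _ _ _ B i by move=> y [[]].
have SX Y : F U Y -> holo_on D (Y a).
  move=> FY y Dy; have h := vfield_hol (tsheaf_vfield oU FY) ha.
  by apply: h; split; [exact: DU|exact: Da].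
have ht j : holo_on D (t j i) by move=> y Dy; have [h _ _] := gt j; apply: h; exact: Di.
have FXw (w : seq 'I_k0) : List.Forall (F U) (map X w) by elim: w => [|l w IH] /=; constructor.
exists D, (m.-bseq 'I_k0), (fun (w : m.-bseq 'I_k0) j => wl a (map X w) (t j i)).
split => //.
  by move=> w j; exact: (hol_wl ha oD Da SX (FXw w) (ht j)).
move=> x d Dx.
have E w : wl a (map X w) (scomb d t i) x = \sum_j d j * wl a (map X w) (t j i) x.
  exact: (wl_sum_on ha oD Da SX (index_enum _) d (FXw w) ht Dx).
have hs : holo_on D (scomb d t i).
  by move=> y Dy; have [h _ _] := scomb_global d gt; apply: h; exact: Di.
have W := fl_words (a := a) (D := D) (X := X) (U := U) m (g := scomb d t i) (x := x) ha oD Da DU oU gX hs Dx.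
split=> [h w|h].
  have := proj1 W (h i a (Di x Dx) (conj ha (Da x Dx))) w (size_bseq w).
  by rewrite E.
apply: (@flS_one m _ x i a) => //; [exact: scomb_global|exact: Di|by split => //; exact: Da|].
apply/W => w sw; rewrite E; exact: (h (Bseq sw)).
Qed.

(* The linear form [l] restricts the combinations to a hyperplane, unless [l = 0]. *)
Definition Dm (m k : nat) (t : 'I_k -> presec) (l : 'I_k -> K) : set M :=
  [set x | exists2 d : 'rV[K]_k, d != 0 & \sum_j d 0 j * l j = 0 /\ flS m (scomb (d 0) t) x].

Lemma Dm_analytic m k (t : 'I_k -> presec) l : (forall j, global_section (t j)) ->
  analytic_subset (Dm m t l).
Proof.
move=> gt; apply: analytic_local => p.
have [U [T [A [oU Up hA hU]]]] := flS_local m p gt.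
(* The index [None] adds the equation of the hyperplane to the linear system. *)
pose A' (r : option T) (j : 'I_k) (x : M) : K := if r is Some r' then A r' j x else l j.
exists U, {ffun 'I_k -> option T}, (fun (f : {ffun 'I_k -> option T}) x => \det (\matrix_(i, j) A' (f i) j x)); split => //.
  move=> f x Ux; apply: hol_det => i j; case: (f i) => [r|]; [exact: hA|exact: hol_cst].
move=> x Ux; rewrite -(minors_vanish (fun r j => A' r j x)).
split=> [[d d0 [dl /(hU x (d 0) Ux) dA]]|[d d0 h]]; exists d => //.
  by case=> [r|] /=.
by split; [exact: (h None)|apply/(hU x _ Ux) => r; exact: (h (Some r))].
Qed.

Lemma flS_le m m' s x : (m' <= m)%N -> flS m s x -> flS m' s x.
Proof. by move=> mm h i a ix ha; apply: (fl_le mm); exact: h. Qed.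

(** If no nonzero vector survives, then for each j some order m leaves dimension at most k - j.
    Indeed, a nonzero vector [d] present at order m fails at some order m1; had the dimension not
    dropped at the larger of the two orders, [d] would lie in the span there and satisfy [P m1]. For
    j = k this is absurd. *)
Lemma decreasing_limit k (P : nat -> 'rV[K]_k -> Prop) :
  (forall m d, P m.+1 d -> P m d) ->
  (forall m (c : K) d d', P m d -> P m d' -> P m (c *: d + d')) ->
  (forall m, exists2 d, d != 0 & P m d) -> exists2 d, d != 0 & forall m, P m d.
Proof.
move=> dec lin ex.
have le m m' d : (m <= m')%N -> P m' d -> P m d.
  move=> /subnK <-; elim: (m' - m)%N => [|q IH]; first by rewrite add0n.
  by rewrite addSn => /dec.
have P0 m : P m 0.
  by have [d _ Pd] := ex m; have := lin m (-1) d d Pd Pd; rewrite scaleN1r addNr.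
have PZ m c d : P m d -> P m (c *: d).
  by move=> Pd; have := lin m c d 0 Pd (P0 m); rewrite addr0.
have PD m d d' : P m d -> P m d' -> P m (d + d').
  by move=> h h'; have := lin m 1 d d' h h'; rewrite scale1r.
have span m (q : nat) (Q : 'M[K]_(q, k)) d : (forall i, P m (row i Q)) -> (d <= Q)%MS -> P m d.
  move=> hB /submxP[c ->]; rewrite mulmx_sum_row.
  by elim/big_ind: _ => //; [exact: PD|move=> i _; exact: PZ].
apply: contrapT => nex.
have nP d : d != 0 -> exists m, ~ P m d.
  move=> d0; apply: contrapT => /forallNP h; apply: nex; exists d => // m; exact: contrapT.
have dims j : exists m, forall (q : nat) (Q : 'M[K]_(q, k)), (forall i, P m (row i Q)) -> (\rank Q <= k - j)%N.
  elim: j => [|j [m hm]]; first by exists 0%N => q Q _; rewrite subn0 rank_leq_col.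
  have [h|] := pselect (forall (q : nat) (Q : 'M[K]_(q, k)), (forall i, P m (row i Q)) -> (\rank Q <= k - j.+1)%N).
    by exists m.
  move=> /existsNP[p0 /existsNP[Q /not_implyP[hB /negP]]]; rewrite -ltnNge => rB.
  have rB0 : (0 < \rank Q)%N by exact: leq_ltn_trans rB.
  have : Q != 0 by rewrite -mxrank_eq0 -lt0n.
  move=> /rowV0Pn[d dB d0]; have Pd := span m p0 Q d hB dB.
  have [m1 hm1] := nP d d0.
  exists (maxn m m1) => q Q' hQ'; rewrite leqNgt; apply/negP => rQ'.
  have hQ'm i : P m (row i Q') by apply: le (hQ' i); exact: leq_maxl.
  have rs : (\rank (col_mx Q' d) <= k - j)%N.
    apply: hm => i; rewrite -(splitK i); case: (fintype.split i) => i' /=.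
      by rewrite rowKu.
    by rewrite rowKd (_ : row i' d = d)//; apply/rowP => l; rewrite mxE ord1.
  have dQ' : (d <= Q')%MS.
    have s1 : (Q' <= col_mx Q' d)%MS by rewrite -addsmxE addsmxSl.
    have s2 : (d <= col_mx Q' d)%MS by rewrite -addsmxE addsmxSr.
    apply: (submx_trans s2); rewrite -(geq_leqif (mxrank_leqif_sup s1)).
    by apply: (leq_trans rs); apply: leq_trans rQ'; rewrite subnS leqSpred.
  apply: hm1; apply: (le m1 (maxn m m1)); first exact: leq_maxr.
  exact: (span _ _ _ _ hQ' dQ').
have [m hm] := dims k; have [d d0 Pd] := ex m.
have := hm 1%N d; rewrite subnn leqn0 mxrank_eq0 (negbTE d0) => h.
suff : false by [].
by apply: h => i; rewrite (_ : row i d = d)//; apply/rowP => l; rewrite mxE ord1.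
Qed.

End Sections.

(** * Propagation of flatness along plaques *)

(** Transport between any two parameters near [t] covers the open and the closed half of the
    connectedness argument at once: from a parameter just below the supremum, [P] is carried beyond
    it unless it is 1. *)
Lemma unit_interval_ind (R : realType) (P : R -> Prop) :
  (forall t : R, 0 <= t <= 1 -> exists2 d : R, 0 < d & forall t1 t2 : R, 0 <= t1 <= 1 ->
     0 <= t2 <= 1 -> `|t1 - t| < d -> `|t2 - t| < d -> P t1 -> P t2) ->
  P 0 -> P 1.
Proof.
move=> H P0; pose S := [set t : R | 0 <= t <= 1 /\ P t].
have S0 : S 0 by split => //; rewrite lexx ler01.
have ubS : ubound S 1 by move=> t [/andP[]].
have hS : has_sup S by split; [exists 0|exists 1].
have t0 : 0 <= sup S by exact: (ub_le_sup (proj2 hS) S0).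
have t1 : sup S <= 1 by apply: ge_sup => //; exists 0.
have [d d0 hd] := H (sup S) (ltac:(by rewrite t0 t1)).
have [u [/andP[u0 u1] Pu] hu] := sup_adherent d0 hS.
have uS : u <= sup S by apply: (ub_le_sup (proj2 hS)); split => //; rewrite u0 u1.
have uu : `|u - sup S| < d by rewrite ler0_norm; lra.
pose v := Num.min (sup S + d / 2) 1.
have v0 : 0 <= v <= 1 by rewrite /v le_min ge_min lexx orbT ler01 andbT; lra.
have vS : sup S <= v by rewrite /v le_min t1 andbT; lra.
have vd : v <= sup S + d / 2 by rewrite /v ge_min lexx.
have vv : `|v - sup S| < d by rewrite ger0_norm; lra.
have Pv : P v by apply: (hd u v) => //; rewrite u0 u1.
have : v <= sup S by apply: (ub_le_sup (proj2 hS)); split.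
rewrite {1}/v; rewrite ge_min => /orP[|h]; first by move=> h; exfalso; lra.
suff <- : v = 1 by [].
by move/andP: v0 => [_ v1]; lra.
Qed.

Section Plaques.
Context {R : realType} {n : nat} {M : complex_manifold R n}.
Local Notation K := (Cx R).
Local Notation E := 'rV[K]_n.
Implicit Types (a b c : chart R n M) (x y p q : M) (U : set M).

(* The vector field equal to the constant [v] in the chart [c]. *)
Definition cv c (v : E) : vfield M := fun a x => 'D_v (a \o chart_inv c) (c x).

Lemma cv_chart c v x : chart_dom c x -> cv c v c x = v.
Proof.
move=> cx.
have h : \forall z \near c x, (c \o chart_inv c) z = id z.
  by apply: filterS (chart_pull cx filterT) => z [].
exact: (etrans (near_derive v h) (derive_id _ _)).
Qed.

Lemma chart_comp_diff a c x : atlas a -> atlas c -> chart_dom a x -> chart_dom c x ->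
  differentiable (a \o chart_inv c) (c x).
Proof. by move=> ha hc ax cx; have [] := atlas_compatible hc ha cx ax. Qed.

Lemma cv_vfield c v : atlas c -> is_vfield (chart_dom c) (cv c v).
Proof.
move=> hc; split.
  move=> a ha x [cx ax].
  apply: (@hol_chart _ _ _ _ c _ x (conj hc cx)).
  pose O := [set z | (c @` chart_dom c) z /\ chart_dom a (chart_inv c z)].
  have oO : open O by apply: open_chart_image; exact: chart_dom_open.
  have dO z : O z -> differentiable (a \o chart_inv c) z.
    move=> [[y cy <-]]; rewrite chart_mapK// => ay; exact: chart_comp_diff.
  have Ox : O (c x) by split; [exists x|rewrite chart_mapK].
  have nO := open_nbhs_nbhs (conj oO Ox).
  apply: (@near_differentiable _ _ _ (fun z => 'D_v (a \o chart_inv c) z)).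
    apply: filterS nO => z [[y cy <-] _].
    by rewrite /cv /= chart_mapK.
  (* [holo_derive] is about scalar functions, hence the passage to entries. *)
  apply: differentiable_row => j.
  apply: (@near_differentiable _ _ _ (fun z => 'D_v (fun w => (a \o chart_inv c) w 0 j) z)).
    apply: filterS nO => z Oz; exact: (derive_entry v j (dO z Oz)).
  apply: (holo_derive v oO) => // z Oz; exact: (differentiable_entry j (dO z Oz)).
move=> x cx a b [ha ax] [hb bx]; rewrite /cv.
have dab : differentiable (b \o chart_inv a) ((a \o chart_inv c) (c x)).
  by rewrite /= chart_mapK//; exact: chart_comp_diff.
have E1 := derive_comp v (chart_comp_diff ha hc ax cx) dab.
have E2 : (a \o chart_inv c) (c x) = a x by rewrite /= chart_mapK.
set u := 'D_v (a \o chart_inv c) (c x) in E1 *.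
have E3 := congr1 (fun z => 'D_u (b \o chart_inv a) z) E2.
apply: (etrans _ (etrans E1 E3)).
apply: near_derive.
apply: filterS (chart_pull cx (nbhs_chart_dom ax)) => z [h1 h2 h3] /=.
by rewrite chart_mapK.
Qed.

(** Links flatness along a constant field with the directional derivatives in [flat_vanish]. *)
Lemma iter_cv c v k (g : M -> K) x : chart_dom c x ->
  iter k (lieD c (cv c v)) g x = iter_derive v k (g \o chart_inv c) (c x).
Proof.
elim: k x => [|k IH] x cx; first by rewrite /= chart_mapK.
have e1 : iter k.+1 (lieD c (cv c v)) g x =
    'D_v (iter k (lieD c (cv c v)) g \o chart_inv c) (c x).
  exact: (congr1 (fun u => 'D_u (iter k (lieD c (cv c v)) g \o chart_inv c) (c x)) (cv_chart v cx)).
apply: (etrans e1); apply: near_derive.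
apply: filterS (chart_pull cx filterT) => z [h1 h2 _].
by rewrite /= (IH _ h1) h2.
Qed.

Lemma derive_zero_line (f : E -> K) z u : (\forall t \near (0 : K), f (z + t *: u) = 0) ->
  'D_u f z = 0.
Proof.
move=> h; apply: cvg_lim => //.
have f0 : f z = 0 by have := nbhs_singleton h; rewrite scale0r addr0.
apply: (@cvg_trans _ ((fun _ : K => (0 : K)) @ 0^')); last exact: cvg_cst.
apply: near_eq_cvg.
have h' : \forall t \near 0^', f (z + t *: u) = 0 by apply: nbhs_dnbhs.
apply: filterS h' => t ht; rewrite /= f0 addrC [t *: u + z]addrC ht.
by rewrite addrC subr0 scaler0.
Qed.

Variable F : foliation M.

Lemma fl_iter a k (g : M -> K) x U X : open U -> U x -> F U X -> fl F a k g x ->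
  iter k (lieD a X) g x = 0.
Proof.
move=> oU Ux FX; elim: k g => [|k IH] g; first by case.
by move=> [_ h]; rewrite iterSr; apply: IH; exact: (h U X).
Qed.

Definition same_fibre c (r : nat) x y := forall j : 'I_n, (r <= j)%N -> c x 0 j = c y 0 j.

(** The hypothesis passes from [g] to X g: the line through a point of the fibre in the direction of
    X keeps the coordinates of index at least r, so [g] is zero along it. The set [D] shrinks in the
    induction because X is only local. *)
Lemma fl_tangent c r D (g : M -> K) x0 : foliated_chart F c r -> open D -> D `<=` chart_dom c ->
  holo_on D g -> (forall y, D y -> same_fibre c r x0 y -> g y = 0) ->
  forall m y, D y -> same_fibre c r x0 y -> fl F c m g y.
Proof.
move=> [hc _ _ spec] oD Dc hg g0 m; elim: m D oD Dc g hg g0 => [|m IH] D oD Dc g hg g0 y Dy fy.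
  by split => //; exact: g0.
split; first exact: g0.
move=> U X oU Uy FX.
have oDU : open (D `&` U) by exact: openI.
have DUc : D `&` U `<=` chart_dom c by move=> z [/Dc].
have FDU := tsheaf_restrict oU oDU (@subIsetr _ D U) FX.
have X0 := proj1 (spec _ X oDU DUc (tsheaf_vfield oDU FDU)) FDU.
apply: (IH (D `&` U)) => //.
  have hX : holo_on (D `&` U) (X c).
    move=> z Dz; have h := vfield_hol (tsheaf_vfield oDU FDU) hc.
    by apply: h; split => //; exact: DUc.
  have SX Y : F (D `&` U) Y -> holo_on (D `&` U) (Y c).
    move=> FY z Dz; have h := vfield_hol (tsheaf_vfield oDU FY) hc.
    by apply: h; split => //; exact: DUc.
  apply: (hol_lieD_dom hc oDU DUc SX FDU).
  by move=> z [Dz _]; exact: hg.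
move=> z [Dz Uz] fz; apply: derive_zero_line.
have cz := Dc z Dz.
have nD : nbhs z D by exact: open_nbhs_nbhs.
have [d d0 hd] := proj1 (nbhs_nr _ _) (chart_pull cz nD).
apply/nbhs_nr.
have v1 : 0 < nr (X c z) + 1 by rewrite ltr_wpDl ?nr_ge0.
exists (d / (nr (X c z) + 1)); first by rewrite divr_gt0.
move=> t; rewrite subr0 ltr_pdivlMr// => ht.
have [|w1 w2 w3] := hd (c z + t *: X c z).
  rewrite addrAC subrr add0r nrZ; apply: le_lt_trans ht.
  by rewrite ler_wpM2l ?nr_ge0// lerDl.
apply: g0 => // j rj.
rewrite w2 [RHS]mxE [X in _ + X]mxE (fz j rj) (X0 z (conj Dz Uz) j rj).
by rewrite mulr0 addr0.
Qed.

Variable B : line_bundle M.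
Local Notation presec := (presection B).

(* A section flat at [y] vanishes on the plaque near [y], by its Taylor expansion
   along the constant fields; being zero on a plaque it is flat there, since the
   fields of [F] are tangent to the plaque. *)
Lemma plaque_local c r (s : presec) x : foliated_chart F c r -> global_section s ->
  chart_dom c x -> exists2 d : R, 0 < d & forall y y', chart_dom c y -> chart_dom c y' ->
    nr (c y - c x) < d -> nr (c y' - c x) < d -> same_fibre c r y y' ->
    (forall m, flS F m s y) -> forall m, flS F m s y'.
Proof.
move=> fc gs cx; have [hc _ _ spec] := fc; have [i ix] := lb_cover B x.
pose W := chart_dom c `&` @lb_dom _ _ _ B i.
have oW : open W by apply: openI; [exact: chart_dom_open|exact: lb_open].
have hs : holo_on W (s i) by move=> y [_ iy]; have [h _ _] := gs; exact: h.
pose O := [set z | (c @` chart_dom c) z /\ @lb_dom _ _ _ B i (chart_inv c z)].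
have oO : open O by apply: open_chart_image; exact: lb_open.
have dO : holo_open O (s i \o chart_inv c).
  by move=> z [[y cy <-]]; rewrite chart_mapK// => iy; apply: hs.
have Ox : O (c x) by split; [exists x|rewrite chart_mapK].
have [r0 r0p [hO [hb hM]]] := holo_bounded_ball oO dO Ox.
move: (_ + 1) hM => A hM.
(* Two points this close to [c x] are less than r0 / 256 apart, which is the radius of [flat_vanish]
   for a ball of radius r0 / 2 around [c y]. *)
have d0 : 0 < r0 / 1024 by lra.
exists (r0 / 1024); first exact: d0.
move=> y y' cy cy' dy dy' yy' fly.
have Oi z : chart_dom c z -> nr (c z - c x) < r0 -> @lb_dom _ _ _ B i z.
  by move=> cz /hO [_]; rewrite chart_mapK.
have hy : nr (c y - c x) < r0 by lra.
have hy' : nr (c y' - c x) < r0 by lra.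
have iy := Oi y cy hy; have iy' := Oi y' cy' hy'.
have van z : chart_dom c z -> nr (c z - c y) < r0 / 256 -> same_fibre c r y z -> s i z = 0.
  move=> cz dz fz; pose v := c z - c y.
  have FX : F (chart_dom c) (cv c v).
    apply: (proj2 (spec _ _ (chart_dom_open c) (fun _ h => h) (cv_vfield v hc))).
    move=> w cw j rj; apply: (etrans (congr1 (fun u : E => u 0 j) (cv_chart v cw))).
    by rewrite /v mxE [X in _ + X]mxE (fz j rj) subrr.
  have r2 : 0 < r0 / 2 by lra.
  have sub w : nr (w - c y) < r0 / 2 -> nr (w - c x) < r0.
    by move=> hw; have := nr_trans w (c y) (c x); lra.
  have := @flat_vanish _ _ (s i \o chart_inv c) (c y) v (r0 / 2) A 1 r2.
  rewrite scale1r (_ : c y + v = c z); last by rewrite /v addrC subrK.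
  rewrite /= chart_mapK//; apply.
  - by move=> w hw; apply: hb; exact: sub.
  - by move=> w hw; apply: hM; exact: sub.
  - move=> k; apply: (etrans (esym (iter_cv v k (s i) cy))).
    exact: (@fl_iter c k (s i) y (chart_dom c) _ (chart_dom_open c) cy FX (fly k i c iy (conj hc cy))).
  - by apply: (lt_le_trans dz); lra.
pose D := [set z | chart_dom c z /\ (nr (c z - c x) < r0 /\ nr (c z - c y) < r0 / 256)].
have oD : open D.
  rewrite openE => z [cz [z1 z2]].
  have o1 := open_nbhs_nbhs (conj (open_nr_ball (c x) r0) z1).
  have o2 := open_nbhs_nbhs (conj (open_nr_ball (c y) (r0 / 256)) z2).
  by apply: filterS (chart_push cz (filterI o1 o2)) => w [].
have flt m : fl F c m (s i) y'.
  apply: (@fl_tangent c r D (s i) y fc oD) => //.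
  - by move=> z [].
  - by move=> z [cz [z1 _]]; apply: hs; split => //; exact: Oi.
  - by move=> z [cz [_ z2]] fz; exact: van.
  - by split => //; split => //; have := nr_trans (c y') (c x) (c y); rewrite (nrB (c x)); lra.
by move=> m; apply: (@flS_one _ _ _ _ _ m s y' i c) => //.
Qed.

(** The image of a foliated chart is a ball, hence convex, so the segment from [c p] to [c q] stays
    in it and in the fibre. *)
Lemma plaque_ind c r p q (Q : M -> Prop) : foliated_chart F c r -> chart_dom c p ->
  chart_dom c q -> same_fibre c r p q ->
  (forall x, chart_dom c x -> exists2 d : R, 0 < d & forall y y', chart_dom c y ->
     chart_dom c y' -> nr (c y - c x) < d -> nr (c y' - c x) < d -> same_fibre c r y y' ->
     Q y -> Q y') ->
  Q p -> Q q.
Proof.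
move=> [hc _ im spec] cp cq pq H Qp.
have imP z : nr z < 1 -> exists2 y, chart_dom c y & c y = z.
  move=> hz; have : (c @` chart_dom c) z by rewrite im /= nrE -rc1 rc_lt.
  by move=> [y cy <-]; exists y.
have im1 y : chart_dom c y -> nr (c y) < 1.
  move=> cy; have : (c @` chart_dom c) (c y) by exists y.
  by rewrite im /= nrE -rc1 rc_lt.
have [z zdef] : exists z : R -> E, forall t, z t = c p + rc t *: (c q - c p) by eexists.
have hz t : 0 <= t <= 1 -> nr (z t) < 1.
  move=> ht; rewrite -[z t]subr0 zdef; apply: seg_ball => //; rewrite subr0; exact: im1.
pose P t := Q (chart_inv c (z t)).
have zE t : 0 <= t <= 1 -> chart_dom c (chart_inv c (z t)) /\ c (chart_inv c (z t)) = z t.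
  by move=> /hz/imP[y cy <-]; rewrite chart_mapK.
have zB t u : nr (z t - z u) = `|t - u| * nr (c q - c p).
  rewrite -nr_rc -nrZ !zdef; congr nr.
  by rewrite opprD addrACA subrr add0r -scalerBl rcD rcN.
suff : P 1.
  by rewrite /P zdef rc1 scale1r addrC subrK chart_mapK.
apply: (@unit_interval_ind _ P); last by rewrite /P zdef rc0 scale0r addr0 chart_mapK.
move=> t ht; have [ct et] := zE t ht.
have [d d0 hd] := H _ ct.
have l0 : 0 < nr (c q - c p) + 1 by rewrite ltr_wpDl ?nr_ge0.
exists (d / (nr (c q - c p) + 1)); first by rewrite divr_gt0.
move=> t1 t2 h1 h2; rewrite (ltr_pdivlMr _ _ l0) (ltr_pdivlMr _ _ l0) => e1 e2.
have [c1 E1] := zE t1 h1; have [c2 E2] := zE t2 h2.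
have small u : `|u - t| * (nr (c q - c p) + 1) < d -> nr (z u - z t) < d.
  by apply: le_lt_trans; rewrite zB ler_wpM2l// lerDl.
have n1 : nr (c (chart_inv c (z t1)) - c (chart_inv c (z t))) < d.
  by rewrite E1 et; exact: small.
have n2 : nr (c (chart_inv c (z t2)) - c (chart_inv c (z t))) < d.
  by rewrite E2 et; exact: small.
have ff : same_fibre c r (chart_inv c (z t1)) (chart_inv c (z t2)).
  move=> j rj; have zj t' : z t' 0 j = c p 0 j.
    by rewrite zdef mxE [X in _ + X]mxE [X in _ * X]mxE [X in _ * (_ + X)]mxE -(pq j rj) subrr mulr0 addr0.
  exact: (etrans (congr1 (fun u : E => u 0 j) E1) (etrans (zj t1) (esym (etrans (congr1 (fun u : E => u 0 j) E2) (zj t2))))).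
exact: (hd _ _ c1 c2 n1 n2 ff).
Qed.

Lemma same_plaque_flat (s : presec) p q : global_section s -> same_plaque F p q ->
  (forall m, flS F m s p) -> forall m, flS F m s q.
Proof.
move=> gs [c [r [fc cp cq pq]]].
apply: (plaque_ind (Q := fun x => forall m, flS F m s x) fc cp cq pq) => x cx.
exact: (plaque_local fc gs cx).
Qed.

(** For the case where M is not connected: a leaf does not cross the border of a clopen set. *)
Lemma same_plaque_clopen (A : set M) p q : open A -> closed A -> same_plaque F p q -> A p -> A q.
Proof.
move=> oA cA [c [r [fc cp cq pq]]].
apply: (plaque_ind (Q := A) fc cp cq pq) => x cx.
have key (A' : set M) : open A' -> A' x -> exists2 d : R, 0 < d &
    forall y, chart_dom c y -> nr (c y - c x) < d -> A' y.
  move=> oA' A'x; have nA : nbhs x A' by exact: open_nbhs_nbhs.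
  have [d d0 hd] := proj1 (nbhs_nr _ _) (chart_pull cx nA).
  by exists d => // y cy /hd[_ _]; rewrite chart_mapK.
have [Ax|nAx] := pselect (A x).
  by have [d d0 hd] := key A oA Ax; exists d => // y y' _ cy' _ dy' _ _; exact: hd.
have [d d0 hd] := key (~` A) (closed_openC cA) nAx.
by exists d => // y y' cy _ dy _ _ Ay; case: (hd y cy dy).
Qed.

Lemma same_plaque_sym p q : same_plaque F p q -> same_plaque F q p.
Proof. by move=> [c [r [h1 h2 h3 h4]]]; exists c, r; split => // j /h4. Qed.

Lemma leaf_ind (Q : M -> Prop) (L : set M) : is_leaf F L ->
  (forall p q, same_plaque F p q -> Q p -> Q q) -> forall p q, L p -> L q -> Q p -> Q q.
Proof.
move=> [p0 _ ->] H p q /= Lp Lq Qp.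
have Q0 : Q p0.
  elim: Lp Qp => [x y /same_plaque_sym/H //|//|x y z _ IH1 _ IH2 /IH2/IH1 //].
by elim: Lq Q0 => [x y /H //|//|x y z _ IH1 _ IH2 /IH1/IH2 //].
Qed.

Lemma leaf_flat_of_flS (L : set M) (s : presec) :
  (forall p, L p -> forall m, flS F m s p) -> leaf_flat_contact F L s.
Proof.
move=> h p Lp U X oU Up FX i a ip ap k.
exact: (fl_iter oU Up FX (h p Lp k i a ip ap)).
Qed.

Lemma leaf_flS (L : set M) (s : presec) p : global_section s -> leaf_flat_contact F L s ->
  L p -> forall m, flS F m s p.
Proof.
move=> gs h Lp m i a ip ap; apply: flat_words => //; first exact: section_hol.
by move=> U X oU Up FX k; exact: (h p Lp U X oU Up FX i a ip ap k).
Qed.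

End Plaques.

(** * The projective line *)

Section Atlas.
Context {R : realType} {n : nat} {T : topologicalType}.
Local Notation K := (Cx R).
Implicit Types (a b c : chart R n T) (A : set (chart R n T)).

Lemma trans_near a b c x : chart_dom a x -> chart_dom c x ->
  differentiable (b \o chart_inv c) (c x) -> differentiable (c \o chart_inv a) (a x) ->
  differentiable (b \o chart_inv a) (a x).
Proof.
move=> ax cx dcb dac.
have e : c x = (c \o chart_inv a) (a x) by rewrite /= chart_mapK.
rewrite e in dcb; apply: (near_differentiable _ (differentiable_comp dac dcb)).
by apply: filterS (chart_pull ax (nbhs_chart_dom cx)) => z [_ _ cz] /=; rewrite chart_mapK.
Qed.

Lemma chart_compatible_refl a : chart_compatible a a.
Proof.
move=> x ax _; suff h : differentiable (a \o chart_inv a) (a x) by [].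
apply: (@near_differentiable _ _ _ id); last exact: ex_diff.
by apply: filterS (chart_pull ax filterT) => z [_ /= ->].
Qed.

Lemma chart_compatible_sym a b : chart_compatible a b -> chart_compatible b a.
Proof. by move=> h x bx ax; have [] := h x ax bx. Qed.

Variable A : set (chart R n T).
Hypothesis T0 : [set: T] !=set0.
Hypothesis Thaus : hausdorff_space T.
Hypothesis Tsc : @second_countable T.
Hypothesis A_cover : forall x, exists2 a, A a & chart_dom a x.
Hypothesis A_compat : forall a b, A a -> A b -> chart_compatible a b.

Definition max_atlas := [set a | forall c, A c -> chart_compatible a c].

Lemma max_atlas_sub : A `<=` max_atlas.
Proof. by move=> a Aa c Ac; exact: A_compat. Qed.

Lemma max_atlas_cover x : exists2 a, max_atlas a & chart_dom a x.
Proof. by have [a /max_atlas_sub ? ?] := A_cover x; exists a. Qed.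

(** Near each point the change of charts factors through a chart of [A]. *)
Lemma max_atlas_compat a b : max_atlas a -> max_atlas b -> chart_compatible a b.
Proof.
move=> ha hb x ax bx; have [c Ac cx] := A_cover x.
have [h1 h2] := ha c Ac x ax cx; have [h3 h4] := hb c Ac x bx cx.
by split; exact: (trans_near _ (c := c)).
Qed.

Lemma max_atlas_maximal a : (forall b, max_atlas b -> chart_compatible a b) -> max_atlas a.
Proof. by move=> h c /max_atlas_sub; exact: h. Qed.

Definition manifold_of_atlas : complex_manifold R n :=
  ComplexManifold T0 Thaus Tsc max_atlas_cover max_atlas_compat max_atlas_maximal.

End Atlas.

(** * Topology of the complex plane *)

Section ComplexTopology.
Context {R : realType}.
Local Notation K := (Cx R).

Lemma mk_continuous : continuous (fun p : R * R => mk p.1 p.2).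
Proof.
move=> [a b]; have h1 : nbhs (mk a b) `<=` nbhs (mk a b) by [].
move=> S /nbhs_nr[e e0 he].
have e2 : 0 < e / 2 by lra.
have na : \forall x \near a, `|a - x| < e / 2 by apply/nbhs_ballP; exists (e / 2).
have nb : \forall x \near b, `|b - x| < e / 2 by apply/nbhs_ballP; exists (e / 2).
exists ([set x | `|a - x| < e / 2], [set x | `|b - x| < e / 2]) => //.
move=> [x y] [/= h2 h3]; apply: he; apply: (le_lt_trans (nr_le_reim _)).
by rewrite reD imD reN imN /=; rewrite distrC in h2; rewrite distrC in h3; lra.
Qed.

Lemma complex_ball_compact (r : R) : compact [set z : K | nr z <= r].
Proof.
have c1 : compact ((fun p : R * R => mk p.1 p.2) @` (`[- r, r] `*` `[- r, r])).
  apply: continuous_compact; last by apply: compact_setX; exact: segment_compact.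
  exact/continuous_subspaceT/mk_continuous.
apply: subclosed_compact c1 _.
  rewrite -[X in closed X]setCK; apply: open_closedC; apply/openP_nr => z /= /negP.
  rewrite -ltNge => hz; exists (nr z - r); first by lra.
  move=> y hy; apply/negP; rewrite -ltNge.
  by have := nr_trans z y 0; rewrite !subr0 (nrB z); lra.
move=> z /= hz; exists (re z, im z); last exact: mkE.
have h1 := re_le_nr z; have h2 := im_le_nr z.
rewrite ler_norml in h1; rewrite ler_norml in h2.
by split; rewrite /= in_itv /=; lra.
Qed.

Lemma nr_continuous : continuous (nr : K -> R).
Proof.
move=> x S /nbhs_ballP[e /= e0 he]; apply: (proj2 (@nbhs_nr R _ x _)); exists e => // y hy; apply: he.
rewrite /ball /=; have := nr_trans x y 0; have := nr_trans y x 0; rewrite !subr0 (nrB x) => h1 h2.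
by rewrite ltr_norml; lra.
Qed.

Lemma complex_compact_bounded (A : set K) : compact A -> exists r : R, forall z, A z -> nr z <= r.
Proof.
move=> cA; have [[x Ax]|/forallNP A0] := pselect (exists x, A x); last first.
  by exists 0 => z /A0.
have cB : compact (nr @` A).
  apply: continuous_compact cA; exact/continuous_subspaceT/nr_continuous.
have [_ [r hr]] : has_sup (nr @` A) by apply: compact_has_sup => //; exists (nr x), x.
by exists r => z Az; apply: hr; exists z.
Qed.

Lemma complex_hausdorff : hausdorff_space K.
Proof. exact: norm_hausdorff. Qed.

Lemma complex_locally_compact : locally_compact [set: K].
Proof.
move=> z _; rewrite withinET; exists [set w : K | nr w <= nr z + 1].
  apply/nbhs_nr; exists 1 => // y hy /=; have := nr_trans y z 0; rewrite !subr0; lra.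
have c := @complex_ball_compact (nr z + 1).
by split => //; apply: compact_closed => //; exact: complex_hausdorff.
Qed.

End ComplexTopology.

Section ProjectiveLine.
Context {R : realType}.
Local Notation K := (Cx R).
Local Notation opc := (one_point_compactification K).
Local Notation E1 := 'rV[K]_1.

Lemma opc_nbhs_some (z : K) (S : set opc) :
  nbhs (Some z : opc) S <-> exists2 e : R, 0 < e & forall y, nr (y - z) < e -> S (Some y).
Proof. exact: (@nbhs_nr R _ z [set y | S (Some y)]). Qed.

(** [None] is the point at infinity: the complement of a compact set contains the exterior of a
    disc, and closed discs are compact. *)
Lemma opc_nbhs_none (S : set opc) :
  nbhs (None : opc) S <-> S None /\ exists r : R, forall z, r < nr z -> S (Some z).
Proof.
split=> [[C [cC _] CS]|[S0 [r hr]]].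
  split; first by apply: CS; right.
  have [r hr] := complex_compact_bounded cC; exists r => z rz.
  apply: CS; left; exists z => // /hr; lra.
exists [set z : K | nr z <= r].
  have c := complex_ball_compact (r := r).
  by split => //; apply: compact_closed => //; exact: complex_hausdorff.
move=> _ [[z /= /negP hz <-]|->//]; apply: hr; by rewrite ltNge.
Qed.

(** The basis consists of the discs with rational centre and radius 1 / (k + 1), and of the
    exteriors of discs of radius k together with infinity. *)
Lemma opc_second_countable : @second_countable opc.
Proof.
pose U (t : (rat * rat * nat) + nat) : set opc := match t with
  | inl (q1, q2, k) => Some @` [set z : K | nr (z - mk (ratr q1) (ratr q2)) < k.+1%:R^-1]
  | inr k => [set None] `|` Some @` [set z : K | k%:R < nr z] end.
exists (range U); first exact: (sub_countable (card_image_le _ _) (countableP _)).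
split=> [_ [[[[q1 q2] k]|k] _ <-]|[z|] V /=].
- by apply: one_point_compactification_open_some; exact: open_nr_ball.
- rewrite openE => -[z|] /=.
    move=> [//|[w /= hw [<-]]]; apply/opc_nbhs_some; exists (nr (w : K) - k%:R); first lra.
    move=> y hy; right; exists y => //=; have := nr_trans (w : K) y 0; rewrite !subr0 (nrB (w : K)); lra.
  move=> _; apply/opc_nbhs_none; split; first by left.
  by exists k%:R => z hz; right; exists z.
- move=> /opc_nbhs_some[e e0 he].
  have e2 : 0 < e / 2 by lra.
  have [k hk] := inv_limit 1 e2; rewrite mul1r in hk.
  have k0 : 0 < (k.+1%:R : R)^-1 by rewrite invr_gt0 ltr0n.
  set d := (k.+1%:R : R)^-1 in hk k0.
  have d2 : 0 < d / 2 by lra.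
  have [|q1] := @rat_in_itvoo R (re z - d / 2) (re z + d / 2); first by lra.
  rewrite in_itv /= => /andP[q11 q12].
  have [|q2] := @rat_in_itvoo R (im z - d / 2) (im z + d / 2); first by lra.
  rewrite in_itv /= => /andP[q21 q22].
  have hz : nr (z - mk (ratr q1) (ratr q2)) < d.
    apply: (le_lt_trans (nr_le_reim _)); rewrite reD imD reN imN /=.
    have h1 : `|re z - ratr q1| < d / 2 by rewrite ltr_norml; lra.
    have h2 : `|im z - ratr q2| < d / 2 by rewrite ltr_norml; lra.
    by lra.
  exists (U (inl (q1, q2, k))); first by split; [exists (inl (q1, q2, k))|exists z].
  move=> _ [y /= hy <-]; apply: he; rewrite -/d in hy.
  by have := nr_trans y (mk (ratr q1) (ratr q2)) z; rewrite (nrB (mk _ _) z); lra.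
- move=> /opc_nbhs_none[V0 [r hr]].
  exists (U (inr (Num.bound r))).
    by split; [exists (inr (Num.bound r))|left].
  move=> _ [->//|[z /= hz <-]]; apply: hr; apply: le_lt_trans hz.
  by apply/ltW/(le_lt_trans (ler_norm r)); rewrite -[Num.bound r]/(Num.bound r) (lt_le_trans (archi_boundP (normr_ge0 r)))// /Num.bound normr_id.
Qed.

Definition e1 (z : K) : E1 := const_mx z.

Lemma e1E z i j : e1 z i j = z. Proof. by rewrite mxE. Qed.
Lemma e1K (v : E1) : e1 (v 0 0) = v.
Proof. by apply/rowP => j; rewrite mxE ord1. Qed.

Lemma e1_diff z : differentiable e1 z.
Proof.
apply: differentiable_row => j; rewrite (_ : (fun w => _) = id); first exact: ex_diff.
by apply/funext => w; rewrite e1E.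
Qed.

Lemma e1_continuous : continuous e1.
Proof. by move=> z; exact: differentiable_continuous (e1_diff z). Qed.

Lemma entry_continuous : continuous (fun v : E1 => v 0 0).
Proof. move=> v; apply: differentiable_continuous; exact: differentiable_coord. Qed.

Let map0 (x : opc) : E1 := e1 (odflt 0 x).
Let inv0 (v : E1) : opc := Some (v 0 0).
Let map1 (x : opc) : E1 := e1 (if x is Some z then z^-1 else 0).
Let inv1 (v : E1) : opc := if v 0 0 == 0 then None else Some (v 0 0)^-1.
Let dom0 : set opc := [set x | x <> None].
Let dom1 : set opc := [set x | x <> Some 0].

Let dom0_open : open dom0.
Proof.
rewrite openE => -[z _|//]; apply/opc_nbhs_some; exists 1 => //.
Qed.

Let dom1_open : open dom1.
Proof.
rewrite openE => -[z z0|_].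
  have nz : 0 < nr z by rewrite nr_gt0; apply/eqP => zz; apply: z0; rewrite zz.
  apply/opc_nbhs_some; exists (nr z) => // y hy [y0].
  by move: hy; rewrite y0 sub0r nrN ltxx.
apply/opc_nbhs_none; split => //; exists 0 => z hz [z0].
by move: hz; rewrite z0 nr0 ltxx.
Qed.

Let img0 : map0 @` dom0 = setT.
Proof. by apply/seteqP; split => // v _; exists (Some (v 0 0)) => //; exact: e1K. Qed.

Let map1K x : dom1 x -> inv1 (map1 x) = x.
Proof.
rewrite /inv1 e1E; case: x => [z z0|_]; last by rewrite eqxx.
have zn : z != 0 by apply/eqP => zz; apply: z0; rewrite zz.
by rewrite invr_eq0 (negbTE zn) invrK.
Qed.

Let img1 : map1 @` dom1 = setT.
Proof.
apply/seteqP; split => // v _; have [v0|v0] := eqVneq (v 0 0) 0.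
  by exists None => //; rewrite /map1 -[RHS]e1K v0.
exists (Some (v 0 0)^-1); last by rewrite /map1 invrK e1K.
by move=> [] /eqP; rewrite invr_eq0 (negbTE v0).
Qed.

Let map0_cont x : dom0 x -> {for x, continuous map0}.
Proof. by case: x => [z _|//]; exact: (e1_continuous (x := z)). Qed.

Let inv0_cont v : (map0 @` dom0) v -> {for v, continuous inv0}.
Proof. by move=> _ S hS; exact: (@entry_continuous v _ hS). Qed.

Let inv_cont (z : K) : z != 0 -> {for z, continuous (fun y : K => y^-1)}.
Proof. by move=> z0; exact: inv_continuous. Qed.

Let map1_cont x : dom1 x -> {for x, continuous map1}.
Proof.
case: x => [z z0|_].
  have zn : z != 0 by apply/eqP => zz; apply: z0; rewrite zz.
  have c : {for z, continuous (e1 \o (fun y : K => y^-1))}.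
    by apply: continuous_comp; [exact: inv_cont|exact: e1_continuous].
  exact: c.
move=> S hS; apply/opc_nbhs_none; split; first exact: nbhs_singleton hS.
have [e e0 he] := proj1 (nbhs_nr _ _) (@e1_continuous 0 S hS).
exists e^-1 => z hz; apply: he; rewrite subr0 nrV.
by rewrite invf_plt ?posrE// (lt_trans _ hz)// invr_gt0.
Qed.

Let inv1_cont v : (map1 @` dom1) v -> {for v, continuous inv1}.
Proof.
move=> _ S; rewrite /inv1; have [v0|v0] := eqVneq (v 0 0) 0.
  move=> /opc_nbhs_none[S0 [r hr]].
  have n0 : nbhs (0 : K) [set w : K | nr w < (`|r| + 1)^-1].
    apply/nbhs_nr; exists (`|r| + 1)^-1; first by rewrite invr_gt0 ltr_wpDl.
    by move=> y; rewrite subr0.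
  rewrite -v0 in n0.
  have h : \forall w \near v, nr ((w : E1) 0 0 : K) < (`|r| + 1)^-1 by exact: (@entry_continuous v _ n0).
  apply: filterS h => w /= hw.
  case: eqVneq => // wn; apply: hr; rewrite nrV.
  have w0 : 0 < nr (w 0 0) by rewrite nr_gt0.
  rewrite (le_lt_trans (ler_norm r))// (lt_le_trans (_ : _ < `|r| + 1)) ?ltrDl//.
  by rewrite -[leLHS]invrK lef_pV2 ?posrE ?invr_gt0 ?ltr_wpDl// ltW.
move=> hS.
have c : {for v, continuous ((fun y : K => y^-1) \o (fun w : E1 => w 0 0))}.
  by apply: continuous_comp; [exact: entry_continuous|exact: inv_cont].
have h1 : \forall w \near v, S (Some ((w : E1) 0 0)^-1) by exact: (c _ hS).
have h2 : \forall w \near v, (w : E1) 0 0 != 0.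
  exact: (@entry_continuous v _ (nbhs_neq0 v0)).
have : \forall w \near v, S (inv1 w).
  by apply: filterS (filterI h1 h2) => w [w1 w0]; rewrite /inv1 (negbTE w0).
exact.
Qed.

(* [p1c0] is the coordinate z, and [p1c1] the coordinate 1 / z. *)
Definition p1c0 : chart R 1 opc.
Proof.
apply: (@Chart R 1 opc dom0 map0 inv0).
- exact: dom0_open.
- by rewrite img0; exact: openT.
- by case => [z _|//]; rewrite /inv0 e1E.
- exact: map0_cont.
- exact: inv0_cont.
Defined.

Definition p1c1 : chart R 1 opc.
Proof.
apply: (@Chart R 1 opc dom1 map1 inv1).
- exact: dom1_open.
- by rewrite img1; exact: openT.
- exact: map1K.
- exact: map1_cont.
- exact: inv1_cont.
Defined.

Let p1_compat : chart_compatible p1c0 p1c1.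
Proof.
move=> [z|//] _ z0; have zn : z != 0 by apply/eqP => zz; apply: z0; rewrite zz.
have h (y : K) : y != 0 -> differentiable (fun v : E1 => e1 (v 0 0)^-1) (e1 y).
  move=> y0; apply: (@differentiable_comp _ _ _ _ (fun v : E1 => (v 0 0)^-1) e1); last exact: e1_diff.
  by apply: differentiableV; [exact: differentiable_coord|rewrite e1E].
split; first exact: h.
apply: (@near_differentiable _ _ _ (fun v : E1 => e1 (v 0 0)^-1)); last by apply: h; rewrite invr_eq0.
have h2 : \forall w \near e1 z^-1, (w : E1) 0 0 != 0.
  apply: (@entry_continuous _ [set y | y != 0]); rewrite e1E.
  by apply: nbhs_neq0; rewrite invr_eq0.
by apply: filterS h2 => w w0; rewrite /= /inv1 (negbTE w0).
Qed.

Let A0 : set (chart R 1 opc) := [set a | a = p1c0 \/ a = p1c1].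

Let opc_ne : [set: opc] !=set0. Proof. by exists None. Qed.

Let opc_haus : hausdorff_space opc.
Proof. exact: (one_point_compactification_hausdorff complex_locally_compact complex_hausdorff). Qed.

Let A0_cover x : exists2 a, A0 a & chart_dom a x.
Proof.
case: x => [z|]; first by exists p1c0; [left|].
by exists p1c1; [right|].
Qed.

Let A0_compat a b : A0 a -> A0 b -> chart_compatible a b.
Proof.
by move=> [->|->] [->|->]; [exact: chart_compatible_refl|exact: p1_compat|
  exact: (chart_compatible_sym p1_compat)|exact: chart_compatible_refl].
Qed.

Definition proj_line : complex_manifold R 1 :=
  manifold_of_atlas opc_ne opc_haus opc_second_countable A0_cover A0_compat.

Lemma proj_line_compact : compact [set: proj_line].
Proof. exact: one_point_compactification_compact. Qed.

Lemma p1c0_at z : chart_at (Some z : proj_line) p1c0.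
Proof. by split => //; apply: (max_atlas_sub A0_compat); left. Qed.

Lemma p1c1_at (y : proj_line) : y <> Some 0 -> chart_at y p1c1.
Proof. by move=> y0; split => //; apply: (max_atlas_sub A0_compat); right. Qed.

Lemma p1c0E (z : K) : p1c0 (Some z) = e1 z. Proof. by []. Qed.
Lemma p1c0_invE v : chart_inv p1c0 v = Some (v 0 0). Proof. by []. Qed.
Lemma p1c1E (z : K) : p1c1 (Some z) = e1 z^-1. Proof. by []. Qed.
Lemma p1c1_noneE : p1c1 None = e1 0. Proof. by []. Qed.
Lemma p1c1_invE (v : E1) : chart_inv p1c1 v = if v 0 0 == 0 then None else Some (v 0 0)^-1.
Proof. by []. Qed.

End ProjectiveLine.

(** * Analytic subsets of products *)

Section ProductManifold.
Context {R : realType} {n m : nat} {M : complex_manifold R n} {N : complex_manifold R m}.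
Local Notation K := (Cx R).
Local Notation E := ('rV[K]_n * 'rV[K]_m)%type.
Implicit Types (h : M * N -> K) (w : M * N).

Definition hol2 h w := forall a b, chart_at w.1 a -> chart_at w.2 b ->
  differentiable (fun z : E => h (chart_inv a z.1, chart_inv b z.2)) (a w.1, b w.2).

Lemma differentiable_fst (V W : normedModType K) (z : V * W) : differentiable (fst : V * W -> V) z.
Proof.
apply: (@linear_differentiable _ _ _ (fst : {linear (V * W)%type -> V})) => y; exact: cvg_fst.
Qed.

Lemma differentiable_snd (V W : normedModType K) (z : V * W) : differentiable (snd : V * W -> W) z.
Proof.
apply: (@linear_differentiable _ _ _ (snd : {linear (V * W)%type -> W})) => y; exact: cvg_snd.
Qed.

Lemma hol2_fst (g : M -> K) w : hol g w.1 -> hol2 (fun u => g u.1) w.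
Proof.
move=> hg a b ha hb.
exact: (@differentiable_comp _ _ _ _ fst (g \o chart_inv a) (a w.1, b w.2) (differentiable_fst _) (hg a ha)).
Qed.

Lemma hol2_snd (g : N -> K) w : hol g w.2 -> hol2 (fun u => g u.2) w.
Proof.
move=> hg a b ha hb.
exact: (@differentiable_comp _ _ _ _ snd (g \o chart_inv b) (a w.1, b w.2) (differentiable_snd _) (hg b hb)).
Qed.

Lemma hol2_cst (c : K) w : hol2 (fun=> c) w.
Proof. by move=> a b _ _; exact: differentiable_cst. Qed.

Lemma hol2_ext h h' w : h =1 h' -> hol2 h w -> hol2 h' w.
Proof. by move=> /funext ->. Qed.

Lemma hol2M h h' w : hol2 h w -> hol2 h' w -> hol2 (fun u => h u * h' u) w.
Proof. by move=> H H' a b ha hb; exact: (differentiableMK (H a b ha hb) (H' a b ha hb)). Qed.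

Lemma hol2_sum (I : Type) (s : seq I) (P : pred I) (f : I -> M * N -> K) w :
  (forall i, P i -> hol2 (f i) w) -> hol2 (fun u => \sum_(i <- s | P i) f i u) w.
Proof.
move=> hf a b ha hb.
by apply: (@differentiable_bigsum _ _ _ _ s P
  (fun i (z : E) => f i (chart_inv a z.1, chart_inv b z.2))) => i Pi; exact: hf.
Qed.

Lemma hol2_prod (I : Type) (s : seq I) (P : pred I) (f : I -> M * N -> K) w :
  (forall i, P i -> hol2 (f i) w) -> hol2 (fun u => \prod_(i <- s | P i) f i u) w.
Proof.
move=> hf a b ha hb.
by apply: (@differentiable_bigprod _ _ _ s P
  (fun i (z : E) => f i (chart_inv a z.1, chart_inv b z.2))) => i Pi; exact: hf.
Qed.

Lemma hol2_det k (A : 'I_k -> 'I_k -> M * N -> K) w : (forall i j, hol2 (A i j) w) ->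
  hol2 (fun u => \det (\matrix_(i, j) A i j u)) w.
Proof.
move=> hA.
apply: (@hol2_ext (fun u => \sum_(s : {perm 'I_k}) (-1) ^+ s * \prod_i A i (s i) u)).
  move=> u; rewrite /determinant; apply: eq_bigr => s _; congr (_ * _).
  by apply: eq_bigr => i _; rewrite mxE.
apply: hol2_sum => s _; apply: hol2M; first exact: hol2_cst.
by apply: hol2_prod => i _.
Qed.

Lemma hol2_continuous h w : hol2 h w -> {for w, continuous h}.
Proof.
move=> hh; have [a [ha ax]] := chart_at_ex w.1; have [b [hb bx]] := chart_at_ex w.2.
have c := differentiable_continuous (hh a b (conj ha ax) (conj hb bx)).
move=> S hS.
have hS' : nbhs (h (chart_inv a (a w.1), chart_inv b (b w.2))) S.
  by rewrite (chart_mapK ax) (chart_mapK bx) -surjective_pairing.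
have [[P Q] [/= nP nQ] PQ] := c S hS'.
have nP' := chart_push ax nP; have nQ' := chart_push bx nQ.
exists ([set x | chart_dom a x /\ P (a x)], [set y | chart_dom b y /\ Q (b y)]) => //.
move=> [x y] /= [[ax' Px] [bx' Qx]]; have := PQ (a x, b y) (conj Px Qx).
by rewrite /= (chart_mapK ax') (chart_mapK bx').
Qed.

Lemma analytic_prod_local (G : set (M * N)) :
  (forall w, exists U (T : finType) (h : T -> M * N -> K), [/\ open U, U w,
     forall i, holo_on_prod U (h i) & forall u, U u -> (G u <-> forall i, h i u = 0)]) ->
  analytic_subset_prod G.
Proof.
move=> H; split; last first.
  move=> w; have [U [T [h [oU Uw hh hG]]]] := H w.
  exists U, #|T|, (fun i => h (enum_val i)); split => // u Uu.
  rewrite hG//; split=> h0 i //; by have := h0 (enum_rank i); rewrite enum_rankK.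
rewrite -[G]setCK; apply: open_closedC; rewrite openE => w nG.
have [U [T [h [oU Uw hh hG]]]] := H w.
have [i hi] : exists i, h i w <> 0.
  by apply: contrapT => /forallNP hn; apply: nG; apply/hG => // i; exact: contrapT.
have hne : \forall u \near w, h i u != 0.
  exact: (hol2_continuous (hh i w Uw : hol2 (h i) w) (nbhs_neq0 (introN eqP hi))).
have nU : nbhs w U by exact: open_nbhs_nbhs.
apply: filterS (filterI hne nU) => u [hu Uu] Gu.
by move: hu; rewrite (proj1 (hG u Uu) Gu i) eqxx.
Qed.

(** Properness over M comes from the compactness of N: the part of the closed set [G] over a compact
    set [A] is closed in a compact product. *)
Lemma meromorphic_graph (f : M -> N) (Z : set M) (G : set (M * N)) :
  compact [set: N] -> analytic_subset Z -> dense (~` Z) -> holo_map_on (~` Z) f ->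
  analytic_subset_prod G -> (forall x y, ~ Z x -> (G (x, y) <-> y = f x)) -> meromorphic_map f Z.
Proof.
move=> cN aZ dZ hf aG GE; split => //; exists G; split => // A cA.
rewrite setIC; apply: compact_closedI; last by case: aG.
exact: compact_setX.
Qed.

Lemma holo_map_local (f : M -> N) (g : M -> 'rV[K]_m) (b0 : chart R m N) x :
  chart_at (f x) b0 -> hol g x -> g x = b0 (f x) ->
  (\forall y \near x, f y = chart_inv b0 (g y)) ->
  {for x, continuous f} /\ forall a b, chart_at x a -> chart_at (f x) b ->
      differentiable (b \o f \o chart_inv a) (a x).
Proof.
move=> [hb0 b0x] hg gx fg; split.
  have c1 := hol_continuous hg.
  have c2 : {for g x, continuous (chart_inv b0)}.
    by rewrite gx; apply: chart_inv_cont; exists (f x).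
  have c3 : {for x, continuous (chart_inv b0 \o g)} by exact: continuous_comp.
  move=> S; rewrite (nbhs_singleton fg) => hS.
  have h : \forall y \near x, S (f y).
    by apply: filterS (filterI fg (c3 S hS)) => y [fy Sy]; rewrite fy.
  exact: h.
move=> a b [ha ax] [hb bx].
have [dbb _] := atlas_compatible hb0 hb b0x bx.
have e : b0 (f x) = (g \o chart_inv a) (a x) by rewrite /= chart_mapK.
rewrite e in dbb.
apply: (near_differentiable _ (differentiable_comp (hg a (conj ha ax)) dbb)).
by apply: filterS (chart_pull ax fg) => z [_ _ /= ->].
Qed.

End ProductManifold.

(** * Analytic subsets of connected manifolds *)

Section Identity.
Context {R : realType} {n : nat} {M : complex_manifold R n}.
Local Notation K := (Cx R).

(** The radius in [zero_vanish] is uniform for y near p. Points within r / 512 of [a p] are less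
    than r / 256 apart, which is (r / 2) / 128. *)
Lemma near_vanish U (f : M -> K) p : open U -> U p -> holo_on U f ->
  \forall y \near p, (\forall z \near y, f z = 0) -> \forall z \near p, f z = 0.
Proof.
move=> oU Up hf; have [a [ha ap]] := chart_at_ex p.
pose O := [set z | (a @` chart_dom a) z /\ U (chart_inv a z)].
have oO : open O by exact: open_chart_image.
have dO : holo_open O (f \o chart_inv a).
  by move=> z [[y ay <-]]; rewrite (chart_mapK ay) => Uy; exact: (hf y Uy a (conj ha ay)).
have Op : O (a p) by split; [exists p|rewrite chart_mapK].
have [r r0 [hO [hb hM]]] := holo_bounded_ball oO dO Op.
move: (_ + 1) hM => B hM.
have r512 : 0 < r / 512 by lra.
have nb := open_nbhs_nbhs (conj (open_nr_ball (a p) (r / 512)) (ltac:(by rewrite /= subrr nr0) : nr (a p - a p) < r / 512)).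
apply: filterS (chart_push ap nb) => y [ay hy] fy.
have [d d0 hd] := proj1 (nbhs_nr _ _) (chart_pull ay fy).
apply: filterS (chart_push ap nb) => z [az hz].
have r2 : 0 < r / 2 by lra.
have sub w : nr (w - a y) < r / 2 -> nr (w - a p) < r.
  by move=> hw; rewrite /= in hy; have := nr_trans w (a y) (a p); lra.
have hzy : nr (a z - a y) < r / 2 / 128.
  by rewrite /= in hy hz; have := nr_trans (a z) (a p) (a y); rewrite (nrB (a p)); lra.
have h1 : holo_ball (f \o chart_inv a) (a y) (r / 2) by move=> w hw; apply: hb; exact: sub.
have h2 : bound_ball (f \o chart_inv a) (a y) (r / 2) B by move=> w hw; apply: hM; exact: sub.
have h3 w : nr (w - a y) < d -> (f \o chart_inv a) w = 0 by move=> /hd[].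
have := zero_vanish r2 h1 h2 d0 h3 hzy.
by rewrite /= (chart_mapK az).
Qed.

Lemma analytic_setI (Z1 Z2 : set M) : analytic_subset Z1 -> analytic_subset Z2 ->
  analytic_subset (Z1 `&` Z2).
Proof.
move=> [_ a1] [_ a2]; apply: analytic_local => p.
have [U1 [k1 [h1 [oU1 U1p hh1 e1]]]] := a1 p; have [U2 [k2 [h2 [oU2 U2p hh2 e2]]]] := a2 p.
exists (U1 `&` U2), ('I_k1 + 'I_k2)%type, (fun i => match i with inl i => h1 i | inr i => h2 i end).
split => //; first exact: openI.
  by move=> [i|i] x [x1 x2]; [exact: hh1|exact: hh2].
move=> x [x1 x2]; split=> [[z1 z2] [i|i]|h].
- exact: (proj1 (e1 x x1) z1).
- exact: (proj1 (e2 x x2) z2).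
- by split; [apply/(e1 x x1) => i; exact: (h (inl i))|apply/(e2 x x2) => i; exact: (h (inr i))].
Qed.

(** The interior of [Z] is closed: at a point of its closure, the local equations of [Z] vanish near
    interior points arbitrarily close by, hence near the point itself by [near_vanish]. *)
Lemma analytic_interior (Z : set M) (x : M) : connected [set: M] -> analytic_subset Z ->
  nbhs x Z -> Z = setT.
Proof.
move=> cM [_ aZ] xZ.
have oW : open Z° by exact: open_interior.
suff clW : closed Z°.
  have WT : Z° = setT.
    by apply: cM; [exists x|exists Z°; rewrite ?setTI|exists Z°; rewrite ?setTI].
  by apply/seteqP; split => // y _; apply: (@interior_subset _ Z); rewrite WT.
move=> p clp; have [U [k [h [oU Up hh e]]]] := aZ p.
have H : \forall y \near p, forall i, (\forall z \near y, h i z = 0) -> \forall z \near p, h i z = 0.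
  by apply: filter_forall => i; exact: (near_vanish oU Up (hh i)).
have nU : nbhs p U by exact: open_nbhs_nbhs.
have [y [Wy [Hy Uy]]] := clp _ (filterI H nU).
have hp : \forall z \near p, forall i, h i z = 0.
  apply: filter_forall => i; apply: Hy.
  have nUy : nbhs y U by exact: open_nbhs_nbhs.
  by apply: filterS (filterI (Wy : nbhs y Z) nUy) => z [Zz Uz]; exact: (proj1 (e z Uz) Zz).
have : nbhs p Z by apply: filterS (filterI hp nU) => z [hz Uz]; apply/(e z Uz).
exact.
Qed.

Lemma analytic_dense (Z : set M) : connected [set: M] -> analytic_subset Z -> Z <> setT ->
  dense (~` Z).
Proof.
move=> cM aZ ZT O [x Ox] oO; apply/set0P/negP => /eqP OZ; apply: ZT.
apply: (analytic_interior (x := x) cM aZ).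
apply: filterS (open_nbhs_nbhs (conj oO Ox)) => y Oy; apply: contrapT => nZ.
by have : (O `&` ~` Z) y by []; rewrite OZ.
Qed.

Lemma dense_closed (A C : set M) : dense A -> closed C -> A `<=` C -> C = setT.
Proof.
move=> dA cC AC; apply/seteqP; split => // x _; apply: contrapT => nC.
have [y [ny Ay]] : (~` C) `&` A !=set0 by apply: dA; [exists x|exact: closed_openC].
by apply: ny; exact: AC.
Qed.

End Identity.

(** * Tuples of sections degenerate to all orders *)

Section Tuples.
Context {R : realType} {n : nat} {M : complex_manifold R n} (F : foliation M) {B : line_bundle M}.
Local Notation K := (Cx R).
Local Notation presec := (presection B).
Local Notation Dm := (@Dm R n M F B).
Variable V : set presec.
Hypothesis hV : linear_system V.

Let Vglobal s : V s -> global_section s. Proof. by have [h _ _] := hV; exact: h. Qed.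

Definition indep k (t : 'I_k -> presec) :=
  forall d : 'rV[K]_k, scomb (d 0) t = @zero_section _ _ _ B -> d = 0.

Lemma V_scomb k (d : 'I_k -> K) (t : 'I_k -> presec) : (forall j, V (t j)) -> V (scomb d t).
Proof.
move=> Vt; have [_ V0 Vlin] := hV.
suff H (s : seq 'I_k) : V (fun i x => \sum_(j <- s) d j * t j i x) by exact: H.
elim: s => [|j s IH].
  rewrite (_ : (fun _ => _) = @zero_section _ _ _ B)//.
  by apply/funext => i; apply/funext => x; rewrite big_nil.
rewrite (_ : (fun _ => _) = (fun i x => d j * t j i x + \sum_(l <- s) d l * t l i x)).
  exact: Vlin.
by apply/funext => i; apply/funext => x; rewrite big_cons.
Qed.

(** A generating tuple of least length is independent, since a relation would eliminate one of its
    members. *)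
Lemma independent_generators : finite_dimensional V -> exists k (b : 'I_k -> presec),
  [/\ forall j, V (b j), indep b &
      forall s, V s -> exists c : 'rV[K]_k, s = scomb (c 0) b].
Proof.
move=> hfin.
pose P k := `[< exists b : 'I_k -> presec, (forall j, V (b j)) /\
   forall s, V s -> exists c : 'I_k -> K, s = scomb c b >].
have exP : exists k, P k by have [k hk] := hfin; exists k; apply/asboolP.
case: (ex_minnP exP) => k /asboolP[b [Vb sb]] kmin.
exists k, b; split => //; last first.
  move=> s /sb[c ->]; exists (\row_j c j); apply/funext => i; apply/funext => x.
  by apply: eq_bigr => j _; rewrite mxE.
move=> d d0; apply: contrapT => /eqP/rV0Pn[j dj].
case: k b Vb sb kmin d j d0 dj => [|k] b Vb sb kmin d j d0 dj; first by case: j dj.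
suff : P k by move/kmin; rewrite ltnn.
apply/asboolP; exists (fun l => b (lift j l)); split => // s /sb[c ->].
exists (fun l => c (lift j l) - c j / d 0 j * d 0 (lift j l)).
apply/funext => i; apply/funext => x; rewrite /scomb.
have := congr1 (fun s : presec => s i x) d0; rewrite /scomb /zero_section.
rewrite !(bigD1_ord j)//= => E.
have -> : b j i x = - (d 0 j)^-1 * \sum_(l < k) d 0 (lift j l) * b (lift j l) i x.
  rewrite (_ : \sum_(l < k) _ = - (d 0 j * b j i x)); first by field.
  by apply/eqP; rewrite -addr_eq0 addrC E.
rewrite mulrA mulr_sumr -big_split /=; apply: eq_bigr => l _; ring.
Qed.

Lemma flS_lin m k (t : 'I_k -> presec) x (c : K) (d d' : 'rV[K]_k) : (forall j, global_section (t j)) ->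
  flS F m (scomb (d 0) t) x -> flS F m (scomb (d' 0) t) x -> flS F m (scomb ((c *: d + d') 0) t) x.
Proof.
move=> gt; have [U [T [A [oU Ux hA hU]]]] := flS_local F m x gt.
move=> /(hU x _ Ux) h /(hU x _ Ux) h'; apply/(hU x _ Ux) => r.
rewrite (eq_bigr (fun j => c * (d 0 j * A r j x) + d' 0 j * A r j x)); last first.
  by move=> j _; rewrite !mxE mulrDl mulrA.
by rewrite big_split /= -mulr_sumr h h' mulr0 addr0.
Qed.

Definition degenerate k (t : 'I_k -> presec) :=
  [/\ forall j, V (t j), indep t & forall m x, Dm m t (fun=> 0) x].

Lemma degenerate_limit k (t : 'I_k -> presec) x : degenerate t ->
  exists2 d : 'rV[K]_k, d != 0 & forall m, flS F m (scomb (d 0) t) x.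
Proof.
move=> [Vt _ hD]; have gt j : global_section (t j) by exact: Vglobal.
apply: (decreasing_limit (P := fun m d => flS F m (scomb (d 0) t) x)).
- by move=> m d; exact: flS_le.
- by move=> m c d d'; exact: flS_lin.
- by move=> m; have [d d0 [_ h]] := hD m x; exists d.
Qed.

Lemma degenerate_generators (Lambda : Type) (L : Lambda -> set M) k (b : 'I_k -> presec) :
  (forall i, exists s : presec, [/\ V s, s <> @zero_section _ _ _ B & leaf_flat_contact F (L i) s]) ->
  analytic_closure (\bigcup_i L i) = [set: M] ->
  (forall j, V (b j)) -> indep b -> (forall s, V s -> exists c : 'rV[K]_k, s = scomb (c 0) b) ->
  degenerate b.
Proof.
move=> hflat hcl Vb ib sb; split => // m x.
have gb j : global_section (b j) by exact: Vglobal.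
have : analytic_closure (\bigcup_i L i) x by rewrite hcl.
apply; first exact: Dm_analytic.
move=> p [i _ Lp]; have [s [Vs s0 fs]] := hflat i; have [c sE] := sb s Vs.
exists c.
  apply/eqP => c0; apply: s0; rewrite sE c0; apply/funext => i'; apply/funext => y.
  by apply: big1 => j _; rewrite mxE mul0r.
split; first by apply: big1 => j _; rewrite mulr0.
by rewrite -sE; exact: (leaf_flS (Vglobal Vs) fs Lp).
Qed.

(* The kernel of a linear form violating the conclusion would give a shorter tuple. *)
Lemma degenerate_minimal k (t : 'I_k -> presec) : degenerate t -> exists k' (t' : 'I_k'.+2 -> presec),
  degenerate t' /\ forall l : 'I_k'.+2 -> K, (exists j, l j != 0) -> exists m x, ~ Dm m t' l x.
Proof.
move=> ht.
pose P k := `[< exists t : 'I_k -> presec, degenerate t >].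
have exP : exists k, P k by exists k; apply/asboolP; exists t.
case: (ex_minnP exP) => {ht t k exP}k /asboolP[t ht] kmin; have [Vt it hD] := ht.
have [x0 _] := mnonempty M.
(* Length 0 leaves no nonzero combination, and for length 1 the only section would vanish at every
   point, against independence. *)
case: k t ht Vt it hD kmin => [|[|k]] t ht Vt it hD kmin.
- by have [d /rV0Pn[[]]] := hD 0%N x0.
- suff /it/eqP : scomb ((const_mx 1 : 'rV[K]_1) 0) t = @zero_section _ _ _ B.
    by move=> /eqP/rowP/(_ 0); rewrite !mxE => /eqP; rewrite oner_eq0.
  apply/funext => i; apply/funext => x; rewrite /scomb big_ord1 mxE mul1r /zero_section.
  have [ix|nix] := pselect (@lb_dom _ _ _ B i x); last first.
    by have [_ h _] := Vglobal (Vt 0); exact: h.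
  have [d d0 [_ fd]] := hD 0%N x; have [a xa] := chart_at_ex x.
  have := fl0 (fd i a ix xa); rewrite /scomb big_ord1 => /eqP; rewrite mulf_eq0 => /orP[/eqP dz|/eqP //].
  by case/eqP: d0; apply/rowP => j; rewrite ord1 dz mxE.
exists k, t; split => // l [j0 lj0]; apply: contrapT => /forallNP hn.
have hl m x : Dm m t l x.
  by have /forallNP/(_ x)/contrapT := hn m.
pose lc : 'cV[K]_k.+2 := \col_j l j.
pose Q := row_base (kermx lc).
have rk : (\rank (kermx lc) < k.+2)%N.
  rewrite mxrank_ker; have : (0 < \rank lc)%N; last by move=> r0; rewrite ltn_subrL r0.
  rewrite lt0n mxrank_eq0; apply/eqP => /matrixP/(_ j0 0); rewrite !mxE => /eqP.
  by rewrite (negbTE lj0).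
pose t' i := scomb (Q i) t.
have t'E (d : 'rV[K]_(\rank (kermx lc))) : scomb (d 0) t' = scomb ((d *m Q) 0) t.
  apply/funext => i; apply/funext => x; rewrite /scomb.
  under eq_bigr do rewrite mulr_sumr.
  rewrite exchange_big /=; apply: eq_bigr => j _; rewrite mxE mulr_suml.
  by apply: eq_bigr => r _; rewrite mulrA.
suff : degenerate t' by move=> h'; have := kmin _ (introT (asboolP _) (ex_intro _ t' h')); rewrite leqNgt rk.
split.
- by move=> i; exact: V_scomb.
- move=> d; rewrite t'E => /it dQ; apply: (row_free_inj (row_base_free _)).
  by rewrite mul0mx.
- move=> m x; have [d d0 [dl fd]] := hl m x.
  have : (d <= Q)%MS.
    rewrite eq_row_base; apply/sub_kermxP/matrixP => i j; rewrite !ord1 !mxE -[RHS]dl.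
    by apply: eq_bigr => r _; rewrite mxE.
  move=> /submxP[d' dE]; exists d'.
    by apply: contra_neq d0 => d'0; rewrite dE d'0 mul0mx.
  by split; [apply: big1 => j _; rewrite mulr0|rewrite t'E -dE].
Qed.

End Tuples.

(** * The first integral *)

Section Ratio.
Context {R : realType} {n : nat} {M : complex_manifold R n} (F : foliation M) {B : line_bundle M}.
Local Notation K := (Cx R).
Local Notation presec := (presection B).
Local Notation Dm := (@Dm R n M F B).
Local Notation N := (@proj_line R).

Lemma hol_chart_map (m : nat) (M' : complex_manifold R m) (a : chart R m M') x :
  chart_at x a -> hol (a : M' -> 'rV[K]_m) x.
Proof.
move=> ha; have [_ ax] := ha; apply: (hol_chart ha).
apply: (@near_differentiable _ _ _ id); last exact: ex_diff.
by apply: filterS (chart_pull ax filterT) => z [_ /= ->].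
Qed.

Lemma p1c1_domE (y : option K) : chart_dom (p1c1 : chart R 1 N) y <-> y <> Some 0.
Proof. by []. Qed.

Lemma sum_delta k (d : 'I_k -> K) i : \sum_j d j * (j == i)%:R = d i.
Proof.
rewrite (bigD1 i)//= eqxx mulr1 big1 ?addr0// => j /negbTE ->.
by rewrite mulr0.
Qed.

Lemma hol_adj k (P : 'I_k.+1 -> 'I_k.+1 -> M -> K) i j x : (forall i j, hol (P i j) x) ->
  hol (fun y => (\adj (\matrix_(a, b) P a b y)) i j) x.
Proof.
move=> hP.
apply: (@hol_near _ _ _ _ (fun y => (-1) ^+ (j + i) *
   \det (\matrix_(a, b) P (lift j a) (lift i b) y))).
  apply: nearW => y; rewrite mxE /cofactor; congr (_ * \det _).
  by apply/matrixP => a b; rewrite !mxE.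
apply: holM; first exact: hol_cst.
exact: hol_det.
Qed.

(* Cramer's rule: where a coordinate is injective on the space of solutions, the
   ratios of the other coordinates to it are holomorphic. *)
Lemma hol_ratio m k (t : 'I_k.+1 -> presec) x (j j' : 'I_k.+1) : (forall i, global_section (t i)) ->
  (forall d : 'rV[K]_k.+1, flS F m (scomb (d 0) t) x -> d 0 j = 0 -> d = 0) ->
  exists2 g : M -> K, hol g x & \forall y \near x,
    (forall d : 'rV[K]_k.+1, flS F m (scomb (d 0) t) y -> d 0 j = 0 -> d = 0) /\
    forall d : 'rV[K]_k.+1, flS F m (scomb (d 0) t) y -> d 0 j' = d 0 j * g y.
Proof.
move=> gt inj; have [U [T [A [oU Ux hA hU]]]] := flS_local F m x gt.
pose A' (r : option T) (l : 'I_k.+1) (y : M) : K := if r is Some r' then A r' l y else (l == j)%:R.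
have hA' r l y : U y -> hol (A' r l) y by move=> Uy; case: r => [r|]; [exact: hA|exact: hol_cst].
have [f fdet] : exists f : {ffun 'I_k.+1 -> option T}, \det (\matrix_(i, l) A' (f i) l x) != 0.
  apply: contrapT => /forallNP H.
  have [|d d0 dA] := proj2 (minors_vanish (fun r l => A' r l x)).
    by move=> f; apply/eqP/negPn/negP; exact: H.
  have dj : d 0 j = 0 by rewrite -(dA None) /A' sum_delta.
  case/eqP: d0; apply: inj => //; apply/(hU x _ Ux) => r; exact: (dA (Some r)).
pose P y := \matrix_(i, l) A' (f i) l y.
(* For flat [d], the rows taken from the flatness equations give 0 and those from [None] give d_j.
   Hence P y sends [d] to d_j u, with [u] independent of [d] and y. *)
pose u i : K := (f i == None)%:R.
have Pd y (d : 'rV[K]_k.+1) : U y -> flS F m (scomb (d 0) t) y ->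
    P y *m d^T = d 0 j *: \col_i u i.
  move=> Uy /(hU y _ Uy) dA; apply/matrixP => i l; rewrite !mxE ord1 /u.
  case fi : (f i) => [r|] /=.
    by rewrite mulr0 -[RHS](dA r); apply: eq_bigr => q _; rewrite !mxE fi mulrC.
  rewrite mulr1 -[RHS](sum_delta (fun i => d 0 i) j); apply: eq_bigr => q _.
  by rewrite !mxE fi mulrC.
have adjE y (d : 'rV[K]_k.+1) l : U y -> flS F m (scomb (d 0) t) y ->
    \det (P y) * d 0 l = d 0 j * \sum_i (\adj (P y)) l i * u i.
  move=> Uy /(Pd y d Uy) E; have := congr1 (fun Q : 'cV_k.+1 => (\adj (P y) *m Q) l 0) E.
  rewrite mulmxA mul_adj_mx mul_scalar_mx -scalemxAr !mxE => ->.
  by congr (_ * _); apply: eq_bigr => i _; rewrite !mxE.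
have hdet : hol (fun y => \det (P y)) x by apply: hol_det => i l; exact: hA'.
exists (fun y => (\det (P y))^-1 * \sum_i (\adj (P y)) j' i * u i).
  apply: holM; first exact: holV.
  apply: hol_sum => i _; apply: holM; last exact: hol_cst.
  by apply: hol_adj => a b; exact: hA'.
have nU : nbhs x U by exact: open_nbhs_nbhs.
apply: filterS (filterI nU (hol_neq0_near hdet fdet)) => y [Uy dy].
split=> [d fd dj|d fd].
  apply/rowP => l; rewrite mxE; apply: (mulfI dy).
  by rewrite (adjE y d l Uy fd) dj mul0r mulr0.
by apply: (mulfI dy); rewrite (adjE y d j' Uy fd) mulrCA mulVKf.
Qed.

Variables (k : nat) (t : 'I_k.+2 -> presec).
Hypothesis gt : forall i, global_section (t i).

Let i0 : 'I_k.+2 := ord0.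
Let i1 : 'I_k.+2 := lift ord0 ord0.

(* The point [Some z] of the projective line stands for the combinations [d]
   with [d 1 = z * d 0], and the point [None] for those with [d 0 = 0]. *)
Definition pform (y : option K) (j : 'I_k.+2) : K :=
  if y is Some z then (j == i1)%:R - z * (j == i0)%:R else (j == i0)%:R.

Definition on_line (y : option K) (d : 'rV[K]_k.+2) := \sum_j d 0 j * pform y j = 0.

Lemma on_lineE y d : on_line y d <-> if y is Some z then d 0 i1 = z * d 0 i0 else d 0 i0 = 0.
Proof.
rewrite /on_line; case: y => [z|] /=; last by rewrite (sum_delta (fun j => d 0 j)).
under eq_bigr do rewrite mulrBr mulrCA.
rewrite sumrB -mulr_sumr !(sum_delta (fun j => d 0 j)).
by split=> [/eqP|->]; rewrite ?subrr// subr_eq0 => /eqP.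
Qed.

(** The point [a : b] in the coordinate b / a; the value at (0, 0) is a default. *)
Definition pt (a b : K) : option K := if a == 0 then None else Some (b / a).

Lemma on_line_pt (d : 'rV[K]_k.+2) : on_line (pt (d 0 i0) (d 0 i1)) d.
Proof. by apply/on_lineE; rewrite /pt; case: eqVneq => // d0; rewrite divfK. Qed.

Lemma on_line_uniq y (d : 'rV[K]_k.+2) : (d 0 i0 != 0) || (d 0 i1 != 0) -> on_line y d -> y = pt (d 0 i0) (d 0 i1).
Proof.
move=> dn /on_lineE; rewrite /pt; case: y => [z|] h; last by rewrite h eqxx.
case: eqVneq => [d0|d0]; last by rewrite h mulfK.
by move: dn; rewrite h d0 mulr0 eqxx.
Qed.

Lemma pform_neq0 y : exists j, pform y j != 0.
Proof.
case: y => [z|]; last by exists i0; rewrite /pform eqxx oner_eq0.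
by exists i1; rewrite /pform eqxx mulr0 subr0 oner_eq0.
Qed.

Variable m : nat.
Hypothesis hgood : forall x, Dm m t (fun=> 0) x.

Local Notation flat d x := (flS F m (scomb (d 0) t) x).

(** Off this set one of the coordinates d_0 and d_1 is injective on the flat combinations. An
    intersection of two loci [Dm], it is analytic. *)
Definition indet : set M := Dm m t (pform None) `&` Dm m t (pform (Some 0)).

(** Defined over the indeterminacy locus as well, where extra points are allowed by
    [meromorphic_map]. *)
Definition ratio_graph : set (M * N) := [set w | Dm m t (pform w.2) w.1].

Definition sec_ratio (x : M) : N := xget (None : N) [set y | ratio_graph (x, y)].

Lemma flat_ex x : exists2 d : 'rV[K]_k.+2, d != 0 & flat d x.
Proof. by have [d d0 [_ h]] := hgood x; exists d. Qed.

Lemma indetP x : ~ indet x <-> exists2 j, j = i0 \/ j = i1 &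
  forall d : 'rV[K]_k.+2, flat d x -> d 0 j = 0 -> d = 0.
Proof.
split=> [nZ|[j hj inj] [[d d0 [dl fd]] [d' d'0 [dl' fd']]]].
  have [h|h] : ~ Dm m t (pform None) x \/ ~ Dm m t (pform (Some 0)) x.
  - by apply: contrapT => /not_orP[/contrapT ? /contrapT ?]; apply: nZ.
  - exists i0; first by left.
    move=> d fd di; apply: contrapT => /eqP d0; apply: h; exists d => //; split => //.
    by apply/(on_lineE None d).
  - exists i1; first by right.
    move=> d fd di; apply: contrapT => /eqP d0; apply: h; exists d => //; split => //.
    by apply/(on_lineE (Some 0) d); rewrite mul0r.
move/(on_lineE None d): dl => dl; move/(on_lineE (Some 0) d'): dl'; rewrite mul0r => dl'.
by case: hj => jE; move: inj; rewrite jE => inj; [case/eqP: d0|case/eqP: d'0]; exact: inj.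
Qed.

(* Off the indeterminacy locus a coordinate is injective on the flat combinations,
   which are therefore proportional. *)
Lemma on_line_flat x y (d d' : 'rV[K]_k.+2) : ~ indet x -> d != 0 -> flat d x -> flat d' x ->
  on_line y d -> on_line y d'.
Proof.
move=> /indetP[j _ inj] d0 fd fd' yd.
have dj : d 0 j != 0 by apply: contra_neq d0 => dj; exact: inj.
have E : (- (d' 0 j / d 0 j)) *: d + d' = 0.
  apply: inj; first exact: flS_lin.
  by rewrite !mxE; field.
have E' i : d' 0 i = d' 0 j / d 0 j * d 0 i.
  have /rowP/(_ i) := E; rewrite !mxE => /eqP; rewrite mulNr addrC subr_eq0 => /eqP.
  by [].
rewrite /on_line; under eq_bigr do rewrite E' -mulrA.
by rewrite -mulr_sumr [X in _ * X]yd mulr0.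
Qed.

Lemma ratio_graphE x y (d : 'rV[K]_k.+2) : ~ indet x -> d != 0 -> flat d x ->
  ratio_graph (x, y) <-> y = pt (d 0 i0) (d 0 i1).
Proof.
move=> nZ d0 fd; have [j hj inj] := proj1 (indetP x) nZ.
have dn : (d 0 i0 != 0) || (d 0 i1 != 0).
  have dj : d 0 j != 0 by apply: contra_neq d0 => dj; exact: inj.
  by case: hj => <-; rewrite dj ?orbT.
split=> [[d' d'0 [yd' fd']]|->]; last by exists d => //; split => //; exact: on_line_pt.
by apply: (on_line_uniq dn); exact: (on_line_flat nZ d'0 fd' fd yd').
Qed.

Lemma sec_ratioE x (d : 'rV[K]_k.+2) : ~ indet x -> d != 0 -> flat d x ->
  sec_ratio x = pt (d 0 i0) (d 0 i1).
Proof.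
move=> nZ d0 fd; rewrite /sec_ratio; case: xgetP => [y _ /= /(ratio_graphE y nZ d0 fd) //|h].
by exfalso; apply: (h (pt (d 0 i0) (d 0 i1))); apply/(ratio_graphE _ nZ d0 fd).
Qed.

Lemma ratio_graph_sec_ratio x y : ~ indet x -> ratio_graph (x, y) <-> y = sec_ratio x.
Proof.
by move=> nZ; have [d d0 fd] := flat_ex x; rewrite (sec_ratioE nZ d0 fd); exact: ratio_graphE.
Qed.

Lemma indet_analytic : analytic_subset indet.
Proof. by apply: analytic_setI; exact: Dm_analytic. Qed.

Lemma sec_ratio_holo : holo_map_on (~` indet) sec_ratio.
Proof.
move=> x nZ; have [j hj inj] := proj1 (indetP x) nZ.
(* If d_0 is the injective coordinate the value is finite and d_1 / d_0 is read in [p1c0]; otherwise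
   d_0 / d_1 is read in the chart [p1c1] at infinity. *)
pose j' := if j == i0 then i1 else i0.
have [g hg near_g] := hol_ratio j' gt inj.
pose b : chart R 1 N := if j == i0 then p1c0 else p1c1.
have rE : \forall y \near x, sec_ratio y = chart_inv b (e1 (g y)) /\ (chart_dom b (sec_ratio y)).
  apply: filterS near_g => y [inj' gE].
  have nZy : ~ indet y by apply/indetP; exists j.
  have [d d0 fd] := flat_ex y.
  have dj : d 0 j != 0 by apply: contra_neq d0 => dj; exact: inj'.
  have E := gE d fd; rewrite (sec_ratioE nZy d0 fd) /pt.
  case: hj => jE; move: dj E; rewrite /b /j' jE.
    rewrite eqxx => dj ->; rewrite (negbTE dj); split=> //.
    by rewrite p1c0_invE e1E mulrC mulKf.
  have -> : i1 == i0 = false by [].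
  move=> dj ->; rewrite mulf_eq0 (negbTE dj) orFb; split.
    rewrite p1c1_invE e1E; case: eqVneq => // g0.
    by congr Some; rewrite invfM mulrA divff// mul1r.
  apply/p1c1_domE; case: eqVneq => // g0 [] /eqP.
  by rewrite mulf_eq0 invr_eq0 mulf_eq0 (negbTE dj) (negbTE g0).
have [rx bx] := nbhs_singleton rE.
have hb : chart_at (sec_ratio x) b.
  move: bx; rewrite /b; case: (j == i0) => bx; last exact: p1c1_at.
  by move: bx; case: (sec_ratio x) => // z _; exact: p1c0_at.
apply: (@holo_map_local _ _ _ _ _ sec_ratio (fun y => e1 (g y)) b) => //.
- by move=> a ha; exact: (differentiable_comp (hg a ha) (e1_diff _)).
- have -> : sec_ratio x = chart_inv b (e1 (g x)) by exact: rx.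
  rewrite rx in bx; move: bx; rewrite /b; case: (j == i0) => bx.
    by rewrite p1c0_invE p1c0E e1E.
  rewrite p1c1_invE e1E; case: eqVneq => [->|g0]; first by rewrite p1c1_noneE.
  by rewrite p1c1E invrK.
- by apply: filterS rE => y [].
Qed.

(** On finite points [pform] is already holomorphic. Around infinity it is multiplied by 1 / z, the
    coordinate of [p1c1], and by -1 at infinity itself; nonzero factors do not change the line. *)
Lemma pform_local (y0 : N) : exists U (q : 'I_k.+2 -> N -> K), [/\ open U, U y0,
  forall j y, U y -> hol (q j) y &
  forall y (d : 'rV[K]_k.+2), U y -> (\sum_j d 0 j * q j y = 0 <-> on_line y d)].
Proof.
have chart_case (y1 : N) (b : chart R 1 N) : chart_at y1 b -> forall y, chart_dom b y ->
    hol (fun y => b y 0 0) y.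
  by move=> [hb _] y yb; apply: hol_entry; exact: hol_chart_map.
have [->|yn] := pselect (y0 = None).
  have hb : chart_at (None : N) p1c1 by exact: p1c1_at.
  exists (chart_dom p1c1), (fun j y => p1c1 y 0 0 * (j == i1)%:R - (j == i0)%:R).
  split; [exact: chart_dom_open|exact: (proj2 hb)| |].
    move=> j y yb; apply: holB; last exact: hol_cst.
    by apply: holM; [exact: (chart_case _ p1c1 hb)|exact: hol_cst].
  move=> y d yb; under eq_bigr do rewrite mulrBr mulrCA.
  rewrite sumrB -mulr_sumr !(sum_delta (fun j => d 0 j)); split=> [/eqP|/on_lineE].
    rewrite subr_eq0 => /eqP E; apply/on_lineE.
    case: y yb E => [z yb|_]; last by rewrite p1c1_noneE e1E mul0r.
    rewrite p1c1E e1E => <-; rewrite mulVKf//.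
    by apply: contra_not_neq yb => ->.
  case: y yb => [z yb ->|_ ->]; last by rewrite p1c1_noneE e1E mul0r subr0.
  by rewrite p1c1E e1E mulKf ?subrr//; apply: contra_not_neq yb => ->.
exists (chart_dom p1c0), (fun j y => (j == i1)%:R - p1c0 y 0 0 * (j == i0)%:R).
split; [exact: chart_dom_open|exact: yn| |].
  move=> j y yb; apply: holB; first exact: hol_cst.
  by apply: holM; [exact: (chart_case _ p1c0 (p1c0_at 0))|exact: hol_cst].
by move=> [z|//] d _; rewrite /on_line /pform p1c0E; under eq_bigr do rewrite e1E.
Qed.

Lemma ratio_graph_analytic : analytic_subset_prod ratio_graph.
Proof.
apply: analytic_prod_local => -[x0 y0].
have [U [T [A [oU Ux0 hA hU]]]] := flS_local F m x0 gt.
have [U' [q [oU' Uy0 hq qE]]] := pform_local y0.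
pose A' (r : option T) (j : 'I_k.+2) (w : M * N) : K := if r is Some r' then A r' j w.1 else q j w.2.
exists (U `*` U'), {ffun 'I_k.+2 -> option T},
  (fun (f : {ffun 'I_k.+2 -> option T}) w => \det (\matrix_(i, j) A' (f i) j w)); split.
- rewrite openE => -[x y] [/= Ux Uy].
  by exists (U, U') => //; split; apply: open_nbhs_nbhs.
- by [].
- move=> f w [Uw U'w].
  apply: (@hol2_det _ _ _ _ _ _ (fun i j w => A' (f i) j w)) => i j; case: (f i) => [r|].
    exact: (hol2_fst (hA r j w.1 Uw : hol (A r j) w.1)).
  exact: (hol2_snd (hq j w.2 U'w)).
move=> [x y] [/= Ux Uy]; rewrite -(minors_vanish (fun r j => A' r j (x, y))).
split=> [[d d0 [dl /(hU x (d 0) Ux) dA]]|[d d0 h]]; exists d => //.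
  by case=> [r|] /=; [exact: dA|apply/(qE y d Uy)].
split; first by apply/(qE y d Uy); exact: (h None).
by apply/(hU x _ Ux) => r; exact: (h (Some r)).
Qed.

End Ratio.

Section FirstIntegral.
Context {R : realType} {n : nat} {M : complex_manifold R n} (F : foliation M).
Local Notation K := (Cx R).
Local Notation N := (@proj_line R).

Lemma analytic_set0 : analytic_subset (set0 : set M).
Proof.
apply: analytic_local => p; exists setT, unit, (fun _ _ => 1); split => //; first exact: openT.
  by move=> _ x _; exact: hol_cst.
by move=> x _; split=> // /(_ tt)/eqP; rewrite oner_eq0.
Qed.

(** The values 0 on [A] and 1 off it are taken in the projective line, whose compactness makes the
    graph proper over M. *)
Lemma locally_constant_first_integral (A : set M) : open A -> closed A -> A !=set0 ->
  A <> setT -> has_first_integral F.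
Proof.
move=> oA cA [x0 Ax0] nAT.
have [x1 nAx1] : exists x, ~ A x.
  by apply: contrapT => /forallNP h; apply: nAT; apply/seteqP; split => // x _; exact: contrapT.
pose v x : K := if `[< A x >] then 0 else 1.
have vA x : A x -> v x = 0 by move=> Ax; rewrite /v asboolT.
have vnA x : ~ A x -> v x = 1 by move=> Ax; rewrite /v asboolF.
have vloc x : exists U : set M, [/\ open U, U x & forall y, U y -> v y = v x].
  have [Ax|nAx] := pselect (A x).
    by exists A; split => // y Ay; rewrite !vA.
  exists (~` A); split => //; first exact: closed_openC.
  by move=> y nAy; rewrite !vnA.
pose f (x : M) : N := Some (v x).
exists 1%N, N, f, set0; split.
- apply: (@meromorphic_graph _ _ _ M N f set0 [set w | w.2 = f w.1]).
  + exact: proj_line_compact.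
  + exact: analytic_set0.
  + by move=> O [x Ox] _; exists x; split.
  + move=> x _; have [U [oU Ux hU]] := vloc x.
    apply: (@holo_map_local _ _ _ M N f (fun=> e1 (v x)) p1c0).
    * exact: p1c0_at.
    * exact: hol_cst.
    * exact: (esym (p1c0E _)).
    * apply: filterS (open_nbhs_nbhs (conj oU Ux)) => y Uy.
      by rewrite p1c0_invE e1E /f (hU y Uy).
  + apply: analytic_prod_local => -[x y0]; have [U [oU Ux hU]] := vloc x.
    have [W [q [oW Wy hq qE]]] : exists (W : set N) (q : N -> K), [/\ open W, W y0,
        forall y, W y -> hol q y & forall y, W y -> (y = Some (v x) <-> q y = 0)].
      have chart_case (y1 : N) (b : chart R 1 N) : chart_at y1 b -> forall y, chart_dom b y ->
          hol (fun y => b y 0 0) y.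
        by move=> [hb _] y yb; apply: hol_entry; exact: hol_chart_map.
      have [->|yn] := pselect (y0 = None).
        have hb : chart_at (None : N) p1c1 by exact: p1c1_at.
        (* Around infinity the equation y = v x reads v x / y = 1, which excludes infinity and has
           no solution when v x = 0. *)
        exists (chart_dom p1c1), (fun y => v x * p1c1 y 0 0 - 1).
        split; [exact: chart_dom_open|exact: (proj2 hb)| |].
          move=> y yb; apply: holB; last exact: hol_cst.
          by apply: holM; [exact: hol_cst|exact: (chart_case _ p1c1 hb)].
        move=> [z|] yb; last first.
          rewrite p1c1_noneE e1E mulr0 sub0r; split=> [//|/eqP].
          by rewrite oppr_eq0 oner_eq0.
        have zn : z != 0 by apply/eqP => zz; apply: yb; rewrite zz.
        rewrite p1c1E e1E; split=> [[<-]|/eqP]; first by rewrite divff// subrr.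
        by rewrite subr_eq0 => /eqP E; rewrite -[v x](mulfVK zn) E mul1r.
      exists (chart_dom p1c0), (fun y => p1c0 y 0 0 - v x).
      split; [exact: chart_dom_open|exact: yn| |].
        move=> y yb; apply: holB; last exact: hol_cst.
        exact: (chart_case _ p1c0 (p1c0_at 0)).
      move=> [z|//] _; rewrite p1c0E e1E; split=> [[<-]|/eqP]; first by rewrite subrr.
      by rewrite subr_eq0 => /eqP ->.
    exists (U `*` W), unit, (fun _ w => q w.2); split.
    * rewrite openE => -[x' y'] [/= Ux' Wy'].
      by exists (U, W) => //; split; apply: open_nbhs_nbhs.
    * by [].
    * by move=> _ w [_ Ww]; exact: (hol2_snd (hq w.2 Ww)).
    * move=> [x' y'] [/= Ux' Wy']; rewrite /f (hU x' Ux') (qE y' Wy').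
      by split=> [h _|/(_ tt)].
  + by [].
- exists x0, x1; split => //; rewrite /f (vA _ Ax0) (vnA _ nAx1) => -[] /eqP.
  by rewrite eq_sym oner_eq0.
- move=> L y hL [p [Lp [fp _]]] q [Lq _]; rewrite /= -fp /f; congr Some.
  have [Ap|nAp] := pselect (A p).
    rewrite (vA p Ap) vA//.
    by apply: (leaf_ind (Q := A) hL _ Lp Lq Ap) => a b; exact: same_plaque_clopen.
  rewrite (vnA p nAp) vnA//.
  apply: (leaf_ind (Q := ~` A) hL _ Lp Lq nAp) => a b; apply: same_plaque_clopen.
    exact: closed_openC.
  exact: open_closedC.
Qed.

Lemma ratio_first_integral (B : line_bundle M) (V : set (presection B)) k
    (t : 'I_k.+2 -> presection B) : linear_system V -> degenerate F V t ->
  (forall l : 'I_k.+2 -> K, (exists j, l j != 0) -> exists m x, ~ Dm F m t l x) ->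
  connected [set: M] -> has_first_integral F.
Proof.
move=> hV ht hmin cM; have [Vt it hD] := ht.
have gt j : global_section (t j) by have [h _ _] := hV; exact: h.
(* Minimality for the form d_0 fixes the order: at [x1] no nonzero combination flat to order m has
   d_0 = 0, so [x1] is off the indeterminacy locus. *)
have [m [x1 hx1]] := hmin _ (pform_neq0 _ None).
have hgood := hD m.
have aZ := indet_analytic F gt m.
have dZ : dense (~` indet F t m).
  apply: (analytic_dense cM aZ) => ZT; apply: hx1.
  by have [] : indet F t m x1 by rewrite ZT.
have key x : exists d : 'rV[K]_k.+2, [/\ d != 0, forall m', flS F m' (scomb (d 0) t) x &
    ~ indet F t m x -> on_line (sec_ratio F t m x) d].
  have [d d0 fd] := degenerate_limit hV x ht; exists d; split => // nZ.
  by rewrite (sec_ratioE gt nZ d0 (fd m)); exact: on_line_pt.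
exists 1%N, N, (sec_ratio F t m), (indet F t m); split.
- apply: (meromorphic_graph proj_line_compact aZ dZ (sec_ratio_holo gt hgood) (ratio_graph_analytic F gt m)).
  by move=> x y nZ; exact: (ratio_graph_sec_ratio gt hgood y nZ).
- have [x0 [_ nZ0]] : setT `&` ~` indet F t m !=set0.
    by apply: dZ; [have [x _] := mnonempty M; exists x|exact: openT].
  apply: contrapT => hn.
  have cst x : ~ indet F t m x -> sec_ratio F t m x = sec_ratio F t m x0.
    by move=> nZ; apply: contrapT => ne; apply: hn; exists x, x0.
  (* For a constant ratio, a combination flat to all orders at a point off the indeterminacy locus
     satisfies the form of this constant. The closed set [Dm] of this form then contains a dense
     set, for every order m', against minimality. *)
  have [m' [x' hx']] := hmin _ (pform_neq0 _ (sec_ratio F t m x0)).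
  have [cD _] := Dm_analytic F m' (pform (sec_ratio F t m x0)) gt.
  have sub : ~` indet F t m `<=` Dm F m' t (pform (sec_ratio F t m x0)).
    move=> x nZ; have [d [d0 fd /(_ nZ) ld]] := key x.
    by exists d => //; split => //; rewrite -(cst x nZ).
  by apply: hx'; rewrite (dense_closed dZ cD sub).
- move=> L y hL [p [Lp [fp nZp]]] q [Lq nZq]; rewrite /= -fp.
  have [d [d0 fd _]] := key p.
  have gd : global_section (scomb (d 0) t) by exact: scomb_global.
  have fq : forall m', flS F m' (scomb (d 0) t) q.
    apply: (leaf_ind (Q := fun x => forall m', flS F m' (scomb (d 0) t) x) hL _ Lp Lq fd).
    by move=> a b; exact: same_plaque_flat.
  by rewrite (sec_ratioE gt nZp d0 (fd m)) (sec_ratioE gt nZq d0 (fq m)).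
Qed.

End FirstIntegral.

Theorem theorem4 (R : realType) (n : nat) (M : complex_manifold R n)
    (F : foliation M) (B : line_bundle M) (V : set (presection B))
    (hV : linear_system V) (hVfin : finite_dimensional V)
    (Lambda : Type) (L : Lambda -> set M)
    (hL : forall i, is_leaf F (L i))
    (hflat : forall i, exists s : presection B,
       [/\ V s, s <> @zero_section R n M B & leaf_flat_contact F (L i) s])
    (hclosure : analytic_closure (\bigcup_i L i) = [set: M]) :
  has_first_integral F /\
  (forall L' : set M, is_leaf F L' ->
     exists s : presection B,
       [/\ V s, s <> @zero_section R n M B & leaf_flat_contact F L' s]).
Proof.
have [k [b [Vb ib sb]]] := independent_generators hVfin.
have hb := degenerate_generators hV hflat hclosure Vb ib sb.
split.
  have [cM|] := pselect (connected [set: M]).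
    have [k' [t [ht hmin]]] := degenerate_minimal hV hb.
    exact: (ratio_first_integral hV ht hmin cM).
  (* [connected] says that a nonempty set both open and closed is everything, so its negation yields
     a proper clopen set. *)
  move=> /existsNP[A /not_implyP[A0 /not_implyP[[C oC AC] /not_implyP[[D cD AD] AT]]]].
  rewrite setTI in AC; rewrite setTI in AD.
  by apply: (@locally_constant_first_integral _ _ _ F A) => //; [rewrite AC|rewrite AD].
move=> L' hL'; have [p0 rp0 L'E] := hL'.
have Lp0 : L' p0 by rewrite L'E; exact: Relation_Operators.rt_refl.
have [d d0 fd] := degenerate_limit hV p0 hb.
have gd : global_section (scomb (d 0) b).
  by apply: scomb_global => j; have [h _ _] := hV; exact: h.
exists (scomb (d 0) b); split.
- exact: V_scomb.
- by move=> /ib d0'; move: d0; rewrite d0' eqxx.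
- apply: leaf_flat_of_flS => p Lp.
  apply: (leaf_ind (Q := fun x => forall m, flS F m (scomb (d 0) b) x) hL' _ Lp0 Lp fd).
  by move=> x y; exact: same_plaque_flat.
Qed.
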